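(* Let $f$ be a continuous function on the closed unit disk $\bar D$ that is holomorphic in the open unit disk $D$, and let $f^\#$ be the function on $\mathbb{R}$ defined in the context. For $0<\alpha<2$ and $0<\lambda<1$, the following identities hold: $$\alpha\sum_{j=0}^\infty f^\#(\alpha j)\lambda^{\alpha j}=f(\lambda)-\frac{\alpha\lambda^\alpha\sin \alpha\pi}{\pi}\int_0^1\frac{t^{\alpha-1}f(-t)}{|t^\alpha-\lambda^\alpha e^{-i\alpha\pi}|^2}\,dt,\qquad (1)$$ $$\alpha\sum_{j=-\infty}^{-1} f^\#(\alpha j)\lambda^{-\alpha j}=\frac{\alpha\lambda^\alpha\sin \alpha\pi}{\pi}\int_0^1\frac{t^{\alpha-1}f(-t)}{|e^{-i\alpha\pi}-(\lambda t)^\alpha |^2}\,dt.\qquad (2)$$ In particular, $$\alpha\sum_{j=-\infty}^\infty f^\#(\alpha j)\lambda^{\alpha |j|}=f(\lambda)-\frac{\alpha\lambda^\alpha(1-\lambda^{2\alpha})\sin \alpha\pi}{\pi}\int_0^1\frac{t^{\alpha-1}(1-t^{2\alpha})f(-t)}{|(t^\alpha-\lambda^\alpha e^{-i\alpha\pi})(e^{-i\alpha\pi}-(\lambda t)^\alpha)|^2}\,dt.\qquad (3)$$ If, in addition, $$\sum_{j=-\infty}^\infty |f^\#(\alpha j)|<\infty,$$ then the identities (1), (2), (3) are also valid for $\lambda=1$; in particular, (3) becomes $$\alpha\sum_{j=-\infty}^\infty f^\#(\alpha j)=f(1).$$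
   Context: $D=\{z\in\mathbb{C}\mid |z|<1\}$ and $\bar D$ is its closure. For $f$ continuous on $\bar D$ and holomorphic in $D$, and for $\xi\in\mathbb{R}$, define $$f^\#(\xi):=\int_{-1/2}^{1/2}f(e^{2\pi ix})e^{-2\pi ix\xi}\,dx=\frac1{2\pi i}\int_C \frac{f(z)}{z^{\xi+1}}\,dz,$$ where $C$ is the oriented contour $(-1,1)\ni t\mapsto\exp(i\pi t)\in\mathbb{C}$ and $z^{\xi+1}=\exp\{(\xi+1)\operatorname{Log} z\}$ on $\mathbb{C}\setminus\{z\in\mathbb{R}\mid z\le0\}$, with the branch of $\operatorname{Log}$ such that $\operatorname{Log}1=0$. *)

(* Defs.v *)
From Stdlib Require Import Reals ZArith.
From Coquelicot Require Import Coquelicot.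
Open Scope R_scope.

(* [f : C -> C] is total; only its values on the closed unit disk matter.
   Continuity on the closed disk is continuity of the restriction of [f], so
   nothing is required when approaching the unit circle from outside. *)
Definition continuous_on_closed_disk (f : C -> C) : Prop :=
  forall z : C, Cmod z <= 1 ->
    filterlim f (within (fun w : C => Cmod w <= 1) (locally z)) (locally (f z)).

Definition holomorphic_in_disk (f : C -> C) : Prop :=
  forall z : C, Cmod z < 1 ->
    @ex_derive C_AbsRing C_NormedModule f z.

(* e^{i theta} *)
Definition expi (theta : R) : C := (cos theta, sin theta).

(* f^#(xi); for [f] continuous on the closed disk the integrand is continuous,
   so the total operator [RInt] is the actual integral. *)
Definition fsharp (f : C -> C) (xi : R) : C :=
  @RInt C_R_CompleteNormedModule
    (fun x : R => (f (expi (2 * PI * x)) * expi (- (2 * PI * x * xi)))%C)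
    (- (1 / 2)) (1 / 2).

Definition is_series_nonneg {K : AbsRing} {V : NormedModule K}
  (a : Z -> V) (l : V) : Prop :=
  is_series (fun n : nat => a (Z.of_nat n)) l.

(* sum over j = -1, -2, ... *)
Definition is_series_neg {K : AbsRing} {V : NormedModule K}
  (a : Z -> V) (l : V) : Prop :=
  is_series (fun n : nat => a (- Z.of_nat (S n))%Z) l.

(* A two-sided series converges when both halves do (not merely its symmetric
   partial sums). *)
Definition is_series_Z {K : AbsRing} {V : NormedModule K}
  (a : Z -> V) (l : V) : Prop :=
  exists l1 l2 : V,
    is_series_nonneg a l1 /\ is_series_neg a l2 /\ l = plus l1 l2.

(* Improper at 0, because of the factor t^(alpha-1) when alpha < 1. *)
Definition is_int_0_1 (g : R -> C) (l : C) : Prop :=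
  @is_RInt_gen C_R_NormedModule g (at_right 0) (at_point 1) l.

Definition identity1 (f : C -> C) (alpha lambda : R) : Prop :=
  exists S I : C,
    @is_series_nonneg R_AbsRing C_R_NormedModule
      (fun j : Z => (fsharp f (alpha * IZR j)
                     * RtoC (Rpower lambda (alpha * IZR j)))%C) S
    /\ is_int_0_1
      (fun t : R => (RtoC (Rpower t (alpha - 1)) * f (RtoC (- t))
        / RtoC (Cmod (RtoC (Rpower t alpha)
                      - RtoC (Rpower lambda alpha) * expi (- (alpha * PI))) ^ 2))%C) I
    /\ (RtoC alpha * S =
        f (RtoC lambda)
        - RtoC (alpha * Rpower lambda alpha * sin (alpha * PI) / PI) * I)%C.

Definition identity2 (f : C -> C) (alpha lambda : R) : Prop :=
  exists S I : C,
    @is_series_neg R_AbsRing C_R_NormedModule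
      (fun j : Z => (fsharp f (alpha * IZR j)
                     * RtoC (Rpower lambda (- (alpha * IZR j))))%C) S
    /\ is_int_0_1
      (fun t : R => (RtoC (Rpower t (alpha - 1)) * f (RtoC (- t))
        / RtoC (Cmod (expi (- (alpha * PI))
                      - RtoC (Rpower (lambda * t) alpha)) ^ 2))%C) I
    /\ (RtoC alpha * S =
        RtoC (alpha * Rpower lambda alpha * sin (alpha * PI) / PI) * I)%C.

Definition identity3 (f : C -> C) (alpha lambda : R) : Prop :=
  exists S I : C,
    @is_series_Z R_AbsRing C_R_NormedModule
      (fun j : Z => (fsharp f (alpha * IZR j)
                     * RtoC (Rpower lambda (alpha * IZR (Z.abs j))))%C) S
    /\ is_int_0_1
      (fun t : R => (RtoC (Rpower t (alpha - 1)) * RtoC (1 - Rpower t (2 * alpha))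
        * f (RtoC (- t))
        / RtoC (Cmod ((RtoC (Rpower t alpha)
                       - RtoC (Rpower lambda alpha) * expi (- (alpha * PI)))
                      * (expi (- (alpha * PI))
                         - RtoC (Rpower (lambda * t) alpha))) ^ 2))%C) I
    /\ (RtoC alpha * S =
        f (RtoC lambda)
        - RtoC (alpha * Rpower lambda alpha * (1 - Rpower lambda (2 * alpha))
                * sin (alpha * PI) / PI) * I)%C.

(* Main.v *)
(** With [z = e^w] the slit disk becomes the half-strip [Re w <= 0], [|Im w| <= PI], and
    [F w = f (e^w)] is holomorphic for [Re w < 0].  Summing the geometric series under the
    integral sign turns the two half-series into integrals of
    [F / (1 - lambda^alpha e^(-alpha w))] and of
    [F lambda^alpha e^(alpha w) / (1 - lambda^alpha e^(alpha w))] over the right edge of the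
    strip.  Goursat's theorem on [[-M, 0] x [-PI, PI]], [M -> oo], moves them to the two
    horizontal edges, i.e. to the two sides of the slit, whose difference is the kernel in
    (1) and (2).  The pole [w = ln lambda] of the first integrand is removed by replacing [F]
    by [F - f lambda]; what remains is the case [f = 1], an explicit [atan] computation.
    (3) is (1) + (2), and [lambda = 1] follows by Abel summation and dominated convergence. *)

Require Import Defs.
From Stdlib Require Import Reals ZArith Lra Lia Psatz Classical ClassicalEpsilon ssreflect.
From Coquelicot Require Import Coquelicot.
Open Scope R_scope.
Unset SsrRewrite.

(** * Topology and derivatives on the complex plane *)

(** Three obstacles shape the argument. (i) [f] is arbitrary outside the closed disk, whereas the
    right edge of every rectangle lies over the unit circle; so [f] is composed with the radial
    retraction onto the disk, which keeps its values there, and the work is done for a function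
    continuous on the whole plane. (ii) That function is known to be differentiable only inside, so
    Goursat's theorem is needed for continuity on the closed rectangle and differentiability in the
    interior. The same form copes with the pole: after subtraction of [f lambda] the integrand
    extends continuously over [ln lambda], and differentiability at that point is avoided by cutting
    the rectangle along the real axis, which puts the point on an edge. (iii) No further pole may
    enter the strip: the zeros of [1 - lambda^alpha e^(-alpha w)] are [2 PI / alpha] apart
    vertically, and [alpha < 2] leaves only the real one in [|Im w| <= PI]. The bounds on [alpha]
    also give [cos (alpha PI) < 1], hence lower bounds for the denominators of the kernels that
    persist at [lambda = 1]. *)

Lemma Cmod_sub_pair_le (x y u v : R) :
  Cmod ((u, v) - (x, y))%C <= Rabs (u - x) + Rabs (v - y).
Proof.
unfold Cmod; simpl.
rewrite <- (sqrt_Rsqr (Rabs (u - x) + Rabs (v - y)))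
  by (pose proof (Rabs_pos (u - x)); pose proof (Rabs_pos (v - y)); lra).
apply sqrt_le_1_alt; unfold Rsqr.
pose proof (Rabs_pos (u - x)); pose proof (Rabs_pos (v - y)).
assert (E1 : (u + - x) * ((u + - x) * 1) = Rabs (u - x) * Rabs (u - x))
  by (rewrite <- Rabs_mult, Rabs_pos_eq; [ring | apply Rle_0_sqr]).
assert (E2 : (v + - y) * ((v + - y) * 1) = Rabs (v - y) * Rabs (v - y))
  by (rewrite <- Rabs_mult, Rabs_pos_eq; [ring | apply Rle_0_sqr]).
rewrite E1, E2; nra.
Qed.

Lemma norm_C_R (z : C) : @norm R_AbsRing C_R_NormedModule z = Cmod z.
Proof.
unfold norm; simpl; unfold prod_norm, Cmod; simpl.
unfold norm; simpl; unfold abs; simpl.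
rewrite !Rmult_1_r, <- !Rabs_mult, !Rabs_pos_eq by apply Rle_0_sqr; reflexivity.
Qed.

Lemma ball_C_of_Cmod (x y : C) (eps : R) :
  Cmod (y - x)%C < eps -> @ball C_UniformSpace x eps y.
Proof. exact (C_NormedModule_mixin_compat1 x y eps). Qed.

(** Balls of the product structure on [C] are squares, so passing to the modulus costs a factor; 2
    is a crude substitute for the square root of 2. *)
Lemma Cmod_of_ball_C (x y : C) (eps : R) :
  @ball C_UniformSpace x eps y -> Cmod (y - x)%C < 2 * eps.
Proof.
intros [H1 H2]; destruct x as [x1 x2], y as [y1 y2].
eapply Rle_lt_trans; [apply Cmod_sub_pair_le|].
change (Rabs (y1 - x1) < eps) in H1; change (Rabs (y2 - x2) < eps) in H2; lra.
Qed.

Lemma filterlim_C_Cmod {T : Type} (F : (T -> Prop) -> Prop) {FF : Filter F}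
  (g : T -> C) (l : C) :
  filterlim g F (@locally C_UniformSpace l) <->
  forall eps, 0 < eps -> F (fun t => Cmod (g t - l)%C < eps).
Proof.
split; intros H.
- intros eps He.
  assert (He2 : 0 < eps / 2) by lra.
  specialize (H (@ball C_UniformSpace l (eps / 2))
     (locally_ball (T := C_UniformSpace) l (mkposreal _ He2))).
  unfold filtermap in H.
  apply: filter_imp H => t /Cmod_of_ball_C; lra.
- intros P [d Hd].
  apply: filter_imp (H d (cond_pos d)) => t Ht.
  apply Hd, ball_C_of_Cmod, Ht.
Qed.

Lemma locally_C_Cmod (z : C) (P : C -> Prop) :
  @locally C_UniformSpace z P <->
  exists d, 0 < d /\ forall w, Cmod (w - z)%C < d -> P w.
Proof.
split.
- intros [d Hd]; exists d; split; [apply cond_pos|].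
  intros w Hw; apply Hd, ball_C_of_Cmod, Hw.
- intros [d [Hd H]].
  assert (Hd2 : 0 < d / 2) by lra.
  exists (mkposreal _ Hd2); intros w Hw; apply H.
  apply Cmod_of_ball_C in Hw; simpl in Hw; lra.
Qed.

Notation ccontinuous f x := (@continuous _ C_UniformSpace f x).

Lemma ccontinuous_pair {U : UniformSpace} (g : U -> C) (x : U) :
  continuous (fun t => fst (g t)) x -> continuous (fun t => snd (g t)) x ->
  ccontinuous g x.
Proof.
intros H1 H2 P [d Hd].
pose proof (H1 _ (locally_ball (fst (g x)) d)) as K1.
pose proof (H2 _ (locally_ball (snd (g x)) d)) as K2.
unfold filtermap in *.
apply: filter_imp (filter_and _ _ K1 K2) => t [T1 T2].
apply Hd; split; assumption.
Qed.

Lemma ccontinuous_fst {U : UniformSpace} (g : U -> C) (x : U) :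
  ccontinuous g x -> continuous (fun t => fst (g t)) x.
Proof. 
intros H P [d Hd].
pose proof (H _ (locally_ball (T := C_UniformSpace) (g x) d)) as K.
unfold filtermap in *.
apply: filter_imp K => t [H1 H2].
apply Hd; assumption.
 Qed.

Lemma ccontinuous_snd {U : UniformSpace} (g : U -> C) (x : U) :
  ccontinuous g x -> continuous (fun t => snd (g t)) x.
Proof. 
intros H P [d Hd].
pose proof (H _ (locally_ball (T := C_UniformSpace) (g x) d)) as K.
unfold filtermap in *.
apply: filter_imp K => t [H1 H2].
apply Hd; assumption.
 Qed.

Lemma ccontinuous_mult {U : UniformSpace} (g h : U -> C) (x : U) :
  ccontinuous g x -> ccontinuous h x -> ccontinuous (fun t => (g t * h t)%C) x.
Proof.
intros Hg Hh; apply ccontinuous_pair; simpl.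
- apply: continuous_minus; apply: continuous_mult;
    (apply ccontinuous_fst || apply ccontinuous_snd); assumption.
- apply: continuous_plus; apply: continuous_mult;
    (apply ccontinuous_fst || apply ccontinuous_snd); assumption.
Qed.

Lemma ccontinuous_minus {U : UniformSpace} (g h : U -> C) (x : U) :
  ccontinuous g x -> ccontinuous h x -> ccontinuous (fun t => (g t - h t)%C) x.
Proof. exact (@continuous_minus U R_AbsRing C_R_NormedModule g h x). Qed.

Lemma ccontinuous_RtoC {U : UniformSpace} (g : U -> R) (x : U) :
  continuous g x -> ccontinuous (fun t => RtoC (g t)) x.
Proof.
intros H; apply ccontinuous_pair; simpl; [exact H | apply continuous_const].
Qed.

Lemma ccontinuous_inv {U : UniformSpace} (g : U -> C) (x : U) :
  ccontinuous g x -> g x <> 0%C -> ccontinuous (fun t => (/ g t)%C) x.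
Proof.
intros Hg H0.
assert (Hd : continuous (fun t => / (fst (g t) ^ 2 + snd (g t) ^ 2)) x).
{ apply (continuous_comp (fun t => fst (g t) ^ 2 + snd (g t) ^ 2) Rinv).
  - simpl; apply: continuous_plus; apply: continuous_mult;
      try apply: continuous_mult; try apply: continuous_const;
      (apply ccontinuous_fst || apply ccontinuous_snd); assumption.
  - apply continuous_Rinv; intros E; apply H0, Cmod_eq_0; unfold Cmod; rewrite E; apply sqrt_0. }
apply ccontinuous_pair; unfold Cinv; simpl fst; simpl snd; unfold Rdiv.
- apply: continuous_mult; [apply ccontinuous_fst|]; assumption.
- apply: continuous_mult; [|assumption].
  apply: continuous_opp; apply ccontinuous_snd; assumption.
Qed.

Lemma ccontinuous_div {U : UniformSpace} (g h : U -> C) (x : U) :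
  ccontinuous g x -> ccontinuous h x -> h x <> 0%C ->
  ccontinuous (fun t => (g t / h t)%C) x.
Proof.
intros Hg Hh H0; apply ccontinuous_mult; [|apply ccontinuous_inv]; assumption.
Qed.

Lemma continuous_Cmod_comp {U : UniformSpace} (g : U -> C) (x : U) :
  ccontinuous g x -> continuous (fun t => Cmod (g t)) x.
Proof.
intros H.
apply (continuous_comp (fun t => fst (g t) ^ 2 + snd (g t) ^ 2) sqrt);
  [simpl | apply continuous_sqrt].
apply: continuous_plus; apply: continuous_mult;
  try apply: continuous_mult; try apply: continuous_const;
  (apply ccontinuous_fst || apply ccontinuous_snd); assumption.
Qed.

(** Derivatives are taken with [C] as a module over itself, the setting of the ring-valued product
    rule; [ex_derive_is_cderive] carries over the hypothesis on [f], which is phrased with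
    [C_NormedModule]. *)
Notation is_cderive f z l :=
  (@is_derive C_AbsRing (AbsRing_NormedModule C_AbsRing) f z l).

Lemma is_cderive_eps (G : C -> C) (z l : C) :
  is_cderive G z l <->
  forall eps, 0 < eps -> exists d, 0 < d /\ forall w, Cmod (w - z)%C < d ->
    Cmod (G w - G z - (w - z) * l)%C <= eps * Cmod (w - z)%C.
Proof.
split.
- intros [_ H] eps He.
  destruct (H z (fun P HP => HP) (mkposreal _ He)) as [d Hd].
  exists d; split; [apply cond_pos|]; intros w Hw; exact (Hd w Hw).
- intros H; split; [apply is_linear_scal_l|].
  intros x Hx eps.
  assert (E : z = x) by exact (is_filter_lim_locally_unique
     (V := AbsRing_NormedModule C_AbsRing) z x Hx).
  subst x.
  destruct (H eps (cond_pos eps)) as [d [Hd K]].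
  exists (mkposreal _ Hd); intros w Hw; exact (K w Hw).
Qed.

Lemma ex_derive_is_cderive (f : C -> C) (z : C) :
  @ex_derive C_AbsRing C_NormedModule f z -> exists l, is_cderive f z l.
Proof.
intros [l [_ H]]; exists l; split; [apply is_linear_scal_l|exact H].
Qed.

Lemma ccontinuous_of_is_cderive (G : C -> C) (z l : C) :
  is_cderive G z l -> ccontinuous G z.
Proof.
intros H; apply is_cderive_eps with (eps := 1) in H; [|lra].
destruct H as [d [Hd H]].
apply filterlim_C_Cmod; [apply locally_filter|]; intros eps He.
apply locally_C_Cmod.
pose proof (Cmod_ge_0 l) as Hl.
exists (Rmin d (eps / (2 + Cmod l))); split.
{ apply Rmin_glb_lt; [exact Hd | apply Rdiv_lt_0_compat; lra]. }
intros w Hw.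
pose proof (Rlt_le_trans _ _ _ Hw (Rmin_l _ _)) as H1.
pose proof (Rlt_le_trans _ _ _ Hw (Rmin_r _ _)) as H2.
specialize (H w H1).
replace (G w - G z)%C with ((G w - G z - (w - z) * l) + (w - z) * l)%C by ring.
eapply Rle_lt_trans; [apply Cmod_triangle|].
rewrite Cmod_mult.
assert (Cmod (w - z) * (2 + Cmod l) < eps).
{ apply (Rmult_lt_compat_r (2 + Cmod l)) in H2; [|lra].
  replace (eps / (2 + Cmod l) * (2 + Cmod l)) with eps in H2 by (field; lra).
  exact H2. }
pose proof (Cmod_ge_0 (w - z)); nra.
Qed.

Lemma is_cderive_inv (G : C -> C) (z l : C) :
  is_cderive G z l -> G z <> 0%C ->
  is_cderive (fun w => / G w)%C z (- l / (G z * G z))%C.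
Proof.
intros HG H0.
assert (K : is_cderive Cinv (G z) (- / (G z * G z))%C).
{ set (u := G z) in *.
  apply is_cderive_eps; intros eps He.
  assert (Hu : 0 < Cmod u) by (apply Cmod_gt_0; exact H0).
  assert (Hu3 : 0 < Cmod u * (Cmod u * Cmod u)) by (repeat apply Rmult_lt_0_compat; lra).
  (* The first radius keeps [Cmod w] above [Cmod u / 2]; the second then bounds the remainder
     [(w - u)^2 / (w u^2)] by [eps * Cmod (w - u)]. *)
  exists (Rmin (Cmod u / 2) (eps * (Cmod u * (Cmod u * Cmod u)) / 2)); split.
  { apply Rmin_glb_lt; [lra|].
    apply Rdiv_lt_0_compat; [apply Rmult_lt_0_compat; assumption | lra]. }
  intros w Hw.
  pose proof (Rlt_le_trans _ _ _ Hw (Rmin_l _ _)) as H1.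
  pose proof (Rlt_le_trans _ _ _ Hw (Rmin_r _ _)) as H2.
  assert (Hw2 : Cmod u / 2 < Cmod w).
  { pose proof (Cmod_triangle w (- (w - u))) as T.
    rewrite Cmod_opp in T.
    replace (w + - (w - u))%C with u in T by ring. lra. }
  assert (Hw0 : w <> 0%C) by (apply Cmod_gt_0; lra).
  replace (/ w - / u - (w - u) * - / (u * u))%C
    with ((w - u) * ((w - u) * / (w * (u * u))))%C
    by (field; split; assumption).
  rewrite Cmod_mult, Rmult_comm.
  apply Rmult_le_compat_r; [apply Cmod_ge_0|].
  rewrite Cmod_mult, Cmod_inv, !Cmod_mult
    by (repeat apply Cmult_neq_0; assumption).
  apply Rmult_le_reg_r with (Cmod w * (Cmod u * Cmod u));
    [repeat apply Rmult_lt_0_compat; lra|].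
  rewrite Rmult_assoc, Rinv_l
    by (apply Rgt_not_eq; repeat apply Rmult_lt_0_compat; lra).
  pose proof (Cmod_ge_0 (w - u)).
  assert (Cmod u / 2 * (Cmod u * Cmod u) <= Cmod w * (Cmod u * Cmod u))
    by (apply Rmult_le_compat_r; nra).
  nra. }
pose proof (is_derive_comp (K := C_AbsRing) (V := AbsRing_NormedModule C_AbsRing)
  Cinv G z _ _ K HG) as D.
replace (- l / (G z * G z))%C with (@scal C_AbsRing (AbsRing_NormedModule C_AbsRing) l (- / (G z * G z))%C).
exact D.
change ((l * (- / (G z * G z)))%C = (- l / (G z * G z))%C).
unfold Cdiv; ring.
Qed.

Lemma is_cderive_mult (G H : C -> C) (z l m : C) :
  is_cderive G z l -> is_cderive H z m ->
  is_cderive (fun w => G w * H w)%C z (l * H z + G z * m)%C.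
Proof.
intros HG HH; exact (is_derive_mult (K := C_AbsRing) G H z l m HG HH Cmult_comm).
Qed.

Lemma is_cderive_comp (f g : C -> C) (z l m : C) :
  is_cderive f (g z) l -> is_cderive g z m ->
  is_cderive (fun w => f (g w)) z (m * l)%C.
Proof. exact (is_derive_comp (K := C_AbsRing) (V := AbsRing_NormedModule C_AbsRing) f g z l m). Qed.

Lemma is_cderive_affine (p q z : C) : is_cderive (fun w => p + q * w)%C z q.
Proof.
apply is_cderive_eps; intros eps He; exists 1; split; [lra|]; intros w _.
replace (p + q * w - (p + q * z) - (w - z) * q)%C with (RtoC 0) by ring.
rewrite Cmod_0; pose proof (Cmod_ge_0 (w - z)); nra.
Qed.

Lemma is_cderive_ext_loc (G H : C -> C) (z l : C) :
  (exists d, 0 < d /\ forall w, Cmod (w - z)%C < d -> G w = H w) ->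
  is_cderive G z l -> is_cderive H z l.
Proof.
intros [d [Hd E]] D; apply is_cderive_eps; intros eps He.
destruct (proj1 (is_cderive_eps _ _ _) D eps He) as [d' [Hd' K]].
exists (Rmin d d'); split; [apply Rmin_glb_lt; assumption|].
intros w Hw.
rewrite <- !E.
- apply K; eapply Rlt_le_trans; [exact Hw | apply Rmin_r].
- replace (z - z)%C with (RtoC 0) by ring; rewrite Cmod_0; exact Hd.
- eapply Rlt_le_trans; [exact Hw | apply Rmin_l].
Qed.

(** * The complex exponential and its derivative *)

Definition cexp (w : C) : C := (exp (fst w) * cos (snd w), exp (fst w) * sin (snd w)).

Lemma cexp_plus (u v : C) : cexp (u + v)%C = (cexp u * cexp v)%C.
Proof.
unfold cexp, Cmult, Cplus; simpl.
rewrite exp_plus, cos_plus, sin_plus; f_equal; ring.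
Qed.

Lemma Cmod_cexp (w : C) : Cmod (cexp w) = exp (fst w).
Proof.
unfold Cmod, cexp; simpl.
pose proof (sin2_cos2 (snd w)) as E; unfold Rsqr in E.
replace (_ + _) with (Rsqr (exp (fst w))) by (unfold Rsqr; nra).
apply sqrt_Rsqr, Rlt_le, exp_pos.
Qed.

(** The upper bound comes from [exp (- x) >= 1 - x]: it gives [exp x <= 1 / (1 - x)], and
    [1 / (1 - x) - 1 - x = x^2 / (1 - x)]. *)
Lemma exp_sub_affine_le (x : R) : Rabs x <= 1 / 2 -> 0 <= exp x - 1 - x <= 2 * x ^ 2.
Proof.
intros H; apply Rabs_le_between in H.
pose proof (exp_ineq1_le x) as H1.
pose proof (exp_ineq1_le (- x)) as H2.
pose proof (exp_pos x) as H3.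
assert (E : exp x * exp (- x) = 1) by (rewrite <- exp_plus, Rplus_opp_r, exp_0; ring).
split; [lra|].
assert (H4 : exp x * (1 - x) <= 1) by nra.
nra.
Qed.

Lemma one_sub_cos_le (y : R) : 0 <= 1 - cos y <= y ^ 2 / 2.
Proof.
pose proof (COS_bound y).
split; [lra|].
replace y with (2 * (y / 2)) at 1 by field.
rewrite cos_2a_sin.
assert (Rabs (sin (y / 2)) <= Rabs (y / 2)).
{ destruct (Req_dec y 0) as [->|Hy].
  - replace (0 / 2) with 0 by field; rewrite sin_0; lra.
  - destruct (MVT_cor4 sin cos 0 (Rabs (y / 2))) with (b := y / 2) as [c [Hc _]].
    + intros c _; apply is_derive_Reals, derivable_pt_lim_sin.
    + rewrite Rminus_0_r; lra.
    + rewrite sin_0, !Rminus_0_r in Hc; rewrite Hc, Rabs_mult.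
      pose proof (Rabs_pos (y / 2)).
      assert (Rabs (cos c) <= 1) by (apply Rabs_le; pose proof (COS_bound c); lra).
      nra. }
apply Rsqr_le_abs_1 in H0; unfold Rsqr in H0; nra.
Qed.

Lemma Rabs_sin_le (y : R) : Rabs (sin y) <= Rabs y.
Proof.
pose proof (one_sub_cos_le (2 * y)) as H; rewrite cos_2a_sin in H.
apply Rsqr_le_abs_0; unfold Rsqr; nra.
Qed.

Lemma Rabs_sin_sub_le (y : R) : Rabs (sin y - y) <= y ^ 2 * Rabs y.
Proof.
destruct (MVT_cor4 (fun t => sin t - t) (fun t => cos t - 1) 0 (Rabs y)) with (b := y) as [c [Hc Hc2]].
- intros c _; auto_derive; [trivial | ring].
- rewrite Rminus_0_r; lra.
- rewrite sin_0, !Rminus_0_r in *; rewrite Hc, Rabs_mult.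
  apply Rmult_le_compat_r; [apply Rabs_pos|].
  rewrite Rabs_minus_sym.
  pose proof (one_sub_cos_le c).
  rewrite Rabs_pos_eq; [|lra].
  apply Rsqr_le_abs_1 in Hc2; unfold Rsqr in Hc2; nra.
Qed.

Lemma is_cderive_cexp_0 : is_cderive cexp (RtoC 0) (RtoC 1).
Proof.
apply is_cderive_eps; intros eps He.
(* The two coordinates of the remainder are bounded by [3 m^2] and [5 m^2], with [m] the modulus of
   the increment, so [8 m <= eps] is enough; the radius 1/2 is what [exp_sub_affine_le] requires. *)
exists (Rmin (1 / 2) (eps / 20)); split; [apply Rmin_glb_lt; lra|].
intros [x y] Hw.
pose proof (Rlt_le_trans _ _ _ Hw (Rmin_l _ _)) as H1.
pose proof (Rlt_le_trans _ _ _ Hw (Rmin_r _ _)) as H2; clear Hw.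
replace ((x, y) - 0)%C with (x, y) in * by (unfold Cminus, Cplus, Copp; simpl; f_equal; ring).
pose proof (Rmax_Cmod (x, y)) as Hm; simpl in Hm.
pose proof (Rle_trans _ _ _ (Rmax_l _ _) Hm) as Hx.
pose proof (Rle_trans _ _ _ (Rmax_r _ _) Hm) as Hy.
set (m := Cmod (x, y)) in *.
replace (cexp (x, y) - cexp 0 - (x, y) * 1)%C with
  (((exp x * cos y - 1 - x)%R, (exp x * sin y - y)%R) - (0%R, 0%R))%C.
2:{ unfold cexp, Cminus, Cplus, Copp, Cmult; simpl.
    rewrite exp_0, cos_0, sin_0; f_equal; ring. }
eapply Rle_trans; [apply Cmod_sub_pair_le|].
rewrite !Rminus_0_r.
assert (Hm0 : 0 <= m) by apply Cmod_ge_0.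
assert (Hx2 : x ^ 2 <= m ^ 2).
{ rewrite <- (pow2_abs x); apply pow_incr; split; [apply Rabs_pos | exact Hx]. }
assert (Hy2 : y ^ 2 <= m ^ 2).
{ rewrite <- (pow2_abs y); apply pow_incr; split; [apply Rabs_pos | exact Hy]. }
pose proof (exp_sub_affine_le x ltac:(lra)) as Ex.
pose proof (one_sub_cos_le y) as Ec.
pose proof (Rabs_sin_le y) as Es.
pose proof (Rabs_sin_sub_le y) as Es2.
assert (He2 : 0 < exp x <= 2).
{ split; [apply exp_pos|].
  assert (Rabs x <= 1 / 2) as B by lra; apply Rabs_le_between in B; nra. }
assert (B1 : Rabs (exp x * cos y - 1 - x) <= 3 * m ^ 2).
{ replace (exp x * cos y - 1 - x) with ((exp x - 1 - x) - exp x * (1 - cos y)) by ring.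
  apply Rabs_le; nra. }
assert (B2 : Rabs (exp x * sin y - y) <= 5 * m ^ 2).
{ replace (exp x * sin y - y) with ((exp x - 1 - x) * sin y + (x * sin y + (sin y - y))) by ring.
  eapply Rle_trans; [apply Rabs_triang|].
  eapply Rle_trans; [apply Rplus_le_compat_l, Rabs_triang|].
  rewrite !Rabs_mult, (Rabs_pos_eq (exp x - 1 - x)) by lra.
  pose proof (Rabs_pos x); pose proof (Rabs_pos y); pose proof (Rabs_pos (sin y)).
  assert (Rabs (sin y) <= 1 / 2) by lra.
  assert ((exp x - 1 - x) * Rabs (sin y) <= m ^ 2) by nra.
  assert (Rabs x * Rabs (sin y) <= m ^ 2) by nra.
  assert (y ^ 2 * Rabs y <= m ^ 2) by nra.
  lra. }
nra.
Qed.

(** The addition theorem [cexp w = cexp z * cexp (w - z)] transports the derivative from 0 to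
    [z]. *)
Lemma is_cderive_cexp (z : C) : is_cderive cexp z (cexp z).
Proof.
apply is_cderive_ext_loc with (fun w => 0 + cexp z * cexp (- z + 1 * w))%C.
{ exists 1; split; [lra|]; intros w _.
  rewrite Cplus_0_l, <- cexp_plus; f_equal; ring. }
pose proof (is_cderive_comp (fun w => 0 + cexp z * w)%C (fun w => cexp (- z + 1 * w)%C) z
  (cexp z) (1 * 1)%C) as D.
replace (1 * 1 * cexp z)%C with (cexp z) in D by ring.
apply D; [apply is_cderive_affine|].
apply (is_cderive_comp cexp (fun w => - z + 1 * w)%C); [|apply is_cderive_affine].
replace (- z + 1 * z)%C with (RtoC 0) by ring; apply is_cderive_cexp_0.
Qed.

(** * Goursat's theorem for rectangles *)

Notation is_cint := (@is_RInt C_R_NormedModule).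
Notation cint := (@RInt C_R_CompleteNormedModule).

Lemma is_cint_of_continuous (g : R -> C) (a b : R) :
  (forall x, Rmin a b <= x <= Rmax a b -> ccontinuous g x) ->
  is_cint g a b (cint g a b).
Proof.
intros H; apply (RInt_correct (V := C_R_CompleteNormedModule)).
apply (ex_RInt_continuous (V := C_R_CompleteNormedModule)); exact H.
Qed.

Lemma is_cint_pair (g : R -> C) (a b lu lv : R) :
  is_RInt (fun t => fst (g t)) a b lu -> is_RInt (fun t => snd (g t)) a b lv ->
  is_cint g a b (lu, lv).
Proof. exact (is_RInt_fct_extend_pair (U := R_NormedModule) (V := R_NormedModule) g a b lu lv). Qed.

Lemma is_cint_mult (g : R -> C) (a b : R) (c l : C) :
  is_cint g a b l -> is_cint (fun t => c * g t)%C a b (c * l)%C.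
Proof.
intros H.
pose proof (is_RInt_fct_extend_fst (U := R_NormedModule) (V := R_NormedModule) g a b l H) as H1.
pose proof (is_RInt_fct_extend_snd (U := R_NormedModule) (V := R_NormedModule) g a b l H) as H2.
apply is_cint_pair; simpl.
- apply: is_RInt_minus; apply: is_RInt_scal; assumption.
- apply: is_RInt_plus; apply: is_RInt_scal; assumption.
Qed.

Lemma is_cint_plus (g h : R -> C) (a b : R) (lg lh : C) :
  is_cint g a b lg -> is_cint h a b lh ->
  is_cint (fun t => g t + h t)%C a b (lg + lh)%C.
Proof. exact (@is_RInt_plus C_R_NormedModule g h a b lg lh). Qed.

Lemma is_cint_minus (g h : R -> C) (a b : R) (lg lh : C) :
  is_cint g a b lg -> is_cint h a b lh ->
  is_cint (fun t => g t - h t)%C a b (lg - lh)%C.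
Proof. exact (@is_RInt_minus C_R_NormedModule g h a b lg lh). Qed.

Lemma is_cint_Chasles (g : R -> C) (a b c : R) (l m : C) :
  is_cint g a b l -> is_cint g b c m -> is_cint g a c (l + m)%C.
Proof. exact (@is_RInt_Chasles C_R_NormedModule g a b c l m). Qed.

Lemma is_cint_unique (g : R -> C) (a b : R) (l : C) :
  is_cint g a b l -> cint g a b = l.
Proof. exact (@is_RInt_unique C_R_CompleteNormedModule g a b l). Qed.

Lemma is_cint_ext (g h : R -> C) (a b : R) (l : C) :
  (forall x, Rmin a b < x < Rmax a b -> g x = h x) ->
  is_cint g a b l -> is_cint h a b l.
Proof. exact (@is_RInt_ext C_R_NormedModule g h a b l). Qed.

Lemma is_cint_const (c : C) (a b : R) : is_cint (fun _ => c) a b (RtoC (b - a) * c)%C.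
Proof.
pose proof (@is_RInt_const C_R_NormedModule a b c) as H.
replace (RtoC (b - a) * c)%C with (@scal R_AbsRing C_R_NormedModule (b - a) c); [exact H|].
destruct c as [c1 c2]; unfold scal; simpl; unfold prod_scal; simpl; unfold scal; simpl;
  unfold mult; simpl.
unfold Cmult; simpl; f_equal; ring.
Qed.

Lemma Cmod_cint_le (g : R -> C) (a b M : R) (l : C) :
  a <= b -> (forall x, a <= x <= b -> Cmod (g x) <= M) ->
  is_cint g a b l -> Cmod l <= (b - a) * M.
Proof.
intros Hab HM Hg; rewrite <- norm_C_R.
apply (norm_RInt_le_const (V := C_R_NormedModule) g a b l M); try assumption.
intros x Hx; rewrite norm_C_R; apply HM, Hx.
Qed.

(** The counterclockwise integral of [G dz] over the boundary: bottom minus top, plus right minus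
    left with [dz = i dy]. *)
Definition rect_int (G : C -> C) (a b c d : R) : C :=
  (cint (fun x => G (x, c)) a b - cint (fun x => G (x, d)) a b
   + Ci * (cint (fun y => G (b, y)) c d - cint (fun y => G (a, y)) c d))%C.

(** Continuity is asked in the plane, also at boundary points, and not just relative to the
    rectangle; this is the form that uniform continuity in two variables consumes. *)
Definition rect_continuous (G : C -> C) (a b c d : R) : Prop :=
  forall x y, a <= x <= b -> c <= y <= d -> ccontinuous G (x, y).

Lemma ccontinuous_horizontal (G : C -> C) (x y : R) :
  ccontinuous G (x, y) -> ccontinuous (fun t : R => G (t, y)) x.
Proof.
intros H; apply (continuous_comp (V := C_UniformSpace) (fun t : R => (t, y)) G); [|exact H].
apply ccontinuous_pair; simpl; [apply continuous_id | apply continuous_const].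
Qed.

Lemma ccontinuous_vertical (G : C -> C) (x y : R) :
  ccontinuous G (x, y) -> ccontinuous (fun t : R => G (x, t)) y.
Proof.
intros H; apply (continuous_comp (V := C_UniformSpace) (fun t : R => (x, t)) G); [|exact H].
apply ccontinuous_pair; simpl; [apply continuous_const | apply continuous_id].
Qed.

Lemma is_cint_horizontal (G : C -> C) (a b c d a' b' y : R) :
  rect_continuous G a b c d -> a <= a' -> a' <= b' -> b' <= b -> c <= y <= d ->
  is_cint (fun x => G (x, y)) a' b' (cint (fun x => G (x, y)) a' b').
Proof.
intros H H1 H2 H3 Hy; apply is_cint_of_continuous; intros x Hx.
rewrite Rmin_left, Rmax_right in Hx by lra.
apply ccontinuous_horizontal, H; lra.
Qed.

Lemma is_cint_vertical (G : C -> C) (a b c d c' d' x : R) :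
  rect_continuous G a b c d -> c <= c' -> c' <= d' -> d' <= d -> a <= x <= b ->
  is_cint (fun y => G (x, y)) c' d' (cint (fun y => G (x, y)) c' d').
Proof.
intros H H1 H2 H3 Hx; apply is_cint_of_continuous; intros y Hy.
rewrite Rmin_left, Rmax_right in Hy by lra.
apply ccontinuous_vertical, H; lra.
Qed.

Lemma rect_continuous_sub (G : C -> C) (a b c d a' b' c' d' : R) :
  a <= a' -> b' <= b -> c <= c' -> d' <= d ->
  rect_continuous G a b c d -> rect_continuous G a' b' c' d'.
Proof. intros; intros x y Hx Hy; apply H3; lra. Qed.

Lemma rect_int_split_x (G : C -> C) (a m b c d : R) :
  a <= m -> m <= b -> c <= d -> rect_continuous G a b c d ->
  rect_int G a b c d = (rect_int G a m c d + rect_int G m b c d)%C.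
Proof.
intros Ham Hmb Hcd H; unfold rect_int.
rewrite (is_cint_unique _ _ _ _ (is_cint_Chasles _ _ _ _ _ _
  (is_cint_horizontal G a b c d a m c H ltac:(lra) ltac:(lra) ltac:(lra) ltac:(lra))
  (is_cint_horizontal G a b c d m b c H ltac:(lra) ltac:(lra) ltac:(lra) ltac:(lra)))).
rewrite (is_cint_unique _ _ _ _ (is_cint_Chasles _ _ _ _ _ _
  (is_cint_horizontal G a b c d a m d H ltac:(lra) ltac:(lra) ltac:(lra) ltac:(lra))
  (is_cint_horizontal G a b c d m b d H ltac:(lra) ltac:(lra) ltac:(lra) ltac:(lra)))).
ring.
Qed.

Lemma rect_int_split_y (G : C -> C) (a b c m d : R) :
  a <= b -> c <= m -> m <= d -> rect_continuous G a b c d ->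
  rect_int G a b c d = (rect_int G a b c m + rect_int G a b m d)%C.
Proof.
intros Hab Hcm Hmd H; unfold rect_int.
rewrite (is_cint_unique _ _ _ _ (is_cint_Chasles _ _ _ _ _ _
  (is_cint_vertical G a b c d c m b H ltac:(lra) ltac:(lra) ltac:(lra) ltac:(lra))
  (is_cint_vertical G a b c d m d b H ltac:(lra) ltac:(lra) ltac:(lra) ltac:(lra)))).
rewrite (is_cint_unique _ _ _ _ (is_cint_Chasles _ _ _ _ _ _
  (is_cint_vertical G a b c d c m a H ltac:(lra) ltac:(lra) ltac:(lra) ltac:(lra))
  (is_cint_vertical G a b c d m d a H ltac:(lra) ltac:(lra) ltac:(lra) ltac:(lra)))).
ring.
Qed.

Lemma is_cint_affine_horizontal (p q : C) (a b y : R) :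
  is_cint (fun x => p + (x, y) * q)%C a b
    (RtoC (b - a) * p + q * (((b ^ 2 - a ^ 2) / 2)%R, ((b - a) * y)%R))%C.
Proof.
apply is_cint_plus; [apply is_cint_const|].
apply is_cint_ext with (fun x => q * (x, y))%C; [intros; apply Cmult_comm|].
apply is_cint_mult, is_cint_pair; simpl.
- replace ((b * (b * 1) - a * (a * 1)) / 2) with (minus (b ^ 2 / 2) (a ^ 2 / 2))
    by (unfold minus, plus, opp; simpl; field).
  apply (is_RInt_derive (V := R_CompleteNormedModule) (fun x => x ^ 2 / 2)); intros x _.
  + auto_derive; [trivial | field].
  + apply continuous_id.
- apply: is_RInt_const.
Qed.

Lemma is_cint_affine_vertical (p q : C) (c d x : R) :
  is_cint (fun y => p + (x, y) * q)%C c d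
    (RtoC (d - c) * p + q * (((d - c) * x)%R, ((d ^ 2 - c ^ 2) / 2)%R))%C.
Proof.
apply is_cint_plus; [apply is_cint_const|].
apply is_cint_ext with (fun y => q * (x, y))%C; [intros; apply Cmult_comm|].
apply is_cint_mult, is_cint_pair; simpl.
- apply: is_RInt_const.
- replace ((d * (d * 1) - c * (c * 1)) / 2) with (minus (d ^ 2 / 2) (c ^ 2 / 2))
    by (unfold minus, plus, opp; simpl; field).
  apply (is_RInt_derive (V := R_CompleteNormedModule) (fun x => x ^ 2 / 2)); intros y _.
  + auto_derive; [trivial | field].
  + apply continuous_id.
Qed.

(** An affine function has zero boundary integral, so only the deviation from it counts, and it is
    at most [M] along the whole perimeter. *)
Lemma rect_int_near_affine (G : C -> C) (p q : C) (a b c d M : R) :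
  a <= b -> c <= d -> rect_continuous G a b c d ->
  (forall x y, a <= x <= b -> c <= y <= d ->
     Cmod (G (x, y) - (p + (x, y) * q))%C <= M) ->
  Cmod (rect_int G a b c d) <= 2 * (b - a + (d - c)) * M.
Proof.
intros Hab Hcd H HM.
set (A := fun z : C => (p + z * q)%C).
assert (HH : forall y, c <= y <= d ->
  Cmod (cint (fun x => G (x, y)) a b -
    (RtoC (b - a) * p + q * (((b ^ 2 - a ^ 2) / 2)%R, ((b - a) * y)%R)))%C <= (b - a) * M).
{ intros y Hy.
  eapply Cmod_cint_le; [exact Hab| |].
  2: apply is_cint_minus;
     [apply (is_cint_horizontal G a b c d); lra || assumption | apply is_cint_affine_horizontal].
  intros x Hx; apply HM; assumption. }
assert (HV : forall x, a <= x <= b ->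
  Cmod (cint (fun y => G (x, y)) c d -
    (RtoC (d - c) * p + q * (((d - c) * x)%R, ((d ^ 2 - c ^ 2) / 2)%R)))%C <= (d - c) * M).
{ intros x Hx.
  eapply Cmod_cint_le; [exact Hcd| |].
  2: apply is_cint_minus;
     [apply (is_cint_vertical G a b c d); lra || assumption | apply is_cint_affine_vertical].
  intros y Hy; apply HM; assumption. }
pose proof (HH c ltac:(lra)) as E1; pose proof (HH d ltac:(lra)) as E2.
pose proof (HV b ltac:(lra)) as E3; pose proof (HV a ltac:(lra)) as E4.
unfold rect_int.
match type of E1 with Cmod ?e <= _ => set (e1 := e) in * end.
match type of E2 with Cmod ?e <= _ => set (e2 := e) in * end.
match type of E3 with Cmod ?e <= _ => set (e3 := e) in * end.
match type of E4 with Cmod ?e <= _ => set (e4 := e) in * end.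
(* The explicit affine contributions cancel here: [e1] to [e4] are the deviations on the four
   edges. *)
replace (_ - _ + _)%C with (e1 + - e2 + Ci * (e3 + - e4))%C.
- eapply Rle_trans; [apply Cmod_triangle|].
  rewrite Cmod_mult, Cmod_Ci, Rmult_1_l.
  pose proof (Cmod_triangle e1 (- e2)) as T1; pose proof (Cmod_triangle e3 (- e4)) as T2.
  rewrite Cmod_opp in T1, T2; lra.
- unfold e1, e2, e3, e4; clear.
  generalize (cint (fun x => G (x, c)) a b) (cint (fun x => G (x, d)) a b)
    (cint (fun y => G (b, y)) c d) (cint (fun y => G (a, y)) c d).
  intros [? ?] [? ?] [? ?] [? ?]; destruct p, q.
  unfold Cminus, Cplus, Copp, Cmult, Ci, RtoC; simpl; f_equal; field.
Qed.

(** * Bisection of rectangles and Goursat's argument *)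

Lemma nested_intervals (u v : nat -> R) :
  (forall n, u n <= u (S n)) -> (forall n, v (S n) <= v n) -> (forall n, u n <= v n) ->
  exists x, forall n, u n <= x <= v n.
Proof.
intros Hu Hv Huv.
assert (Mu : forall n k, u n <= u (n + k)%nat).
{ intros n k; induction k as [|k IH]; [rewrite Nat.add_0_r; lra|].
  rewrite Nat.add_succ_r; eapply Rle_trans; [exact IH | apply Hu]. }
assert (Mv : forall n k, v (n + k)%nat <= v n).
{ intros n k; induction k as [|k IH]; [rewrite Nat.add_0_r; lra|].
  rewrite Nat.add_succ_r; eapply Rle_trans; [apply Hv | exact IH]. }
assert (Muv : forall n m, u n <= v m).
{ intros n m; eapply Rle_trans; [apply (Mu n m)|].
  eapply Rle_trans; [apply Huv|]; rewrite Nat.add_comm; apply Mv. }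
destruct (completeness (fun r => exists n, r = u n)) as [x [Hx1 Hx2]].
- exists (v 0%nat); intros r [n ->]; apply Muv.
- exists (u 0%nat), 0%nat; reflexivity.
- exists x; intros n; split.
  + apply Hx1; exists n; reflexivity.
  + apply Hx2; intros r [m ->]; apply Muv.
Qed.

Definition rect : Type := ((R * R) * (R * R))%type.

Definition is_quarter (r s : rect) : Prop :=
  let '((a, b), (c, d)) := r in
  let m := (a + b) / 2 in let n := (c + d) / 2 in
  (fst s = (a, m) \/ fst s = (m, b)) /\ (snd s = (c, n) \/ snd s = (n, d)).

(** Compactness in the form that Goursat's argument uses: a property inherited by some quarter of
    each rectangle holds on arbitrarily small rectangles around one point. *)
Lemma rect_bisection (P : rect -> Prop) (a b c d : R) :
  a < b -> c < d ->
  (forall r, P r -> exists s, is_quarter r s /\ P s) ->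
  P ((a, b), (c, d)) ->
  exists x y, a <= x <= b /\ c <= y <= d /\
    forall eps, 0 < eps -> exists a' b' c' d',
      a <= a' <= x /\ x <= b' <= b /\ c <= c' <= y /\ y <= d' <= d /\
      0 < b' - a' + (d' - c') < eps /\ P ((a', b'), (c', d')).
Proof.
intros Hab Hcd Hstep H0.
(* [epsilon] turns the existence of a good quarter into a total function; that the choice is good is
   recovered in [HP], along the orbit where the property holds. *)
set (next := fun r : rect => epsilon (inhabits r) (fun s => is_quarter r s /\ P s)).
set (seq := fix seq (n : nat) : rect :=
  match n with O => ((a, b), (c, d)) | S n => next (seq n) end).
assert (HP : forall n, P (seq n) /\ is_quarter (seq n) (seq (S n))).
{ assert (K : forall r, P r -> is_quarter r (next r) /\ P (next r))
    by (intros r Hr; apply (epsilon_spec (inhabits r) (fun s => is_quarter r s /\ P s)), Hstep, Hr).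
  intros n; induction n as [|n [IH1 IH2]].
  - split; [exact H0 | apply K; exact H0].
  - assert (P (seq (S n))) by (apply K; exact IH1).
    split; [assumption | apply K; assumption]. }
set (A n := fst (fst (seq n))); set (B n := snd (fst (seq n))).
set (C' n := fst (snd (seq n))); set (D n := snd (snd (seq n))).
assert (Hw : forall n, B n - A n = (b - a) / 2 ^ n /\ D n - C' n = (d - c) / 2 ^ n).
{ intros n; induction n as [|n [IH1 IH2]].
  - unfold A, B, C', D; simpl; split; field.
  - destruct (HP n) as [_ Hq].
    unfold A, B, C', D in *; clearbody seq.
    destruct (seq n) as [[a1 b1] [c1 d1]], (seq (S n)) as [[a2 b2] [c2 d2]].
    simpl in *; destruct Hq as [Hx Hy].
    assert (Hp : 2 ^ n <> 0) by (apply pow_nonzero; lra).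
    split.
    + apply (f_equal (fun r => r / 2)) in IH1.
      replace ((b - a) / (2 * 2 ^ n)) with ((b - a) / 2 ^ n / 2) by (field; exact Hp).
      rewrite <- IH1; destruct Hx as [Hx|Hx]; inversion Hx; field.
    + apply (f_equal (fun r => r / 2)) in IH2.
      replace ((d - c) / (2 * 2 ^ n)) with ((d - c) / 2 ^ n / 2) by (field; exact Hp).
      rewrite <- IH2; destruct Hy as [Hy|Hy]; inversion Hy; field. }
assert (Hpow : forall n, 0 < 2 ^ n) by (intros n; apply pow_lt; lra).
assert (HAB : forall n, A n < B n).
{ intros n; destruct (Hw n) as [E _].
  assert (0 < (b - a) / 2 ^ n) by (apply Rdiv_lt_0_compat; [lra | apply Hpow]); lra. }
assert (HCD : forall n, C' n < D n).
{ intros n; destruct (Hw n) as [_ E].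
  assert (0 < (d - c) / 2 ^ n) by (apply Rdiv_lt_0_compat; [lra | apply Hpow]); lra. }
assert (Hmono : forall n, (A n <= A (S n) /\ B (S n) <= B n) /\ (C' n <= C' (S n) /\ D (S n) <= D n)).
{ intros n; specialize (HAB n); specialize (HCD n); destruct (HP n) as [_ Hq].
  unfold A, B, C', D in *; clearbody seq.
  destruct (seq n) as [[a1 b1] [c1 d1]], (seq (S n)) as [[a2 b2] [c2 d2]].
  simpl in *; destruct Hq as [Hx Hy].
  split; [destruct Hx as [Hx|Hx] | destruct Hy as [Hy|Hy]]; [inversion Hx | inversion Hx | inversion Hy | inversion Hy]; lra. }
destruct (nested_intervals A B) as [x Hx];
  try (intros n; destruct (Hmono n); specialize (HAB n); lra).
destruct (nested_intervals C' D) as [y Hy];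
  try (intros n; destruct (Hmono n); specialize (HCD n); lra).
assert (Hin : forall n, (a <= A n /\ B n <= b) /\ (c <= C' n /\ D n <= d)).
{ intros n; induction n as [|n IH]; [unfold A, B, C', D; simpl; lra|].
  specialize (Hmono n); lra. }
exists x, y; split; [exact (Hx 0%nat)|]; split; [exact (Hy 0%nat)|].
intros eps He.
destruct (pow_lt_1_zero (1 / 2)) with (y := eps / (b - a + (d - c))) as [N HN].
{ rewrite Rabs_pos_eq; lra. }
{ apply Rdiv_lt_0_compat; lra. }
specialize (HN N (le_n N)).
exists (A N), (B N), (C' N), (D N).
specialize (Hx N); specialize (Hy N); specialize (Hin N).
specialize (HAB N); specialize (HCD N).
repeat split; try lra.
- destruct (Hw N) as [-> ->].
  rewrite Rabs_pos_eq in HN by (apply pow_le; lra).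
  unfold Rdiv in HN at 1; rewrite Rmult_1_l, pow_inv in HN.
  replace ((b - a) / 2 ^ N + (d - c) / 2 ^ N) with (/ 2 ^ N * (b - a + (d - c)))
    by (field; apply Rgt_not_eq, Hpow).
  apply (Rmult_lt_compat_r (b - a + (d - c))) in HN; [|lra].
  replace (eps / (b - a + (d - c)) * (b - a + (d - c))) with eps in HN by (field; lra).
  exact HN.
- destruct (HP N) as [K _].
  unfold A, B, C', D; destruct (seq N) as [[? ?] [? ?]]; exact K.
Qed.

(** Bisection keeps the integral at least [k] times the squared half-perimeter [L'^2]. Near the
    limit point differentiability makes [G] affine up to [(k / 4) L'], which bounds the integral by
    [(k / 2) L'^2], a contradiction. *)
Lemma rect_int_of_cderive (G : C -> C) (a b c d : R) :
  a < b -> c < d ->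
  (forall x y, a <= x <= b -> c <= y <= d -> exists l, is_cderive G (x, y) l) ->
  rect_int G a b c d = 0%C.
Proof.
intros Hab Hcd HG.
assert (Hcont : rect_continuous G a b c d).
{ intros x y Hx Hy; destruct (HG x y Hx Hy) as [l Hl].
  exact (ccontinuous_of_is_cderive _ _ _ Hl). }
apply NNPP; intros Hne.
apply Cmod_gt_0 in Hne.
set (L := b - a + (d - c)).
assert (HL : 0 < L) by (unfold L; lra).
(* Scaled so that the whole rectangle attains the bound with equality. Halving divides the squared
   half-perimeter by 4, so four quarters below the bound would sum to less than their parent. *)
set (k := Cmod (rect_int G a b c d) / L ^ 2).
assert (Hk : 0 < k) by (apply Rdiv_lt_0_compat; [exact Hne | apply pow_lt, HL]).
set (P := fun r : rect => let '((a', b'), (c', d')) := r in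
  ((a <= a' /\ a' <= b' /\ b' <= b) /\ (c <= c' /\ c' <= d' /\ d' <= d)) /\
  k * (b' - a' + (d' - c')) ^ 2 <= Cmod (rect_int G a' b' c' d')).
destruct (rect_bisection P a b c d Hab Hcd) as [x [y [Hx [Hy K]]]].
- intros [[a1 b1] [c1 d1]] [[H1 H2] H3].
  assert (Hc1 : rect_continuous G a1 b1 c1 d1)
    by (apply (rect_continuous_sub G a b c d); lra || assumption).
  set (m := (a1 + b1) / 2) in *; set (n := (c1 + d1) / 2) in *.
  assert (Em : b1 - a1 = 2 * (m - a1) /\ b1 - m = m - a1) by (unfold m; lra).
  assert (En : d1 - c1 = 2 * (n - c1) /\ d1 - n = n - c1) by (unfold n; lra).
  destruct (classic (P ((a1, m), (c1, n)))) as [Q|Q1].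
  { exists ((a1, m), (c1, n)); split; [simpl; auto | exact Q]. }
  destruct (classic (P ((m, b1), (c1, n)))) as [Q|Q2].
  { exists ((m, b1), (c1, n)); split; [simpl; auto | exact Q]. }
  destruct (classic (P ((a1, m), (n, d1)))) as [Q|Q3].
  { exists ((a1, m), (n, d1)); split; [simpl; auto | exact Q]. }
  destruct (classic (P ((m, b1), (n, d1)))) as [Q|Q4].
  { exists ((m, b1), (n, d1)); split; [simpl; auto | exact Q]. }
  exfalso.
  unfold P in Q1, Q2, Q3, Q4.
  assert (B1 : Cmod (rect_int G a1 m c1 n) < k * (m - a1 + (n - c1)) ^ 2)
    by (apply Rnot_le_lt; intros B; apply Q1; split; [lra | exact B]).
  assert (B2 : Cmod (rect_int G m b1 c1 n) < k * (b1 - m + (n - c1)) ^ 2)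
    by (apply Rnot_le_lt; intros B; apply Q2; split; [lra | exact B]).
  assert (B3 : Cmod (rect_int G a1 m n d1) < k * (m - a1 + (d1 - n)) ^ 2)
    by (apply Rnot_le_lt; intros B; apply Q3; split; [lra | exact B]).
  assert (B4 : Cmod (rect_int G m b1 n d1) < k * (b1 - m + (d1 - n)) ^ 2)
    by (apply Rnot_le_lt; intros B; apply Q4; split; [lra | exact B]).
  rewrite (rect_int_split_x G a1 m b1 c1 d1) in H3 by (lra || assumption).
  rewrite (rect_int_split_y G a1 m c1 n d1), (rect_int_split_y G m b1 c1 n d1) in H3
    by (lra || (apply (rect_continuous_sub G a1 b1 c1 d1); lra || assumption)).
  destruct Em as [Em1 Em2], En as [En1 En2].
  rewrite Em1, En1 in H3; rewrite Em2 in B2, B4; rewrite En2 in B3, B4.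
  pose proof (Cmod_triangle (rect_int G a1 m c1 n + rect_int G a1 m n d1)
    (rect_int G m b1 c1 n + rect_int G m b1 n d1)) as T.
  pose proof (Cmod_triangle (rect_int G a1 m c1 n) (rect_int G a1 m n d1)) as T1.
  pose proof (Cmod_triangle (rect_int G m b1 c1 n) (rect_int G m b1 n d1)) as T2.
  nra.
- split; [lra|]; unfold k; fold L.
  right; field; lra.
- destruct (HG x y Hx Hy) as [l Hl].
  destruct (proj1 (is_cderive_eps _ _ _) Hl (k / 4) ltac:(lra)) as [e [He Hd]].
  destruct (K e He) as [a' [b' [c' [d' [Ha [Hb [Hc [Hd' [HL' [_ HP]]]]]]]]]].
  set (L' := b' - a' + (d' - c')) in *.
  pose proof (rect_int_near_affine G (G (x, y) - (x, y) * l)%C l a' b' c' d' (k / 4 * L')) as B.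
  assert (Cmod (rect_int G a' b' c' d') <= 2 * L' * (k / 4 * L')).
  { apply B; try lra.
    - apply (rect_continuous_sub G a b c d); lra || assumption.
    - intros u v Hu Hv.
      assert (Hdist : Cmod ((u, v) - (x, y))%C <= L').
      { eapply Rle_trans; [apply Cmod_sub_pair_le|].
        assert (Rabs (u - x) <= b' - a') by (apply Rabs_le; lra).
        assert (Rabs (v - y) <= d' - c') by (apply Rabs_le; lra).
        unfold L'; lra. }
      replace (G (u, v) - (G (x, y) - (x, y) * l + (u, v) * l))%C with
        (G (u, v) - G (x, y) - ((u, v) - (x, y)) * l)%C by ring.
      eapply Rle_trans; [apply Hd; lra|].
      apply Rmult_le_compat_l; lra. }
  change (k * L' ^ 2 <= Cmod (rect_int G a' b' c' d')) in HP.

  assert (0 < k * (L' * L')) by (apply Rmult_lt_0_compat; [exact Hk | nra]).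
  lra.
Qed.

(** * Goursat's theorem with mere continuity on the boundary *)

Lemma rect_uniform_continuity (G : C -> C) (a b c d : R) :
  rect_continuous G a b c d ->
  forall eps, 0 < eps -> exists delta, 0 < delta /\ forall x y u v,
    a <= x <= b -> c <= y <= d -> a <= u <= b -> c <= v <= d ->
    Rabs (u - x) < delta -> Rabs (v - y) < delta ->
    Cmod (G (u, v) - G (x, y))%C < eps.
Proof.
intros H eps He.
assert (He2 : 0 < eps / 2) by lra.
assert (H2d : forall p : C -> R, (forall z, ccontinuous G z -> continuous (fun w => p (G w)) z) ->
  forall x y, a <= x <= b -> c <= y <= d -> continuity_2d_pt (fun x y => p (G (x, y))) x y).
{ intros p Hp x y Hx Hy e.
  pose proof (Hp _ (H x y Hx Hy) _ (locally_ball (p (G (x, y))) e)) as [r Hr].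
  exists r; intros u v Hu Hv; apply (Hr (u, v)); split; assumption. }
destruct (uniform_continuity_2d (fun x y => fst (G (x, y))) a b c d
  (H2d fst (fun z => ccontinuous_fst (U := C_UniformSpace) G z)) (mkposreal _ He2)) as [d1 H1].
destruct (uniform_continuity_2d (fun x y => snd (G (x, y))) a b c d
  (H2d snd (fun z => ccontinuous_snd (U := C_UniformSpace) G z)) (mkposreal _ He2)) as [d2 H2].
exists (Rmin d1 d2); split; [apply Rmin_glb_lt; apply cond_pos|].
intros x y u v Hx Hy Hu Hv Hux Hvy.
specialize (H1 x y u v Hx Hy Hu Hv (Rlt_le_trans _ _ _ Hux (Rmin_l _ _)) (Rlt_le_trans _ _ _ Hvy (Rmin_l _ _))).
specialize (H2 x y u v Hx Hy Hu Hv (Rlt_le_trans _ _ _ Hux (Rmin_r _ _)) (Rlt_le_trans _ _ _ Hvy (Rmin_r _ _))).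
simpl in H1, H2.
destruct (G (u, v)) as [g1 g2], (G (x, y)) as [h1 h2]; simpl in *.
eapply Rle_lt_trans; [apply Cmod_sub_pair_le | lra].
Qed.

Lemma ccontinuous_bounded (g : R -> C) (a b : R) :
  a <= b -> (forall x, a <= x <= b -> ccontinuous g x) ->
  exists M, 0 < M /\ forall x, a <= x <= b -> Cmod (g x) <= M.
Proof.
intros Hab H.
destruct (continuity_ab_maj (fun t => Cmod (g t)) a b Hab) as [m [Hm _]].
{ intros x Hx; apply continuity_pt_filterlim.
  exact (continuous_Cmod_comp g x (H x Hx)). }
exists (Cmod (g m) + 1); split; [pose proof (Cmod_ge_0 (g m)); lra|].
intros x Hx; specialize (Hm x Hx); lra.
Qed.

Lemma Cmod_cint_shrink_le (g h : R -> C) (a b e eta M : R) :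
  0 <= e -> a + e <= b - e ->
  (forall x, a <= x <= b -> ccontinuous g x) ->
  (forall x, a <= x <= b -> ccontinuous h x) ->
  (forall x, a <= x <= b -> Cmod (g x) <= M) ->
  (forall x, a <= x <= b -> Cmod (g x - h x)%C <= eta) ->
  0 <= eta ->
  Cmod (cint g a b - cint h (a + e) (b - e))%C <= (b - a) * eta + 2 * (e * M).
Proof.
intros He Hab Hg Hh HM Heta Heta0.
assert (Ig : forall u v, a <= u -> u <= v -> v <= b -> is_cint g u v (cint g u v)).
{ intros u v H1 H2 H3; apply is_cint_of_continuous; intros x Hx.
  rewrite Rmin_left, Rmax_right in Hx by lra; apply Hg; lra. }
assert (Ih : is_cint h (a + e) (b - e) (cint h (a + e) (b - e))).
{ apply is_cint_of_continuous; intros x Hx.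
  rewrite Rmin_left, Rmax_right in Hx by lra; apply Hh; lra. }
pose proof (Ig a (a + e) ltac:(lra) ltac:(lra) ltac:(lra)) as I1.
pose proof (Ig (a + e) (b - e) ltac:(lra) ltac:(lra) ltac:(lra)) as I2.
pose proof (Ig (b - e) b ltac:(lra) ltac:(lra) ltac:(lra)) as I3.
rewrite (is_cint_unique _ _ _ _ (is_cint_Chasles _ _ _ _ _ _ I1 (is_cint_Chasles _ _ _ _ _ _ I2 I3))).
apply Cmod_cint_le with (M := M) in I1; [|lra|intros; apply HM; lra].
apply Cmod_cint_le with (M := M) in I3; [|lra|intros; apply HM; lra].
pose proof (is_cint_minus _ _ _ _ _ _ I2 Ih) as I4.
apply Cmod_cint_le with (M := eta) in I4; [|lra|intros; apply Heta; lra].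
set (u1 := cint g a (a + e)) in *; set (u2 := cint g (a + e) (b - e)) in *.
set (u3 := cint g (b - e) b) in *; set (u4 := cint h (a + e) (b - e)) in *.
replace (u1 + (u2 + u3) - u4)%C with (u1 + ((u2 - u4) + u3))%C by ring.
eapply Rle_trans; [apply Cmod_triangle|].
eapply Rle_trans; [apply Rplus_le_compat_l, Cmod_triangle|].
nra.
Qed.

(** The boundary integral is a limit of those over slightly smaller concentric rectangles, on which
    Goursat's theorem applies. Both the edge over the unit circle and the cut through the removed
    pole rely on this form. *)
Lemma rect_int_of_interior_cderive (G : C -> C) (a b c d : R) :
  a < b -> c < d -> rect_continuous G a b c d ->
  (forall x y, a < x < b -> c < y < d -> exists l, is_cderive G (x, y) l) ->
  rect_int G a b c d = 0%C.
Proof.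
intros Hab Hcd HC HG.
assert (Hh : forall y, c <= y <= d -> forall x, a <= x <= b -> ccontinuous (fun t : R => G (t, y)) x)
  by (intros; apply ccontinuous_horizontal, HC; assumption).
assert (Hv : forall x, a <= x <= b -> forall y, c <= y <= d -> ccontinuous (fun t : R => G (x, t)) y)
  by (intros; apply ccontinuous_vertical, HC; assumption).
destruct (ccontinuous_bounded _ a b ltac:(lra) (Hh c ltac:(lra))) as [M1 [HM1 B1]].
destruct (ccontinuous_bounded _ a b ltac:(lra) (Hh d ltac:(lra))) as [M2 [HM2 B2]].
destruct (ccontinuous_bounded _ c d ltac:(lra) (Hv a ltac:(lra))) as [M3 [HM3 B3]].
destruct (ccontinuous_bounded _ c d ltac:(lra) (Hv b ltac:(lra))) as [M4 [HM4 B4]].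
set (M := M1 + M2 + M3 + M4).
apply Cmod_eq_0, Rle_antisym; [|apply Cmod_ge_0].
apply le_epsilon; intros eps He; rewrite Rplus_0_l.
set (L := b - a + (d - c)).
assert (HL : 0 < L) by (unfold L; lra).
assert (HM : 0 < M) by (unfold M; lra).
(* The four edges cost [2 L eta + 8 e M] in all: [eta] makes the first term half of [eps], and the
   bound [eps / (16 M)] on [e] does so for the second. The other bounds on [e] keep the inner
   rectangle nondegenerate and within the modulus of continuity [delta]. *)
set (eta := eps / (4 * L)).
assert (Heta : 0 < eta) by (apply Rdiv_lt_0_compat; lra).
destruct (rect_uniform_continuity G a b c d HC eta Heta) as [delta [Hdelta HU]].
set (e := Rmin (Rmin ((b - a) / 4) ((d - c) / 4)) (Rmin (delta / 2) (eps / (16 * M)))).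
assert (He0 : 0 < e).
{ repeat apply Rmin_glb_lt; try lra; apply Rdiv_lt_0_compat; lra. }
assert (He1 : e <= (b - a) / 4) by (eapply Rle_trans; [apply Rmin_l | apply Rmin_l]).
assert (He2 : e <= (d - c) / 4) by (eapply Rle_trans; [apply Rmin_l | apply Rmin_r]).
assert (He3 : e <= delta / 2) by (eapply Rle_trans; [apply Rmin_r | apply Rmin_l]).
assert (He4 : e <= eps / (16 * M)) by (eapply Rle_trans; [apply Rmin_r | apply Rmin_r]).
clearbody e.
assert (H0 : rect_int G (a + e) (b - e) (c + e) (d - e) = 0%C).
{ apply rect_int_of_cderive; try lra; intros; apply HG; lra. }
assert (D0 : Rabs 0 < delta) by (rewrite Rabs_R0; lra).
assert (De : Rabs e < delta) by (rewrite Rabs_pos_eq; lra).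
assert (De' : Rabs (- e) < delta) by (rewrite Rabs_Ropp; exact De).
assert (S1 := Cmod_cint_shrink_le (fun t => G (t, c)) (fun t => G (t, c + e)) a b e eta M
  ltac:(lra) ltac:(lra) (Hh c ltac:(lra)) (Hh (c + e) ltac:(lra))
  ltac:(intros x Hx; specialize (B1 x Hx); unfold M; lra)
  ltac:(intros x Hx; left; apply HU; (replace (x - x) with 0 by ring) || (replace (c - (c + e)) with (- e) by ring) || idtac; lra || assumption)
  ltac:(lra)).
assert (S2 := Cmod_cint_shrink_le (fun t => G (t, d)) (fun t => G (t, d - e)) a b e eta M
  ltac:(lra) ltac:(lra) (Hh d ltac:(lra)) (Hh (d - e) ltac:(lra))
  ltac:(intros x Hx; specialize (B2 x Hx); unfold M; lra)
  ltac:(intros x Hx; left; apply HU; (replace (x - x) with 0 by ring) || (replace (d - (d - e)) with e by ring) || idtac; lra || assumption)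
  ltac:(lra)).
assert (S3 := Cmod_cint_shrink_le (fun t => G (a, t)) (fun t => G (a + e, t)) c d e eta M
  ltac:(lra) ltac:(lra) (Hv a ltac:(lra)) (Hv (a + e) ltac:(lra))
  ltac:(intros x Hx; specialize (B3 x Hx); unfold M; lra)
  ltac:(intros x Hx; left; apply HU; (replace (x - x) with 0 by ring) || (replace (a - (a + e)) with (- e) by ring) || idtac; lra || assumption)
  ltac:(lra)).
assert (S4 := Cmod_cint_shrink_le (fun t => G (b, t)) (fun t => G (b - e, t)) c d e eta M
  ltac:(lra) ltac:(lra) (Hv b ltac:(lra)) (Hv (b - e) ltac:(lra))
  ltac:(intros x Hx; specialize (B4 x Hx); unfold M; lra)
  ltac:(intros x Hx; left; apply HU; (replace (x - x) with 0 by ring) || (replace (b - (b - e)) with e by ring) || idtac; lra || assumption)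
  ltac:(lra)).
unfold rect_int in *.
match type of S1 with Cmod (?u - ?v)%C <= _ => set (u1 := u) in *; set (v1 := v) in * end.
match type of S2 with Cmod (?u - ?v)%C <= _ => set (u2 := u) in *; set (v2 := v) in * end.
match type of S3 with Cmod (?u - ?v)%C <= _ => set (u3 := u) in *; set (v3 := v) in * end.
match type of S4 with Cmod (?u - ?v)%C <= _ => set (u4 := u) in *; set (v4 := v) in * end.
replace (u1 - u2 + Ci * (u4 - u3))%C with
  ((u1 - v1) + - (u2 - v2) + Ci * ((u4 - v4) + - (u3 - v3)))%C.
2:{ transitivity (u1 - u2 + Ci * (u4 - u3) - (v1 - v2 + Ci * (v4 - v3)))%C; [ring|].
    rewrite H0; ring. }
eapply Rle_trans; [apply Cmod_triangle|].
rewrite Cmod_mult, Cmod_Ci, Rmult_1_l.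
pose proof (Cmod_triangle (u1 - v1) (- (u2 - v2))) as T1.
pose proof (Cmod_triangle (u4 - v4) (- (u3 - v3))) as T2.
rewrite Cmod_opp in T1, T2.
assert (K1 : e * M <= eps / 16).
{ apply (Rmult_le_compat_r M) in He4; [|lra].
  replace (eps / (16 * M) * M) with (eps / 16) in He4 by (field; lra); exact He4. }
assert (K2 : L * eta = eps / 4) by (unfold eta; field; lra).
unfold L in K2; nra.
Qed.

(** * Improper integrals and the half-strip *)

Lemma scal_C_R (r : R) (z : C) : @scal R_AbsRing C_R_NormedModule r z = (RtoC r * z)%C.
Proof.
destruct z as [z1 z2]; unfold scal; simpl; unfold prod_scal; simpl; unfold scal; simpl;
  unfold mult; simpl.
unfold Cmult; simpl; f_equal; ring.
Qed.

Lemma is_cint_0_1_tail (g : R -> C) (u v : R) :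
  (forall t, 0 < t <= 1 -> ccontinuous g t) -> 0 < u <= 1 -> 0 < v <= 1 ->
  is_cint g u v (cint g u v).
Proof.
intros Hg Hu Hv; apply is_cint_of_continuous; intros t Ht; apply Hg.
revert Ht; unfold Rmin, Rmax; destruct (Rle_dec u v); lra.
Qed.

Lemma is_int_0_1_iff (g : R -> C) (I : C) :
  (forall t, 0 < t <= 1 -> ccontinuous g t) ->
  is_int_0_1 g I <->
  forall eps, 0 < eps -> exists d, 0 < d /\ forall e, 0 < e < d -> e < 1 ->
    Cmod (cint g e 1 - I)%C < eps.
Proof.
intros Hg; split.
- intros H eps He.
  assert (He2 : 0 < eps / 2) by lra.
  destruct (H (@ball C_UniformSpace I (eps / 2))
    (locally_ball (T := C_UniformSpace) I (mkposreal _ He2))) as [P Q [d Hd] HQ HPQ].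
  exists d; split; [apply cond_pos|]; intros e He0 He1.
  destruct (HPQ e 1) as [l [Hl1 Hl2]].
  + apply Hd; [|lra].
    change (Rabs (e - 0) < d); rewrite Rminus_0_r, Rabs_pos_eq; lra.
  + exact HQ.
  + simpl in Hl1; rewrite (is_cint_unique _ _ _ _ Hl1).
    apply Cmod_of_ball_C in Hl2; lra.
- intros H P [eps HP].
  destruct (H eps (cond_pos eps)) as [d [Hd K]].
  assert (Hd1 : 0 < Rmin d 1) by (apply Rmin_glb_lt; lra).
  apply Filter_prod with (fun e => 0 < e < Rmin d 1) (fun t => t = 1).
  + exists (mkposreal _ Hd1); intros e He1 He2.
    change (Rabs (e - 0) < Rmin d 1) in He1; rewrite Rminus_0_r, Rabs_pos_eq in He1; lra.
  + reflexivity.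
  + intros e t He ->; simpl.
    pose proof (Rmin_l d 1); pose proof (Rmin_r d 1).
    exists (cint g e 1); split.
    * apply is_cint_0_1_tail; lra || assumption.
    * apply HP, ball_C_of_Cmod, K; lra.
Qed.

Lemma is_int_0_1_unique (g : R -> C) (I J : C) :
  is_int_0_1 g I -> is_int_0_1 g J -> I = J.
Proof.
intros HI HJ.
rewrite <- (is_RInt_gen_unique (V := C_R_CompleteNormedModule) g I HI).
apply (is_RInt_gen_unique (V := C_R_CompleteNormedModule) g J HJ).
Qed.

Lemma is_int_0_1_ext (g h : R -> C) (I : C) :
  (forall t, 0 < t < 1 -> g t = h t) -> is_int_0_1 g I -> is_int_0_1 h I.
Proof.
intros E H.
refine (is_RInt_gen_ext (V := C_R_NormedModule) (Fa := at_right 0) (Fb := at_point 1) g h I _ H).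
apply Filter_prod with (fun e => 0 < e < 1) (fun t => t = 1).
- exists (mkposreal _ Rlt_0_1); intros e He1 He2.
  change (Rabs (e - 0) < 1) in He1; rewrite Rminus_0_r, Rabs_pos_eq in He1; lra.
- reflexivity.
- intros e t He -> x; simpl; rewrite Rmin_left, Rmax_right by lra.
  intros Hx; apply E; lra.
Qed.

Lemma is_int_0_1_minus (g h : R -> C) (I J : C) :
  is_int_0_1 g I -> is_int_0_1 h J -> is_int_0_1 (fun t => g t - h t)%C (I - J)%C.
Proof. exact (is_RInt_gen_minus (V := C_R_NormedModule) g h I J). Qed.

Lemma is_int_0_1_mult (g : R -> C) (c I : C) :
  (forall t, 0 < t <= 1 -> ccontinuous g t) ->
  is_int_0_1 g I -> is_int_0_1 (fun t => c * g t)%C (c * I)%C.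
Proof.
intros Hg H.
apply is_int_0_1_iff.
{ intros t Ht; apply ccontinuous_mult; [apply continuous_const | apply Hg, Ht]. }
intros eps He.
pose proof (Cmod_ge_0 c) as Hc.
destruct (proj1 (is_int_0_1_iff g I Hg) H (eps / (1 + Cmod c))) as [d [Hd K]].
{ apply Rdiv_lt_0_compat; lra. }
exists d; split; [exact Hd|]; intros e He0 He1.
rewrite (is_cint_unique _ _ _ _ (is_cint_mult g e 1 c _
  (is_cint_0_1_tail g e 1 Hg ltac:(lra) ltac:(lra)))).
replace (c * cint g e 1 - c * I)%C with (c * (cint g e 1 - I))%C by ring.
rewrite Cmod_mult.
specialize (K e He0 He1).
pose proof (Cmod_ge_0 (cint g e 1 - I)).
assert (Cmod (cint g e 1 - I) * (1 + Cmod c) < eps).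
{ apply (Rmult_lt_compat_r (1 + Cmod c)) in K; [|lra].
  replace (eps / (1 + Cmod c) * (1 + Cmod c)) with eps in K by (field; lra); exact K. }
nra.
Qed.

(** * Powers on (0, 1] and the integrals that they dominate *)

Lemma is_derive_Rpower (alpha t : R) :
  0 < t -> is_derive (fun t => Rpower t alpha) t (alpha * Rpower t (alpha - 1)).
Proof.
intros Ht; unfold Rpower.
auto_derive; [exact Ht|].
replace ((alpha - 1) * ln t) with (alpha * ln t + - ln t) by ring.
rewrite exp_plus, exp_Ropp, exp_ln by exact Ht.
field; lra.
Qed.

Lemma continuous_Rpower (alpha t : R) : 0 < t -> continuous (fun t => Rpower t alpha) t.
Proof.
intros Ht.
apply (ex_derive_continuous (K := R_AbsRing) (V := R_NormedModule)).
exists (alpha * Rpower t (alpha - 1)); apply is_derive_Rpower, Ht.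
Qed.

Lemma is_RInt_Rpower (K alpha a b : R) :
  0 < alpha -> 0 < a -> a <= b ->
  is_RInt (fun t => K * Rpower t (alpha - 1)) a b
    (K * (Rpower b alpha - Rpower a alpha) / alpha).
Proof.
intros Ha H0 Hab.
replace (K * (Rpower b alpha - Rpower a alpha) / alpha) with
  (minus (K / alpha * Rpower b alpha) (K / alpha * Rpower a alpha))
  by (unfold minus, plus, opp; simpl; field; lra).
apply (is_RInt_derive (V := R_CompleteNormedModule) (fun t => K / alpha * Rpower t alpha)).
- intros t Ht; rewrite Rmin_left, Rmax_right in Ht by lra.
  replace (K * Rpower t (alpha - 1)) with (scal (K / alpha) (alpha * Rpower t (alpha - 1)))
    by (unfold scal; simpl; unfold mult; simpl; field; lra).
  apply: is_derive_scal; apply is_derive_Rpower; lra.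
- intros t Ht; rewrite Rmin_left, Rmax_right in Ht by lra.
  apply: continuous_mult; [apply continuous_const | apply continuous_Rpower; lra].
Qed.

Lemma Cmod_cint_Rpower_le (g : R -> C) (K alpha a b : R) :
  0 < alpha -> 0 <= K -> 0 < a -> a <= b -> b <= 1 ->
  (forall t, 0 < t <= 1 -> ccontinuous g t) ->
  (forall t, 0 < t <= 1 -> Cmod (g t) <= K * Rpower t (alpha - 1)) ->
  Cmod (cint g a b) <= K * Rpower b alpha / alpha.
Proof.
intros Ha HK H0 Hab Hb Hg HB.
apply Rle_trans with (K * (Rpower b alpha - Rpower a alpha) / alpha).
- rewrite <- norm_C_R.
  refine (norm_RInt_le (V := C_R_NormedModule) g (fun t => K * Rpower t (alpha - 1)) a b _ _ Hab _ _ _).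
  + intros t Ht; rewrite norm_C_R; apply HB; lra.
  + apply is_cint_0_1_tail; lra || assumption.
  + apply is_RInt_Rpower; assumption.
- apply Rmult_le_compat_r; [left; apply Rinv_0_lt_compat, Ha|].
  apply Rmult_le_compat_l; [exact HK|].
  assert (0 < Rpower a alpha) by apply exp_pos; lra.
Qed.

(** Comparison with [K t^(alpha - 1)], whose integral over (0, 1) is [K / alpha]. The bound on the
    value is what later gives the passage to the limit under the integral sign. *)
Lemma ex_is_int_0_1 (g : R -> C) (K alpha : R) :
  0 < alpha -> 0 <= K ->
  (forall t, 0 < t <= 1 -> ccontinuous g t) ->
  (forall t, 0 < t <= 1 -> Cmod (g t) <= K * Rpower t (alpha - 1)) ->
  exists I, is_int_0_1 g I /\ Cmod I <= K / alpha.
Proof.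
intros Ha HK Hg HB.
assert (HL : exists I : C, filterlim (fun e => cint g e 1) (at_right 0) (@locally C_UniformSpace I)).
{ apply (filterlim_locally_cauchy (U := C_R_CompleteNormedModule) (F := at_right 0)).
  intros eps.
  (* A piece ending at [v] contributes at most [K v^alpha / alpha], which is below [eps] once
     [v^alpha <= r]; the denominator [K + 1] covers [K = 0], and [d] is chosen with
     [d^alpha <= r]. *)
  set (r := eps * alpha / (K + 1)).
  assert (Hr : 0 < r).
  { pose proof (cond_pos eps); apply Rdiv_lt_0_compat; [nra | lra]. }
  set (d := Rmin 1 (Rpower r (/ alpha))).
  assert (Hd : 0 < d) by (apply Rmin_glb_lt; [lra | apply exp_pos]).
  assert (Hdr : Rpower d alpha <= r).
  { apply Rle_trans with (Rpower (Rpower r (/ alpha)) alpha).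
    - apply Rle_Rpower_l; [lra|]; split; [exact Hd | apply Rmin_r].
    - rewrite Rpower_mult, Rinv_l, Rpower_1; lra. }
  exists (fun e => 0 < e < d); split.
  - exists (mkposreal _ Hd); intros e He1 He2.
    change (Rabs (e - 0) < d) in He1; rewrite Rminus_0_r, Rabs_pos_eq in He1; lra.
  - assert (Hd1 : d <= 1) by apply Rmin_l; clearbody d.
    assert (Key : forall u v, 0 < u < d -> 0 < v < d -> u <= v ->
      Cmod (cint g u 1 - cint g v 1)%C < eps).
    { intros u v Hu Hv Huv.
      rewrite (is_cint_unique _ _ _ _ (is_cint_Chasles _ _ _ _ _ _
        (is_cint_0_1_tail g u v Hg ltac:(lra) ltac:(lra))
        (is_cint_0_1_tail g v 1 Hg ltac:(lra) ltac:(lra)))).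
      assert (E : forall p q : C, (p + q - q = p)%C) by (intros; ring).
      rewrite E.
      eapply Rle_lt_trans; [apply (Cmod_cint_Rpower_le g K alpha); lra || assumption|].
      assert (Rpower v alpha <= r).
      { eapply Rle_trans; [|exact Hdr]; apply Rle_Rpower_l; lra. }
      assert (0 < Rpower v alpha) by apply exp_pos.
      apply Rmult_lt_reg_r with alpha; [exact Ha|].
      unfold Rdiv; rewrite Rmult_assoc, Rinv_l, Rmult_1_r by lra.
      assert (r * (K + 1) = eps * alpha) by (unfold r; field; lra).
      nra. }
    intros u v Hu Hv; apply (ball_C_of_Cmod (cint g u 1) (cint g v 1)).
    destruct (Rle_lt_dec u v).
    + rewrite <- Cmod_opp, Copp_minus_distr; apply Key; assumption.
    + apply Key; lra || assumption. }
destruct HL as [I HI]; exists I.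
pose proof (proj1 (filterlim_C_Cmod _ _ _) HI) as HI'.
assert (HII : is_int_0_1 g I).
{ apply is_int_0_1_iff; [exact Hg|]; intros eps He.
  destruct (HI' eps He) as [d Hd].
  exists d; split; [apply cond_pos|]; intros e He0 He1; apply Hd; [|lra].
  change (Rabs (e - 0) < d); rewrite Rminus_0_r, Rabs_pos_eq; lra. }
split; [exact HII|].
apply le_epsilon; intros eps He.
destruct (proj1 (is_int_0_1_iff g I Hg) HII eps He) as [d [Hd Kd]].
set (e := Rmin d 1 / 2).
assert (0 < Rmin d 1) by (apply Rmin_glb_lt; lra).
pose proof (Rmin_l d 1); pose proof (Rmin_r d 1).
assert (He0 : 0 < e < d) by (unfold e; lra).
assert (He1 : e < 1) by (unfold e; lra).
specialize (Kd e He0 He1).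
pose proof (Cmod_cint_Rpower_le g K alpha e 1 Ha HK ltac:(lra) ltac:(lra) ltac:(lra) Hg HB) as B.
replace (Rpower 1 alpha) with 1 in B by (unfold Rpower; rewrite ln_1, Rmult_0_r, exp_0; reflexivity).
replace I with (cint g e 1 + - (cint g e 1 - I))%C by ring.
eapply Rle_trans; [apply Cmod_triangle|].
rewrite Cmod_opp; lra.
Qed.

(** The substitution [t = e^x] takes a horizontal edge back to the slit; its left end [- M] becomes
    the lower limit [exp (- M)] of the improper integral. *)
Lemma cint_exp_subst (psi : R -> C) (M : R) :
  0 < M -> (forall t, 0 < t <= 1 -> ccontinuous psi t) ->
  is_cint (fun x => RtoC (exp x) * psi (exp x))%C (- M) 0 (cint psi (exp (- M)) 1).
Proof.
intros HM Hpsi.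
replace (cint psi (exp (- M)) 1) with (cint psi (exp (- M)) (exp 0)) by (rewrite exp_0; reflexivity).
apply is_cint_ext with (fun x => @scal R_AbsRing C_R_NormedModule (exp x) (psi (exp x))).
{ intros x _; apply scal_C_R. }
apply (is_RInt_comp (V := C_R_CompleteNormedModule) psi exp exp).
- intros x Hx; rewrite Rmin_left, Rmax_right in Hx by lra.
  apply Hpsi; split; [apply exp_pos|].
  rewrite <- exp_0; destruct (Req_dec x 0) as [->|]; [lra|].
  left; apply exp_increasing; lra.
- intros x _; split; [apply is_derive_exp | apply continuous_exp].
Qed.

(** Vanishing of the boundary integral equates the right edge with the left edge plus the difference
    of the horizontal ones. That difference is [i k] times the integral of [psi] from [exp (- M)] to
    1, the [i] being absorbed by [dz = i dy], and the left edge dies out as [M] grows. *)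
Lemma strip_limit (G : C -> C) (psi : R -> C) (k I : C) :
  (forall M, 0 < M -> rect_continuous G (- M) 0 (- PI) PI) ->
  (forall M, 0 < M -> rect_int G (- M) 0 (- PI) PI = 0%C) ->
  (forall x, x <= 0 ->
     (G (x, PI) - G (x, (- PI)%R))%C = (Ci * k * (RtoC (exp x) * psi (exp x)))%C) ->
  (forall t, 0 < t <= 1 -> ccontinuous psi t) ->
  is_int_0_1 psi I ->
  (forall eps, 0 < eps -> exists M0, forall M y, M0 < M -> - PI <= y <= PI ->
     Cmod (G (- M, y)) <= eps) ->
  cint (fun y => G (0, y)) (- PI) PI = (k * I)%C.
Proof.
intros HC H0 HG Hpsi HI Hsmall.
pose proof PI_RGT_0 as Hpi.
set (V := cint (fun y => G (0, y)) (- PI) PI : C).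
set (v := fun M : R => cint (fun y => G (- M, y)) (- PI) PI : C).
set (j := fun M : R => cint psi (exp (- M)) 1 : C).
assert (K : forall M, 0 < M -> V = (v M + k * j M)%C).
{ intros M HM.
  pose proof (is_cint_minus _ _ _ _ _ _
    (is_cint_horizontal G (- M) 0 (- PI) PI (- M) 0 PI (HC M HM) ltac:(lra) ltac:(lra) ltac:(lra) ltac:(lra))
    (is_cint_horizontal G (- M) 0 (- PI) PI (- M) 0 (- PI) (HC M HM) ltac:(lra) ltac:(lra) ltac:(lra) ltac:(lra))) as D.
  apply is_cint_ext with (h := fun x => (Ci * k * (RtoC (exp x) * psi (exp x)))%C) in D.
  2:{ intros x Hx; rewrite Rmin_left, Rmax_right in Hx by lra; apply HG; lra. }
  apply is_cint_unique in D.
  rewrite (is_cint_unique _ _ _ _ (is_cint_mult _ _ _ (Ci * k)%C _ (cint_exp_subst psi M HM Hpsi))) in D.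
  specialize (H0 M HM); unfold rect_int in H0; fold V in H0.
  change (cint (fun y => G (- M, y)) (- PI) PI) with (v M) in H0.
  change (cint psi (exp (- M)) 1) with (j M) in D.
  set (h1 := cint (fun x => G (x, PI)) (- M) 0 : C) in *.
  set (h2 := cint (fun x => G (x, - PI)) (- M) 0 : C) in *.
  generalize dependent h1; generalize dependent h2.
  generalize (v M) (j M) V; clear; intros v j V h2 h1 H0 D.
  assert (E : (Ci * V = Ci * (v + k * j))%C).
  { transitivity ((h2 - h1 + Ci * (V - v)) + (h1 - h2) + Ci * v)%C; [ring|].
    rewrite H0, <- D; ring. }
  assert (Ci2 : (Ci * Ci = - (1))%C) by (unfold Ci, Cmult, Copp, RtoC; simpl; f_equal; ring).
  transitivity (- (Ci * Ci * V))%C; [rewrite Ci2; ring|].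
  rewrite <- Cmult_assoc, E, Cmult_assoc, Ci2; ring. }
apply Ceq_minus, Cmod_eq_0, Rle_antisym; [|apply Cmod_ge_0].
apply le_epsilon; intros eps He; rewrite Rplus_0_l.
pose proof (Cmod_ge_0 k) as Hk.
set (e1 := eps / (4 * PI)).
assert (He1 : 0 < e1) by (apply Rdiv_lt_0_compat; lra).
set (e2 := eps / (2 * (1 + Cmod k))).
assert (He2 : 0 < e2) by (apply Rdiv_lt_0_compat; lra).
destruct (Hsmall e1 He1) as [M0 HM0].
destruct (proj1 (is_int_0_1_iff psi I Hpsi) HI e2 He2) as [d [Hd Kd]].
(* [M > M0] makes the left edge small, [M > - ln d] says [exp (- M) < d], and [M > 0] keeps the
   rectangle nondegenerate. *)
set (M := Rmax (Rmax M0 (- ln d)) 0 + 1).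
assert (HM1 : M0 < M) by (unfold M; pose proof (Rmax_l (Rmax M0 (- ln d)) 0); pose proof (Rmax_l M0 (- ln d)); lra).
assert (HM2 : - ln d < M) by (unfold M; pose proof (Rmax_l (Rmax M0 (- ln d)) 0); pose proof (Rmax_r M0 (- ln d)); lra).
assert (HM3 : 0 < M) by (unfold M; pose proof (Rmax_r (Rmax M0 (- ln d)) 0); lra).
clearbody M.
assert (B2 : Cmod (j M - I)%C < e2).
{ apply Kd.
  - split; [apply exp_pos|]; rewrite <- (exp_ln d Hd); apply exp_increasing; lra.
  - rewrite <- exp_0; apply exp_increasing; lra. }
assert (B1 : Cmod (v M) <= (PI - - PI) * e1).
{ eapply Cmod_cint_le; [lra| |].
  2: apply (is_cint_vertical G (- M) 0 (- PI) PI); lra || (apply HC; assumption).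
  intros y Hy; apply HM0; assumption. }
rewrite (K M HM3).
replace (v M + k * j M - k * I)%C with (v M + k * (j M - I))%C by ring.
eapply Rle_trans; [apply Cmod_triangle|]; rewrite Cmod_mult.
replace ((PI - - PI) * e1) with (eps / 2) in B1 by (unfold e1; field; lra).
assert (e2 * (1 + Cmod k) = eps / 2) by (unfold e2; field; lra).
pose proof (Cmod_ge_0 (j M - I)).
nra.
Qed.

(** * The kernels *)

Lemma ccontinuous_comp {U : UniformSpace} (f : C -> C) (g : U -> C) (x : U) :
  ccontinuous g x -> ccontinuous f (g x) -> ccontinuous (fun t => f (g t)) x.
Proof. exact (continuous_comp (V := C_UniformSpace) g f x). Qed.

Lemma ccontinuous_ext_loc (G H : C -> C) (z : C) :
  (exists d, 0 < d /\ forall w, Cmod (w - z)%C < d -> G w = H w) ->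
  ccontinuous G z -> ccontinuous H z.
Proof.
intros E; apply (continuous_ext_loc (T := C_UniformSpace) (U := C_UniformSpace)).
apply locally_C_Cmod; exact E.
Qed.

(** The difference quotient of [N] at [z], completed by the value [n]. A quotient of two functions
    with a common simple zero at [z] becomes the quotient of their slopes, which makes sense at [z]
    itself. *)
Definition slope (N : C -> C) (z n w : C) : C :=
  match excluded_middle_informative (w = z) with
  | left _ => n
  | right _ => ((N w - N z) / (w - z))%C
  end.

Lemma slope_eq (N : C -> C) (z n : C) : slope N z n z = n.
Proof. unfold slope; destruct (excluded_middle_informative (z = z)); congruence. Qed.

Lemma slope_neq (N : C -> C) (z n w : C) :
  w <> z -> slope N z n w = ((N w - N z) / (w - z))%C.
Proof. intros H; unfold slope; destruct (excluded_middle_informative (w = z)); congruence. Qed.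

Lemma Cminus_neq_0 (w z : C) : w <> z -> (w - z)%C <> 0%C.
Proof. intros H E; apply H, Ceq_minus, E. Qed.

Lemma ccontinuous_slope_eq (N : C -> C) (z n : C) :
  is_cderive N z n -> ccontinuous (slope N z n) z.
Proof.
intros H; apply filterlim_C_Cmod; [apply locally_filter|]; intros eps He.
apply locally_C_Cmod.
destruct (proj1 (is_cderive_eps _ _ _) H (eps / 2) ltac:(lra)) as [d [Hd K]].
exists d; split; [exact Hd|]; intros w Hw.
rewrite slope_eq.
destruct (classic (w = z)) as [->|Hne].
- rewrite slope_eq; replace (n - n)%C with (RtoC 0) by ring; rewrite Cmod_0; exact He.
- rewrite slope_neq by exact Hne.
  pose proof (Cminus_neq_0 _ _ Hne) as Hne'.
  replace ((N w - N z) / (w - z) - n)%C with ((N w - N z - (w - z) * n) / (w - z))%C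
    by (field; exact Hne').
  rewrite Cmod_div by exact Hne'.
  specialize (K w Hw).
  apply Cmod_gt_0 in Hne'.
  apply Rle_lt_trans with (eps / 2); [|lra].
  apply Rmult_le_reg_r with (Cmod (w - z)); [exact Hne'|].
  unfold Rdiv at 1; rewrite Rmult_assoc, Rinv_l by lra; lra.
Qed.

Lemma slope_neq_loc (N : C -> C) (z n w : C) :
  w <> z -> exists d, 0 < d /\ forall v, Cmod (v - w)%C < d ->
    ((N v - N z) / (v - z))%C = slope N z n v.
Proof.
intros Hne.
exists (Cmod (w - z)); split; [apply Cmod_gt_0, Cminus_neq_0, Hne|].
intros v Hv; symmetry; apply slope_neq; intros ->.
replace (z - w)%C with (- (w - z))%C in Hv by ring; rewrite Cmod_opp in Hv; lra.
Qed.

Lemma ccontinuous_id (z : C) : ccontinuous (fun w : C => w) z.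
Proof. exact (continuous_id (U := C_UniformSpace) z). Qed.

Lemma ccontinuous_const {U : UniformSpace} (c : C) (x : U) : ccontinuous (fun _ => c) x.
Proof. apply continuous_const. Qed.

Lemma ccontinuous_slope_neq (N : C -> C) (z n w : C) :
  w <> z -> ccontinuous N w -> ccontinuous (slope N z n) w.
Proof.
intros Hne H; apply (ccontinuous_ext_loc _ _ _ (slope_neq_loc N z n w Hne)).
apply (ccontinuous_div (U := C_UniformSpace)); [| |apply Cminus_neq_0, Hne];
  apply (ccontinuous_minus (U := C_UniformSpace));
  try apply ccontinuous_const; [exact H | apply ccontinuous_id].
Qed.

Lemma is_cderive_minus_const (N : C -> C) (c z l : C) :
  is_cderive N z l -> is_cderive (fun w => N w - c)%C z l.
Proof.
intros H; apply is_cderive_eps; intros eps He.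
destruct (proj1 (is_cderive_eps _ _ _) H eps He) as [d [Hd K]].
exists d; split; [exact Hd|]; intros w Hw.
replace (N w - c - (N z - c) - (w - z) * l)%C with (N w - N z - (w - z) * l)%C by ring.
apply K, Hw.
Qed.

Lemma is_cderive_id (z : C) : is_cderive (fun w => w) z (RtoC 1).
Proof.
apply is_cderive_ext_loc with (fun w => 0 + 1 * w)%C; [|apply is_cderive_affine].
exists 1; split; [lra|]; intros; ring.
Qed.

Lemma ex_cderive_div (N D : C -> C) (z n d : C) :
  is_cderive N z n -> is_cderive D z d -> D z <> 0%C ->
  exists l, is_cderive (fun w => N w / D w)%C z l.
Proof.
intros HN HD H0; eexists; apply is_cderive_mult; [exact HN|].
apply is_cderive_inv; [exact HD | exact H0].
Qed.

Lemma ex_cderive_slope_neq (N : C -> C) (z n w l : C) :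
  w <> z -> is_cderive N w l -> exists l', is_cderive (slope N z n) w l'.
Proof.
intros Hne H.
destruct (ex_cderive_div (fun v => N v - N z)%C (fun v => v - z)%C w l (RtoC 1)) as [l' Hl'].
- apply is_cderive_minus_const, H.
- apply is_cderive_minus_const, is_cderive_id.
- apply Cminus_neq_0, Hne.
- exists l'; exact (is_cderive_ext_loc _ _ _ _ (slope_neq_loc N z n w Hne) Hl').
Qed.

(** * The exponential on the strip and the zeros of the denominators *)

Lemma cexp_scal (a x y : R) :
  cexp (RtoC a * (x, y))%C = (exp (a * x) * cos (a * y), exp (a * x) * sin (a * y)).
Proof.
unfold cexp, Cmult, RtoC; simpl.
replace (a * x - 0 * y) with (a * x) by ring.
replace (a * y + 0 * x) with (a * y) by ring; reflexivity.
Qed.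

Lemma Cmod_cexp_scal (a x y : R) : Cmod (cexp (RtoC a * (x, y))%C) = exp (a * x).
Proof. rewrite Cmod_cexp; simpl; f_equal; ring. Qed.

Lemma cexp_PI (x : R) : cexp (x, PI) = RtoC (- exp x).
Proof. unfold cexp, RtoC; simpl; rewrite cos_PI, sin_PI; f_equal; ring. Qed.

Lemma cexp_opp_PI (x : R) : cexp (x, - PI) = RtoC (- exp x).
Proof. unfold cexp, RtoC; simpl; rewrite cos_neg, sin_neg, cos_PI, sin_PI; f_equal; ring. Qed.

Lemma cexp_expi (y : R) : cexp (0, y) = expi y.
Proof. unfold cexp, expi; simpl; rewrite exp_0; f_equal; ring. Qed.

Lemma is_cderive_cexp_scal (a : R) (z : C) :
  is_cderive (fun w => cexp (RtoC a * w)%C) z (RtoC a * cexp (RtoC a * z))%C.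
Proof.
apply (is_cderive_comp cexp (fun w => RtoC a * w)%C).
- apply is_cderive_cexp.
- apply is_cderive_ext_loc with (fun w => 0 + RtoC a * w)%C; [|apply is_cderive_affine].
  exists 1; split; [lra|]; intros; ring.
Qed.

Lemma is_cderive_one_sub (r a : R) (z : C) :
  is_cderive (fun w => 1 - RtoC r * cexp (RtoC a * w))%C z
    (- (RtoC r * RtoC a * cexp (RtoC a * z)))%C.
Proof.
replace (- (RtoC r * RtoC a * cexp (RtoC a * z)))%C
  with (RtoC a * cexp (RtoC a * z) * - RtoC r)%C by ring.
apply (is_cderive_ext_loc (fun w => 1 + - RtoC r * cexp (RtoC a * w))%C).
{ exists 1; split; [lra|]; intros; ring. }
apply (is_cderive_comp (fun w => 1 + - RtoC r * w)%C (fun w => cexp (RtoC a * w)%C)).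
- apply is_cderive_affine.
- apply is_cderive_cexp_scal.
Qed.

(** By [1 - cos th = 2 sin^2 (th / 2)], the half angle is a zero of the sine inside [(- PI, PI)]. *)
Lemma cos_eq_1_small (th : R) : - (2 * PI) < th < 2 * PI -> cos th = 1 -> th = 0.
Proof.
intros Hth Hc.
replace th with (2 * (th / 2)) in Hc by field.
rewrite cos_2a_sin in Hc.
assert (Hs : sin (th / 2) = 0) by nra.
destruct (Rtotal_order th 0) as [H|[H|H]]; [|exact H|].
- pose proof (sin_gt_0 (- (th / 2)) ltac:(lra) ltac:(lra)) as K; rewrite sin_neg in K; lra.
- pose proof (sin_gt_0 (th / 2) ltac:(lra) ltac:(lra)) as K; lra.
Qed.

Lemma one_sub_polar_eq_0 (r th : R) :
  0 < r -> - (2 * PI) < th < 2 * PI ->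
  (1 - RtoC r * (cos th, sin th))%C = 0%C -> r = 1 /\ th = 0.
Proof.
intros Hr Hth H; injection H; intros H2 H1; simpl in H1, H2.
assert (Hs : sin th = 0) by nra.
assert (Hc : r * cos th = 1) by nra.
pose proof (sin2_cos2 th) as E; unfold Rsqr in E; rewrite Hs in E.
assert (Hc1 : cos th = 1) by nra.
split; [nra | apply cos_eq_1_small; assumption].
Qed.

(** The zeros of [1 - r e^(a w)] form a vertical progression; the bound on [a * y], which
    [alpha < 2] supplies for [|y| <= PI], leaves only the real one. *)
Lemma one_sub_cexp_scal_eq_0 (r a x y : R) :
  0 < r -> - (2 * PI) < a * y < 2 * PI ->
  (1 - RtoC r * cexp (RtoC a * (x, y)))%C = 0%C -> r * exp (a * x) = 1 /\ a * y = 0.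
Proof.
intros Hr Hy H; apply one_sub_polar_eq_0; [|exact Hy|].
- apply Rmult_lt_0_compat; [exact Hr | apply exp_pos].
- rewrite <- H, cexp_scal.
  unfold Cminus, Cplus, Copp, Cmult, RtoC; simpl; f_equal; ring.
Qed.

(** The kernel of (1) with its squared modulus expanded and [r] in the place of [lambda^alpha]; as a
    function of [r] it extends to the limiting case [r = 1]. [kernel2] is the same for (2). *)
Definition kernel1 (alpha r t : R) : R :=
  Rpower t (alpha - 1) /
  (Rpower t alpha ^ 2 - 2 * r * Rpower t alpha * cos (alpha * PI) + r ^ 2).

Definition kernel2 (alpha r t : R) : R :=
  Rpower t (alpha - 1) /
  (1 - 2 * (r * Rpower t alpha) * cos (alpha * PI) + (r * Rpower t alpha) ^ 2).

Lemma cos_alpha_PI_lt_1 (alpha : R) : 0 < alpha < 2 -> cos (alpha * PI) < 1.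
Proof.
intros Ha; pose proof PI_RGT_0.
destruct (COS_bound (alpha * PI)) as [_ [H1|H1]]; [exact H1|].
apply cos_eq_1_small in H1; nra.
Qed.

(* [u^2 - 2uvc + v^2 = (1+c)/2 (u-v)^2 + (1-c)/2 (u+v)^2]. *)
Lemma quad_cos_ge (c u v : R) :
  -1 <= c -> 0 <= u -> 0 <= v -> c <= 1 ->
  (1 - c) / 2 * v ^ 2 <= u ^ 2 - 2 * v * u * c + v ^ 2.
Proof.
intros H1 Hu Hv H2.
assert (0 <= (1 + c) * (u - v) ^ 2) by (apply Rmult_le_pos; [lra | apply pow2_ge_0]).
assert (0 <= (1 - c) * (u ^ 2 + 2 * u * v)) by (apply Rmult_le_pos; [lra | nra]).
nra.
Qed.

Lemma kernel1_den_pos (alpha r t : R) :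
  0 < alpha < 2 -> 0 < r ->
  0 < Rpower t alpha ^ 2 - 2 * r * Rpower t alpha * cos (alpha * PI) + r ^ 2.
Proof.
intros Ha Hr; pose proof (cos_alpha_PI_lt_1 alpha Ha).
pose proof (COS_bound (alpha * PI)).
assert (0 < Rpower t alpha) by apply exp_pos.
pose proof (quad_cos_ge (cos (alpha * PI)) (Rpower t alpha) r ltac:(lra) ltac:(lra) ltac:(lra) ltac:(lra)).
assert (0 < (1 - cos (alpha * PI)) / 2 * r ^ 2) by (apply Rmult_lt_0_compat; [lra | nra]).
lra.
Qed.

Lemma kernel2_den_pos (alpha r t : R) :
  0 < alpha < 2 -> 0 < r ->
  0 < 1 - 2 * (r * Rpower t alpha) * cos (alpha * PI) + (r * Rpower t alpha) ^ 2.
Proof.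
intros Ha Hr; pose proof (cos_alpha_PI_lt_1 alpha Ha).
pose proof (COS_bound (alpha * PI)).
assert (0 < Rpower t alpha) by apply exp_pos.
pose proof (quad_cos_ge (cos (alpha * PI)) (r * Rpower t alpha) 1 ltac:(lra) ltac:(nra) ltac:(lra) ltac:(lra)).
nra.
Qed.

Lemma Rpower_exp (x a : R) : Rpower (exp x) a = exp (a * x).
Proof. unfold Rpower; rewrite ln_exp; reflexivity. Qed.

Lemma exp_mul_Rpower_exp (x a : R) : exp x * Rpower (exp x) (a - 1) = exp (a * x).
Proof. rewrite Rpower_exp, <- exp_plus; f_equal; ring. Qed.

Lemma continuous_kernel1 (alpha r t : R) :
  0 < alpha < 2 -> 0 < r -> 0 < t -> continuous (kernel1 alpha r) t.
Proof.
intros Ha Hr Ht; unfold kernel1, Rdiv.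
apply: continuous_mult; [apply continuous_Rpower, Ht|].
apply continuous_Rinv_comp; [|apply Rgt_not_eq, kernel1_den_pos; assumption].
apply: continuous_plus; [|apply continuous_const].
apply: continuous_minus.
- simpl; repeat apply: continuous_mult; try apply continuous_const; apply continuous_Rpower, Ht.
- repeat apply: continuous_mult; try apply continuous_const; apply continuous_Rpower, Ht.
Qed.

Lemma continuous_kernel2 (alpha r t : R) :
  0 < alpha < 2 -> 0 < r -> 0 < t -> continuous (kernel2 alpha r) t.
Proof.
intros Ha Hr Ht; unfold kernel2, Rdiv.
apply: continuous_mult; [apply continuous_Rpower, Ht|].
apply continuous_Rinv_comp; [|apply Rgt_not_eq, kernel2_den_pos; assumption].
apply: continuous_plus.
- apply: continuous_minus; [apply continuous_const|].
  repeat apply: continuous_mult; try apply continuous_const; apply continuous_Rpower, Ht.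
- simpl; repeat apply: continuous_mult; try apply continuous_const; apply continuous_Rpower, Ht.
Qed.

Lemma ccontinuous_kernel_f (f : C -> C) (k : R -> R) :
  (forall z, ccontinuous f z) -> (forall t, 0 < t -> continuous k t) ->
  forall t, 0 < t <= 1 -> ccontinuous (fun t => RtoC (k t) * f (RtoC (- t)))%C t.
Proof.
intros Hf Hk t Ht; apply ccontinuous_mult.
- apply ccontinuous_RtoC, Hk; lra.
- apply ccontinuous_comp; [|apply Hf].
  apply ccontinuous_RtoC; apply: continuous_opp; apply continuous_id.
Qed.

(* The jump of both contour integrands across the slit reduces to this. *)
Lemma slit_jump (q b : R) :
  1 - 2 * q * cos b + q ^ 2 <> 0 ->
  (/ (1 - ((q * cos b)%R, (q * sin b)%R)) - / (1 - ((q * cos b)%R, (- (q * sin b))%R)))%C =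
  (Ci * RtoC (2 * q * sin b / (1 - 2 * q * cos b + q ^ 2)))%C.
Proof.
intros H.
pose proof (sin2_cos2 b) as E; unfold Rsqr in E.
assert (E1 : (1 + - (q * cos b)) * ((1 + - (q * cos b)) * 1) + (0 + - (q * sin b)) * ((0 + - (q * sin b)) * 1)
  = 1 - 2 * q * cos b + q ^ 2) by nra.
assert (E2 : (1 + - (q * cos b)) * ((1 + - (q * cos b)) * 1) + (0 + - - (q * sin b)) * ((0 + - - (q * sin b)) * 1)
  = 1 - 2 * q * cos b + q ^ 2) by nra.
set (D := 1 - 2 * q * cos b + q ^ 2) in *; clearbody D.
unfold Cminus, Cplus, Copp, Cmult, Cinv, Ci, RtoC; simpl.
rewrite E1, E2; f_equal; field; exact H.
Qed.

(** * Contour integrals *)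

Lemma exp_le_1 (x : R) : x <= 0 -> exp x <= 1.
Proof.
intros [H| ->]; [|rewrite exp_0; lra].
rewrite <- exp_0; left; apply exp_increasing, H.
Qed.

Lemma cexp_scal_expi (a y : R) : cexp (RtoC a * (0, y))%C = expi (a * y).
Proof. rewrite cexp_scal, Rmult_0_r, exp_0; unfold expi; f_equal; ring. Qed.

Lemma alpha_mul_bounds (alpha y : R) :
  0 < alpha < 2 -> - PI <= y <= PI -> - (2 * PI) < alpha * y < 2 * PI.
Proof. intros Ha Hy; pose proof PI_RGT_0; split; nra. Qed.

Lemma ccontinuous_cexp (z : C) : ccontinuous cexp z.
Proof. exact (ccontinuous_of_is_cderive _ _ _ (is_cderive_cexp z)). Qed.

Lemma ex_cderive_f_cexp (f : C -> C) (x y : R) :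
  (forall z, Cmod z < 1 -> exists l, is_cderive f z l) -> x < 0 ->
  exists l, is_cderive (fun w => f (cexp w)) (x, y) l.
Proof.
intros Hf Hx.
destruct (Hf (cexp (x, y))) as [l Hl].
{ rewrite Cmod_cexp; simpl; rewrite <- exp_0; apply exp_increasing, Hx. }
eexists; apply is_cderive_comp; [exact Hl | apply is_cderive_cexp].
Qed.

Lemma f_cexp_bounded_left (f : C -> C) :
  ccontinuous f (RtoC 0) ->
  exists B M0, 0 < B /\ forall M y, M0 < M -> Cmod (f (cexp ((- M)%R, y))) <= B.
Proof.
intros Hf.
pose proof (proj1 (filterlim_C_Cmod _ _ _) Hf 1 Rlt_0_1) as H.
apply locally_C_Cmod in H; destruct H as [d [Hd K]].
pose proof (Cmod_ge_0 (f (RtoC 0))).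
exists (Cmod (f (RtoC 0)) + 1), (- ln d); split; [lra|].
intros M y HM.
assert (Hc : Cmod (cexp ((- M)%R, y) - 0)%C < d).
{ replace (cexp ((- M)%R, y) - 0)%C with (cexp ((- M)%R, y)) by ring.
  rewrite Cmod_cexp; simpl; rewrite <- (exp_ln d Hd); apply exp_increasing; lra. }
apply K in Hc.
replace (f (cexp ((- M)%R, y))) with ((f (cexp ((- M)%R, y)) - f (RtoC 0)) + f (RtoC 0))%C by ring.
eapply Rle_trans; [apply Cmod_triangle | lra].
Qed.

Lemma exp_neg_small (alpha eps : R) :
  0 < alpha -> 0 < eps -> exists M0, 0 < M0 /\ forall M, M0 < M -> exp (- (alpha * M)) < eps.
Proof.
intros Ha He.
exists (Rmax 1 (- ln eps / alpha)); split; [pose proof (Rmax_l 1 (- ln eps / alpha)); lra|].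
intros M HM.
rewrite <- (exp_ln eps He); apply exp_increasing.
assert (H : - ln eps / alpha < M) by (pose proof (Rmax_r 1 (- ln eps / alpha)); lra).
apply (Rmult_lt_compat_l alpha) in H; [|exact Ha].
replace (alpha * (- ln eps / alpha)) with (- ln eps) in H by (field; lra); lra.
Qed.

Lemma Cmod_one_sub_ge (z : C) : 1 - Cmod z <= Cmod (1 - z)%C.
Proof.
pose proof (Cmod_triangle (1 - z) z) as T.
replace (1 - z + z)%C with (RtoC 1) in T by ring.
rewrite Cmod_1 in T; lra.
Qed.

Lemma Cmod_mult_cexp_scal (r a x y : R) :
  0 < r -> Cmod (RtoC r * cexp (RtoC a * (x, y)))%C = r * exp (a * x).
Proof. intros Hr; rewrite Cmod_mult, Cmod_cexp_scal, Cmod_R, Rabs_pos_eq; lra. Qed.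

(** There is no pole here: [r e^(alpha w)] has modulus at most [r < 1] on the half-strip. The same
    factor in the numerator makes the integrand decay to the left. *)
Lemma contour_outer (f : C -> C) (alpha r : R) (I : C) :
  (forall z, ccontinuous f z) ->
  (forall z, Cmod z < 1 -> exists l, is_cderive f z l) ->
  0 < alpha < 2 -> 0 < r < 1 ->
  is_int_0_1 (fun t => RtoC (kernel2 alpha r t) * f (RtoC (- t)))%C I ->
  cint (fun y => f (expi y) * (RtoC r * expi (alpha * y)) / (1 - RtoC r * expi (alpha * y)))%C
    (- PI) PI = (RtoC (2 * r * sin (alpha * PI)) * I)%C.
Proof.
intros fc fh Ha Hr HI.
pose proof PI_RGT_0 as Hpi.
set (G := fun w : C => (f (cexp w) * (RtoC r * cexp (RtoC alpha * w))
  / (1 - RtoC r * cexp (RtoC alpha * w)))%C).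
assert (Hlt : forall x y, x <= 0 -> Cmod (RtoC r * cexp (RtoC alpha * (x, y)))%C < 1).
{ intros x y Hx; rewrite Cmod_mult_cexp_scal by lra.
  assert (exp (alpha * x) <= 1) by (apply exp_le_1; nra).
  pose proof (exp_pos (alpha * x)); nra. }
assert (Hden : forall x y, x <= 0 -> (1 - RtoC r * cexp (RtoC alpha * (x, y)))%C <> 0%C).
{ intros x y Hx; apply Cmod_gt_0.
  specialize (Hlt x y Hx); pose proof (Cmod_one_sub_ge (RtoC r * cexp (RtoC alpha * (x, y)))); lra. }
assert (HN : forall z, is_cderive (fun w => RtoC r * cexp (RtoC alpha * w))%C z
  (RtoC alpha * cexp (RtoC alpha * z) * RtoC r)%C).
{ intros z.
  apply is_cderive_ext_loc with (fun w => 0 + RtoC r * cexp (RtoC alpha * w))%C.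
  { exists 1; split; [lra|]; intros; ring. }
  apply (is_cderive_comp (fun w => 0 + RtoC r * w)%C (fun w => cexp (RtoC alpha * w)%C));
    [apply is_cderive_affine | apply is_cderive_cexp_scal]. }
transitivity (cint (fun y => G (0, y)) (- PI) PI).
{ apply (RInt_ext (V := C_R_CompleteNormedModule)); intros y _; unfold G.
  rewrite cexp_expi, cexp_scal_expi; reflexivity. }
assert (HC : forall M, 0 < M -> rect_continuous G (- M) 0 (- PI) PI).
{ intros M HM x y Hx Hy; unfold G.
  apply (ccontinuous_div (U := C_UniformSpace)); [| |apply Hden; lra].
  - apply (ccontinuous_mult (U := C_UniformSpace)).
    + apply (ccontinuous_comp (U := C_UniformSpace)); [apply ccontinuous_cexp | apply fc].
    + exact (ccontinuous_of_is_cderive _ _ _ (HN _)).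
  - exact (ccontinuous_of_is_cderive _ _ _ (is_cderive_one_sub r alpha _)). }
apply (strip_limit G (fun t => RtoC (kernel2 alpha r t) * f (RtoC (- t)))%C).
- exact HC.
- intros M HM; apply rect_int_of_interior_cderive; try lra; [apply HC, HM|].
  intros x y Hx Hy.
  destruct (ex_cderive_f_cexp f x y fh ltac:(lra)) as [l Hl].
  eapply ex_cderive_div.
  + apply is_cderive_mult; [exact Hl | apply HN].
  + apply is_cderive_one_sub.
  + apply Hden; lra.
- intros x Hx; unfold G.
  rewrite cexp_PI, cexp_opp_PI.
  pose proof (Hden x PI Hx) as D1; pose proof (Hden x (- PI) Hx) as D2.
  set (q := r * exp (alpha * x)).
  assert (E1 : (RtoC r * cexp (RtoC alpha * (x, PI)))%C = (q * cos (alpha * PI), q * sin (alpha * PI))).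
  { rewrite cexp_scal; unfold q, Cmult, RtoC; simpl; f_equal; ring. }
  assert (E2 : (RtoC r * cexp (RtoC alpha * (x, (- PI)%R)))%C = (q * cos (alpha * PI), - (q * sin (alpha * PI)))).
  { rewrite cexp_scal; replace (alpha * - PI) with (- (alpha * PI)) by ring.
    rewrite cos_neg, sin_neg; unfold q, Cmult, RtoC; simpl; f_equal; ring. }
  rewrite E1 in *; rewrite E2 in *.
  pose proof (kernel2_den_pos alpha r (exp x) Ha ltac:(lra)) as Hp.
  assert (Eq : r * Rpower (exp x) alpha = q) by (rewrite Rpower_exp; reflexivity).
  rewrite Eq in Hp.
  assert (Hk : exp x * kernel2 alpha r (exp x) =
    exp (alpha * x) / (1 - 2 * q * cos (alpha * PI) + q ^ 2)).
  { unfold kernel2; rewrite Eq, <- (exp_mul_Rpower_exp x alpha); field; lra. }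
  (* Since [z / (1 - z) = 1 / (1 - z) - 1] and [f] takes the same value on both edges, the constants
     cancel in the difference. *)
  transitivity (f (RtoC (- exp x)) *
    (/ (1 - ((q * cos (alpha * PI))%R, (q * sin (alpha * PI))%R)) -
     / (1 - ((q * cos (alpha * PI))%R, (- (q * sin (alpha * PI)))%R))))%C.
  { field; split; assumption. }
  rewrite slit_jump by lra.
  set (D := 1 - 2 * q * cos (alpha * PI) + q ^ 2) in *; clearbody D.
  replace (2 * q * sin (alpha * PI) / D)
    with ((2 * r * sin (alpha * PI)) * (exp x * kernel2 alpha r (exp x)))
    by (rewrite Hk; unfold q; field; lra).
  rewrite !RtoC_mult; ring.
- apply ccontinuous_kernel_f; [exact fc|].
  intros t Ht; apply continuous_kernel2; lra.
- exact HI.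
- intros eps He.
  destruct (f_cexp_bounded_left f (fc _)) as [B [M1 [HB K1]]].
  (* On the left edge the integrand is at most [B E / (1 - r)] with [E = exp (- alpha M)], so
     [E B <= eps (1 - r)] is the target. *)
  destruct (exp_neg_small alpha (eps * (1 - r) / B)) as [M2 [HM2 K2]]; [lra| |].
  { apply Rdiv_lt_0_compat; [nra | exact HB]. }
  exists (Rmax M1 M2); intros M y HM Hy.
  assert (HM1 : M1 < M) by (pose proof (Rmax_l M1 M2); lra).
  assert (HM2' : M2 < M) by (pose proof (Rmax_r M1 M2); lra).
  unfold G; rewrite Cmod_div by (apply Hden; lra).
  rewrite Cmod_mult, Cmod_mult_cexp_scal by lra.
  pose proof (Cmod_one_sub_ge (RtoC r * cexp (RtoC alpha * ((- M)%R, y)))) as Hge.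
  rewrite Cmod_mult_cexp_scal in Hge by lra.
  assert (He1 : exp (alpha * - M) <= 1) by (apply exp_le_1; nra).
  specialize (K1 M y HM1); specialize (K2 M HM2').
  replace (- (alpha * M)) with (alpha * - M) in K2 by ring.
  pose proof (exp_pos (alpha * - M)) as Hep.
  set (E := exp (alpha * - M)) in *.
  assert (HEB : E * B <= eps * (1 - r)).
  { apply (Rmult_lt_compat_r B) in K2; [|exact HB].
    replace (eps * (1 - r) / B * B) with (eps * (1 - r)) in K2 by (field; lra); lra. }
  apply Rle_div_l; [nra|].
  pose proof (Cmod_ge_0 (f (cexp ((- M)%R, y)))).
  assert (HrE : 0 < r * E <= E) by nra.
  apply Rle_trans with (B * E); [apply Rmult_le_compat; lra|].
  apply Rle_trans with (eps * (1 - r)); [lra|].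
  apply Rmult_le_compat_l; [lra|].
  eapply Rle_trans; [|exact Hge]; nra.
Qed.

(** The denominator has its only zero in the strip at [w0 = ln lambda], where the numerator vanishes
    too. Decay to the left now comes from the denominator, as [e^(-alpha w)] blows up there. *)
Lemma contour_inner (f : C -> C) (alpha lambda : R) (I : C) :
  (forall z, ccontinuous f z) ->
  (forall z, Cmod z < 1 -> exists l, is_cderive f z l) ->
  0 < alpha < 2 -> 0 < lambda < 1 ->
  is_int_0_1 (fun t => RtoC (kernel1 alpha (Rpower lambda alpha) t)
                       * (f (RtoC (- t)) - f (RtoC lambda)))%C I ->
  cint (fun y => (f (expi y) - f (RtoC lambda))
                 / (1 - RtoC (Rpower lambda alpha) * expi (- (alpha * y))))%C (- PI) PI
  = (RtoC (- (2 * Rpower lambda alpha * sin (alpha * PI))) * I)%C.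
Proof.
intros fc fh Ha Hl HI.
pose proof PI_RGT_0 as Hpi.
set (r := Rpower lambda alpha) in *.
assert (Hr : 0 < r) by apply exp_pos.
set (w0 := (ln lambda, 0) : C).
assert (Hln : ln lambda < 0) by (rewrite <- ln_1; apply ln_increasing; lra).
assert (Ew0 : cexp w0 = RtoC lambda).
{ unfold cexp, w0, RtoC; simpl; rewrite exp_ln, cos_0, sin_0 by lra; f_equal; ring. }
set (F := fun w => f (cexp w)).
set (D := fun w => (1 - RtoC r * cexp (RtoC (- alpha) * w))%C).
assert (Fc : forall z, ccontinuous F z).
{ intros z; apply (ccontinuous_comp (U := C_UniformSpace) f cexp z); [apply ccontinuous_cexp | apply fc]. }
assert (Dc : forall z, ccontinuous D z).
{ intros z; exact (ccontinuous_of_is_cderive _ _ _ (is_cderive_one_sub r (- alpha) z)). }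
assert (Erw : (RtoC r * cexp (RtoC (- alpha) * w0))%C = RtoC 1).
{ unfold w0; rewrite cexp_scal, Rmult_0_r, cos_0, sin_0.
  assert (E : r * exp (- alpha * ln lambda) = 1).
  { unfold r, Rpower; rewrite <- exp_plus.
    replace (alpha * ln lambda + - alpha * ln lambda) with 0 by ring; apply exp_0. }
  unfold Cmult, RtoC; simpl; f_equal; lra. }
assert (Dw0 : D w0 = 0%C) by (unfold D; rewrite Erw; ring).
assert (Dd : is_cderive D w0 (RtoC alpha)).
{ pose proof (is_cderive_one_sub r (- alpha) w0) as K.
  replace (- (RtoC r * RtoC (- alpha) * cexp (RtoC (- alpha) * w0)))%C with (RtoC alpha) in K; [exact K|].
  transitivity (RtoC alpha * (RtoC r * cexp (RtoC (- alpha) * w0)))%C.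
  - rewrite Erw; ring.
  - rewrite RtoC_opp; ring. }
assert (Dne : forall x y, - PI <= y <= PI -> (x, y) <> w0 -> D (x, y) <> 0%C).
{ intros x y Hy Hne E; apply Hne.
  apply one_sub_cexp_scal_eq_0 in E; [|exact Hr|].
  - destruct E as [E1 E2].
    assert (y = 0) by nra; subst y; unfold w0; f_equal.
    unfold r, Rpower in E1; rewrite <- exp_plus, <- exp_0 in E1.
    apply exp_inv in E1; nra.
  - pose proof (alpha_mul_bounds alpha y Ha Hy); lra. }
destruct (ex_cderive_f_cexp f (ln lambda) 0 fh Hln) as [l Fd].
change (is_cderive F w0 l) in Fd.
(* The common factor [w - w0] is divided out of numerator and denominator; the denominator is left
   with the value [alpha] at [w0], hence nonzero. *)
set (G := fun w => (slope F w0 l w / slope D w0 (RtoC alpha) w)%C).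
assert (HGne : forall x y, - PI <= y <= PI -> (x, y) <> w0 ->
  G (x, y) = ((F (x, y) - f (RtoC lambda)) / D (x, y))%C).
{ intros x y Hy Hne; unfold G; rewrite !slope_neq, Dw0 by exact Hne.
  unfold F at 2; rewrite Ew0; field; repeat split.
  - apply Dne; assumption.
  - apply Cminus_neq_0, Hne. }
assert (Sne : forall x y, - PI <= y <= PI -> slope D w0 (RtoC alpha) (x, y) <> 0%C).
{ intros x y Hy; destruct (classic ((x, y) = w0)) as [->|Hne].
  - rewrite slope_eq; intros E; injection E; lra.
  - rewrite slope_neq, Dw0 by exact Hne.
    replace (D (x, y) - 0)%C with (D (x, y)) by ring.
    apply Cmult_neq_0; [apply Dne; assumption|].
    intros E; pose proof (Cinv_r _ (Cminus_neq_0 _ _ Hne)) as K.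
    rewrite E, Cmult_0_r in K; injection K; lra. }
assert (HC : forall M, 0 < M -> rect_continuous G (- M) 0 (- PI) PI).
{ intros M HM x y Hx Hy; unfold G.
  apply (ccontinuous_div (U := C_UniformSpace)); [| |apply Sne, Hy].
  - destruct (classic ((x, y) = w0)) as [->|Hne].
    + apply ccontinuous_slope_eq, Fd.
    + apply ccontinuous_slope_neq; [exact Hne | apply Fc].
  - destruct (classic ((x, y) = w0)) as [->|Hne].
    + apply ccontinuous_slope_eq, Dd.
    + apply ccontinuous_slope_neq; [exact Hne | apply Dc]. }
assert (HD : forall x y, x < 0 -> - PI <= y <= PI -> y <> 0 -> exists m, is_cderive G (x, y) m).
{ intros x y Hx Hy Hy0.
  assert (Hne : (x, y) <> w0) by (intros E; injection E; intros; lra).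
  destruct (ex_cderive_f_cexp f x y fh Hx) as [l1 Hl1].
  destruct (ex_cderive_slope_neq F w0 l _ _ Hne Hl1) as [l2 Hl2].
  destruct (ex_cderive_slope_neq D w0 (RtoC alpha) _ _ Hne (is_cderive_one_sub r (- alpha) _)) as [l3 Hl3].
  exact (ex_cderive_div _ _ _ _ _ Hl2 Hl3 (Sne x y Hy)). }
transitivity (cint (fun y => G (0, y)) (- PI) PI).
{ apply (RInt_ext (V := C_R_CompleteNormedModule)); intros y Hy.
  rewrite Rmin_left, Rmax_right in Hy by lra.
  rewrite HGne; [|lra|intros E; injection E; lra].
  unfold F, D; rewrite cexp_expi, cexp_scal_expi.
  replace (- alpha * y) with (- (alpha * y)) by ring; reflexivity. }
apply (strip_limit G (fun t => RtoC (kernel1 alpha r t) * (f (RtoC (- t)) - f (RtoC lambda)))%C).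
- exact HC.
- intros M HM.
  (* [G] is known to be continuous at [w0] and differentiable off the real axis. Cutting along
     [y = 0] moves [w0] out of both interiors. *)
  rewrite (rect_int_split_y G (- M) 0 (- PI) 0 PI) by (lra || apply HC, HM).
  rewrite !rect_int_of_interior_cderive; try lra;
    try (apply (rect_continuous_sub G (- M) 0 (- PI) PI); lra || apply HC, HM);
    try (intros x y Hx Hy; apply HD; lra).
  ring.
- intros x Hx.
  assert (N1 : (x, PI) <> w0) by (intros E; injection E; lra).
  assert (N2 : (x, (- PI)%R) <> w0) by (intros E; injection E; lra).
  rewrite (HGne x PI), (HGne x (- PI)) by (lra || assumption).
  pose proof (Dne x PI ltac:(lra) N1) as D1; pose proof (Dne x (- PI) ltac:(lra) N2) as D2.
  unfold F; rewrite cexp_PI, cexp_opp_PI.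
  set (q := r * exp (- alpha * x)).
  assert (E1 : D (x, PI) = (1 - ((q * cos (alpha * PI))%R, (- (q * sin (alpha * PI)))%R))%C).
  { unfold D; rewrite cexp_scal; replace (- alpha * PI) with (- (alpha * PI)) by ring.
    rewrite cos_neg, sin_neg; unfold q, Cminus, Cplus, Copp, Cmult, RtoC; simpl; f_equal; ring. }
  assert (E2 : D (x, (- PI)%R) = (1 - ((q * cos (alpha * PI))%R, (q * sin (alpha * PI))%R))%C).
  { unfold D; rewrite cexp_scal; replace (- alpha * - PI) with (alpha * PI) by ring.
    unfold q, Cminus, Cplus, Copp, Cmult, RtoC; simpl; f_equal; ring. }
  rewrite E1 in *; rewrite E2 in *.
  pose proof (kernel1_den_pos alpha r (exp x) Ha Hr) as Hp.
  set (u := exp (alpha * x)).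
  assert (Hu : 0 < u) by apply exp_pos.
  assert (Equ : q = r / u) by (unfold q, u; replace (- alpha * x) with (- (alpha * x)) by ring; rewrite exp_Ropp; reflexivity).
  assert (Eq : Rpower (exp x) alpha = u) by apply Rpower_exp.
  rewrite Eq in Hp.
  assert (Hk : exp x * kernel1 alpha r (exp x) = u / (u ^ 2 - 2 * r * u * cos (alpha * PI) + r ^ 2)).
  { unfold kernel1, Rdiv; rewrite Eq, <- Rmult_assoc, exp_mul_Rpower_exp; reflexivity. }
  (* Multiplication by [u^2 = t^(2 alpha)] turns the denominator in [q = r / u] into that of
     [kernel1]. *)
  assert (Hq : u ^ 2 * (1 - 2 * q * cos (alpha * PI) + q ^ 2) = u ^ 2 - 2 * r * u * cos (alpha * PI) + r ^ 2).
  { rewrite Equ; field; lra. }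
  assert (Hq0 : 1 - 2 * q * cos (alpha * PI) + q ^ 2 <> 0) by (intros E; rewrite E in Hq; lra).
  (* The exponent is [- alpha * w], so the upper edge carries the angle [- alpha * PI]: the jump is
     opposite to that of [slit_jump], whence the minus sign in the conclusion. *)
  transitivity (- ((f (RtoC (- exp x)) - f (RtoC lambda)) *
    (/ (1 - ((q * cos (alpha * PI))%R, (q * sin (alpha * PI))%R)) -
     / (1 - ((q * cos (alpha * PI))%R, (- (q * sin (alpha * PI)))%R)))))%C.
  { field; split; assumption. }
  rewrite slit_jump by exact Hq0.
  replace (2 * q * sin (alpha * PI) / (1 - 2 * q * cos (alpha * PI) + q ^ 2))
    with ((2 * r * sin (alpha * PI)) * (exp x * kernel1 alpha r (exp x))).
  2:{ rewrite Hk, <- Hq; set (Q := 1 - 2 * q * cos (alpha * PI) + q ^ 2) in *; clearbody Q.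
      rewrite Equ; field; split; [lra | exact Hq0]. }
  generalize (f (RtoC (- exp x))); intros v.
  rewrite RtoC_opp, !RtoC_mult; ring.
- intros t Ht; apply ccontinuous_mult.
  + apply ccontinuous_RtoC, continuous_kernel1; lra.
  + apply ccontinuous_minus; [|apply ccontinuous_const].
    apply ccontinuous_comp; [|apply fc].
    apply ccontinuous_RtoC; apply: continuous_opp; apply continuous_id.
- exact HI.
- intros eps He.
  destruct (f_cexp_bounded_left f (fc _)) as [B [M1 [HB K1]]].
  pose proof (Cmod_ge_0 (f (RtoC lambda))) as Hfl.
  set (B' := B + Cmod (f (RtoC lambda))).
  assert (HB' : 0 < B' / eps) by (apply Rdiv_lt_0_compat; unfold B'; lra).
  destruct (exp_neg_small alpha (r / (1 + B' / eps))) as [M2 [HM2 K2]]; [lra| |].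
  { apply Rdiv_lt_0_compat; lra. }
  (* For these [M] the left edge lies to the left of [w0], and [r e^(-alpha w)] has modulus at least
     [1 + B' / eps] on it; so [D] is at least [B' / eps] while the numerator stays below [B']. *)
  exists (Rmax (Rmax M1 M2) (- ln lambda)); intros M y HM Hy.
  pose proof (Rmax_l (Rmax M1 M2) (- ln lambda)); pose proof (Rmax_r (Rmax M1 M2) (- ln lambda)).
  pose proof (Rmax_l M1 M2); pose proof (Rmax_r M1 M2).
  rewrite HGne; [|exact Hy|intros E; injection E; lra].
  specialize (K1 M y ltac:(lra)); specialize (K2 M ltac:(lra)).
  assert (Hz : 1 + B' / eps <= Cmod (RtoC r * cexp (RtoC (- alpha) * ((- M)%R, y)))%C).
  { rewrite Cmod_mult_cexp_scal by exact Hr.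
    replace (- alpha * - M) with (alpha * M) by ring.
    rewrite exp_Ropp in K2.
    pose proof (exp_pos (alpha * M)) as Hp.
    apply (Rmult_lt_compat_r (exp (alpha * M))) in K2; [|exact Hp].
    rewrite Rinv_l in K2 by lra.
    apply (Rmult_lt_compat_r (1 + B' / eps)) in K2; [|lra].
    replace (r / (1 + B' / eps) * exp (alpha * M) * (1 + B' / eps)) with (r * exp (alpha * M)) in K2
      by (generalize (B' / eps) HB'; intros; field; lra).
    lra. }
  assert (HDM : B' / eps <= Cmod (D ((- M)%R, y))).
  { unfold D; set (z := (RtoC r * cexp (RtoC (- alpha) * ((- M)%R, y)))%C) in *.
    pose proof (Cmod_triangle (- (1 - z)) 1) as T.
    replace (- (1 - z) + 1)%C with z in T by ring.
    rewrite Cmod_opp, Cmod_1 in T; lra. }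
  rewrite Cmod_div by (apply Cmod_gt_0; lra).
  apply Rle_div_l; [lra|].
  apply Rle_trans with B'.
  + unfold Cminus; eapply Rle_trans; [apply Cmod_triangle|].
    rewrite Cmod_opp; unfold B', F; lra.
  + apply (Rmult_le_compat_l eps) in HDM; [|lra].
    replace (eps * (B' / eps)) with B' in HDM by (field; lra); exact HDM.
Qed.

(** * The constant function *)

Lemma one_sub_r_cos_pos (r th : R) : 0 < r < 1 -> 0 < 1 - r * cos th.
Proof. intros Hr; pose proof (COS_bound th); nra. Qed.

Lemma cint_geometric_kernel (alpha r : R) :
  0 < alpha -> 0 < r < 1 ->
  is_cint (fun y => / (1 - RtoC r * expi (- (alpha * y))))%C (- PI) PI
    (RtoC (2 * PI + 2 / alpha * atan (r * sin (alpha * PI) / (1 - r * cos (alpha * PI))))).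
Proof.
intros Ha Hr.
set (D := fun y => (1 - r * cos (alpha * y)) ^ 2 + (r * sin (alpha * y)) ^ 2).
assert (HD : forall y, 0 < D y).
{ intros y; unfold D; pose proof (one_sub_r_cos_pos r (alpha * y) Hr).
  pose proof (pow2_ge_0 (r * sin (alpha * y))).
  assert (0 < (1 - r * cos (alpha * y)) ^ 2) by (apply pow_lt; assumption); lra. }
assert (HDc : forall y, continuous D y).
{ intros y; apply (ex_derive_continuous (K := R_AbsRing) (V := R_NormedModule)).
  unfold D; auto_derive; trivial. }
(* From [1 / (1 - z) = 1 + z / (1 - z)] a primitive is [y + log (1 - r e^(-i alpha y)) / (i alpha)].
   [P] and [Q] are its real and imaginary parts, the argument being an arctangent because
   [1 - r cos] is positive; [Q] is even and contributes nothing. *)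
set (P := fun y => y + atan (r * sin (alpha * y) / (1 - r * cos (alpha * y))) / alpha).
set (Q := fun y => - ln (D y) / (2 * alpha)).
apply is_cint_ext with (fun y => ((1 - r * cos (alpha * y)) / D y, - (r * sin (alpha * y)) / D y)).
{ intros y _; unfold D, expi; rewrite cos_neg, sin_neg.
  unfold Cinv, Cminus, Cplus, Copp, Cmult, RtoC; simpl.
  f_equal; f_equal; ring. }
apply is_cint_pair; simpl fst; simpl snd.
- replace (2 * PI + 2 / alpha * atan (r * sin (alpha * PI) / (1 - r * cos (alpha * PI))))
    with (minus (P PI) (P (- PI))).
  2:{ unfold P, minus, plus, opp; simpl.
      replace (alpha * - PI) with (- (alpha * PI)) by ring.
      rewrite cos_neg, sin_neg.
      replace (r * - sin (alpha * PI) / (1 - r * cos (alpha * PI)))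
        with (- (r * sin (alpha * PI) / (1 - r * cos (alpha * PI))))
        by (field; pose proof (one_sub_r_cos_pos r (alpha * PI) Hr); lra).
      rewrite atan_opp; field; lra. }
  apply (is_RInt_derive (V := R_CompleteNormedModule) P); intros y _.
  + pose proof (one_sub_r_cos_pos r (alpha * y) Hr) as Hy.
    specialize (HD y).
    unfold P; auto_derive; [lra|].
    unfold D in HD |- *.
    pose proof (sin2_cos2 (alpha * y)) as E; unfold Rsqr in E.
    set (s := sin (alpha * y)) in *; set (c := cos (alpha * y)) in *.
    assert (E2 : s * s = 1 - c * c) by lra.
    assert (E3 : (1 - r * c) ^ 2 + (r * s) ^ 2 = 1 - 2 * r * c + r * r) by nra.
    rewrite E3 in HD |- *.
    replace ((r * s / (1 + - (r * c))) ^ 2) with (r * r * (1 - c * c) / (1 - r * c) ^ 2)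
      by (rewrite <- E2; field; lra).
    field_simplify_eq.
    * ring [E2].
    * repeat split; lra.
  + apply: continuous_mult.
    * apply: continuous_minus; [apply continuous_const|].
      apply: continuous_mult; [apply continuous_const|].
      apply continuous_cos_comp; apply: continuous_mult; [apply continuous_const | apply continuous_id].
    * apply continuous_Rinv_comp; [apply HDc | apply Rgt_not_eq, HD].
- replace 0 with (minus (Q PI) (Q (- PI))).
  2:{ unfold Q, D, minus, plus, opp; simpl.
      replace (alpha * - PI) with (- (alpha * PI)) by ring.
      rewrite cos_neg, sin_neg.
      replace (r * - sin (alpha * PI) * (r * - sin (alpha * PI) * 1))
        with (r * sin (alpha * PI) * (r * sin (alpha * PI) * 1)) by ring.
      ring. }
  apply (is_RInt_derive (V := R_CompleteNormedModule) Q); intros y _.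
  + specialize (HD y).
    unfold Q, D in *; auto_derive; [exact HD|].
    field; split; [exact (Rgt_not_eq _ _ HD) | lra].
  + apply: continuous_mult.
    * apply: continuous_opp; apply: continuous_mult; [apply continuous_const|].
      apply: continuous_comp; [|apply continuous_sin].
      apply: continuous_mult; [apply continuous_const | apply continuous_id].
    * apply continuous_Rinv_comp; [apply HDc | apply Rgt_not_eq, HD].
Qed.

(** Here the branches of the arctangent are reconciled. For [b < PI],
    [atan (1 / x) = PI / 2 - atan x] and [- cot b = tan (b - PI / 2)]; for [b > PI] both arctangents
    on the left drop by [PI], which cancels in the difference. *)
Lemma atan_slit_value (r b : R) :
  0 < r < 1 -> 0 < b < 2 * PI -> sin b <> 0 ->
  atan ((1 / r - cos b) / sin b) - atan (- cos b / sin b) =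
  PI - b - atan (r * sin b / (1 - r * cos b)).
Proof.
intros Hr Hb Hs.
pose proof (one_sub_r_cos_pos r b Hr) as Hc.
pose proof PI_RGT_0 as Hpi.
replace ((1 / r - cos b) / sin b) with (/ (r * sin b / (1 - r * cos b)))
  by (field; repeat split; lra).
destruct (Rlt_le_dec b PI) as [H|H].
- assert (Hp : 0 < sin b) by (apply sin_gt_0; lra).
  rewrite atan_inv by (apply Rdiv_lt_0_compat; nra).
  replace (- cos b / sin b) with (tan (b - PI / 2)).
  + rewrite atan_tan; lra.
  + unfold tan; rewrite sin_minus, cos_minus, sin_PI2, cos_PI2.
    replace (sin b * 0 - cos b * 1) with (- cos b) by ring.
    replace (cos b * 0 + sin b * 1) with (sin b) by ring; reflexivity.
- destruct H as [H|H]; [|exfalso; apply Hs; rewrite <- H; apply sin_PI].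
  assert (Hp : sin b < 0) by (apply sin_lt_0; lra).
  replace (/ (r * sin b / (1 - r * cos b))) with (- / (r * - sin b / (1 - r * cos b)))
    by (field; repeat split; lra).
  rewrite atan_opp, atan_inv by (apply Rdiv_lt_0_compat; nra).
  replace (r * - sin b / (1 - r * cos b)) with (- (r * sin b / (1 - r * cos b))) by (field; lra).
  rewrite atan_opp.
  replace (- cos b / sin b) with (tan (b - 3 * (PI / 2))).
  + rewrite atan_tan; lra.
  + unfold tan; rewrite sin_minus, cos_minus.
    rewrite sin_3PI2, cos_3PI2.
    replace (sin b * 0 - cos b * -1) with (cos b) by ring.
    replace (cos b * 0 + sin b * -1) with (- sin b) by ring.
    field; exact Hs.
Qed.

Lemma Rpower_small (alpha d : R) :
  0 < alpha -> 0 < d -> exists d', 0 < d' /\ forall e, 0 < e < d' -> Rpower e alpha < d.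
Proof.
intros Ha Hd; exists (Rpower d (/ alpha)); split; [apply exp_pos|].
intros e He.
replace d with (Rpower (Rpower d (/ alpha)) alpha)
  by (rewrite Rpower_mult, Rinv_l, Rpower_1; lra).
apply Rlt_Rpower_l; lra.
Qed.

Lemma kernel1_integral (alpha r : R) (J : C) :
  0 < alpha < 2 -> 0 < r < 1 ->
  is_int_0_1 (fun t => RtoC (kernel1 alpha r t)) J ->
  (RtoC (alpha * r * sin (alpha * PI)) * J)%C =
  RtoC (PI - alpha * PI - atan (r * sin (alpha * PI) / (1 - r * cos (alpha * PI)))).
Proof.
intros Ha Hr HJ.
pose proof PI_RGT_0 as Hpi.
assert (Hb : 0 < alpha * PI < 2 * PI) by nra.
(* The primitive used in the general case divides by the sine. The sine vanishes only for
   [alpha = 1], and then both sides are 0. *)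
destruct (Req_dec (sin (alpha * PI)) 0) as [Hs|Hs].
- assert (Eb : alpha * PI = PI).
  { destruct (Rtotal_order (alpha * PI) PI) as [H|[H|H]]; [|exact H|].
    - pose proof (sin_gt_0 (alpha * PI)); lra.
    - pose proof (sin_lt_0 (alpha * PI)); lra. }
  rewrite Eb, sin_PI, !Rmult_0_r; unfold Rdiv; rewrite Rmult_0_l, atan_0.
  replace (PI - PI - 0) with 0 by ring; ring.
- set (s := sin (alpha * PI)) in *; set (c := cos (alpha * PI)).
  (* With [x = t^alpha] the denominator is [(x - r c)^2 + (r s)^2], so [h / (r s)] is a primitive in
     [x] of its inverse. Continuity of [h] at 0 yields the improper integral. *)
  set (h := fun x => atan ((x / r - c) / s)).
  assert (Ck : forall t, 0 < t <= 1 -> ccontinuous (fun t => RtoC (kernel1 alpha r t)) t)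
    by (intros t Ht; apply ccontinuous_RtoC, continuous_kernel1; lra).
  assert (HQ : forall e, 0 < e < 1 ->
    is_cint (fun t => RtoC (kernel1 alpha r t)) e 1
      (RtoC ((h 1 - h (Rpower e alpha)) / (alpha * r * s)))).
  { intros e He; apply is_cint_pair; simpl fst; simpl snd.
    - replace ((h 1 - h (Rpower e alpha)) / (alpha * r * s)) with
        (minus (h (Rpower 1 alpha) / (alpha * r * s)) (h (Rpower e alpha) / (alpha * r * s))).
      2:{ replace (Rpower 1 alpha) with 1
            by (unfold Rpower; rewrite ln_1, Rmult_0_r, exp_0; reflexivity).
          unfold minus, plus, opp; simpl; field; repeat split; lra. }
      apply (is_RInt_derive (V := R_CompleteNormedModule)
        (fun t => h (Rpower t alpha) / (alpha * r * s))).
      + intros t Ht; rewrite Rmin_left, Rmax_right in Ht by lra.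
        assert (Dh : forall x, is_derive (fun x => h x / (alpha * r * s)) x
          (/ alpha / (x ^ 2 - 2 * r * x * c + r ^ 2))).
        { intros x; unfold h.
          assert (Es : s * s = 1 - c * c)
            by (pose proof (sin2_cos2 (alpha * PI)) as E; unfold Rsqr in E; fold s c in E; lra).
          assert (Hq : 0 < x ^ 2 - 2 * r * x * c + r ^ 2).
          { replace (x ^ 2 - 2 * r * x * c + r ^ 2) with ((x - r * c) ^ 2 + r * r * (s * s))
              by (rewrite Es; ring).
            assert (0 < r * r * (s * s))
              by (apply Rmult_lt_0_compat; [nra | apply Rsqr_pos_lt, Hs]).
            pose proof (pow2_ge_0 (x - r * c)); lra. }
          auto_derive; [trivial|].
          match goal with |- context [1 + ?e] =>
            replace (1 + e) with ((x ^ 2 - 2 * r * x * c + r ^ 2) / (r * r * (s * s))) end.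
          2:{ replace (x ^ 2 - 2 * r * x * c + r ^ 2) with ((x - r * c) ^ 2 + r * r * (s * s))
                by (rewrite Es; ring).
              field; repeat split; lra. }
          set (q := x ^ 2 - 2 * r * x * c + r ^ 2) in *; clearbody q.
          field; repeat split; lra. }
        pose proof (is_derive_comp (fun x => h x / (alpha * r * s)) (fun t => Rpower t alpha) t _ _
          (Dh (Rpower t alpha)) (is_derive_Rpower alpha t ltac:(lra))) as Dc.
        evar_last; [exact Dc|].
        unfold kernel1, scal; simpl; unfold mult; simpl; fold c.
        pose proof (kernel1_den_pos alpha r t Ha ltac:(lra)) as Hq; fold c in Hq.
        simpl in Hq.
        set (q := _ - _ + _) in *; clearbody q.
        field; repeat split; lra.
      + intros t Ht; rewrite Rmin_left, Rmax_right in Ht by lra.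
        apply continuous_kernel1; lra.
    - pose proof (is_RInt_const (V := R_NormedModule) e 1 0) as K.
      change (is_RInt (fun _ => 0) e 1 ((1 - e) * 0)) in K.
      rewrite Rmult_0_r in K; exact K. }
  assert (HJ2 : is_int_0_1 (fun t => RtoC (kernel1 alpha r t))
    (RtoC ((h 1 - h 0) / (alpha * r * s)))).
  { apply is_int_0_1_iff; [exact Ck|]; intros eps He.
    assert (Hc : continuous (fun x => h x / (alpha * r * s)) 0).
    { apply (ex_derive_continuous (K := R_AbsRing) (V := R_NormedModule)).
      unfold h; auto_derive; trivial. }
    pose proof (Hc _ (locally_ball _ (mkposreal _ He))) as [d Kd].
    destruct (Rpower_small alpha d) as [d' [Hd' K']]; [lra | apply cond_pos|].
    exists d'; split; [exact Hd'|]; intros e He0 He1.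
    rewrite (is_cint_unique _ _ _ _ (HQ e ltac:(lra))).
    rewrite <- RtoC_minus, Cmod_R.
    specialize (K' e He0).
    assert (Hpe : 0 < Rpower e alpha) by apply exp_pos.
    assert (B : ball 0 d (Rpower e alpha)).
    { change (Rabs (Rpower e alpha - 0) < d); rewrite Rminus_0_r, Rabs_pos_eq; lra. }
    specialize (Kd _ B).
    change (Rabs (h (Rpower e alpha) / (alpha * r * s) - h 0 / (alpha * r * s)) < eps) in Kd.
    rewrite Rabs_minus_sym in Kd.
    replace ((h 1 - h (Rpower e alpha)) / (alpha * r * s) - (h 1 - h 0) / (alpha * r * s))
      with (h 0 / (alpha * r * s) - h (Rpower e alpha) / (alpha * r * s))
      by (unfold Rdiv; ring).
    exact Kd. }
  rewrite (is_int_0_1_unique _ _ _ HJ HJ2), <- RtoC_mult; f_equal.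
  unfold s, c; rewrite <- atan_slit_value by (lra || assumption); fold s c.
  unfold h; replace ((0 / r - c) / s) with (- c / s) by (field; lra).
  field; repeat split; lra.
Qed.

(** * The series as contour integrals *)

Lemma expi_plus (a b : R) : expi (a + b) = (expi a * expi b)%C.
Proof. unfold expi, Cmult; simpl; rewrite cos_plus, sin_plus; f_equal; ring. Qed.

Lemma Cmod_expi (a : R) : Cmod (expi a) = 1.
Proof. rewrite <- cexp_expi, Cmod_cexp; apply exp_0. Qed.

Lemma expi_pow (a : R) (n : nat) : (expi a ^ n)%C = expi (INR n * a).
Proof.
induction n as [|n IH].
- simpl; rewrite Rmult_0_l; unfold expi; rewrite cos_0, sin_0; reflexivity.
- rewrite S_INR; replace ((INR n + 1) * a) with (a + INR n * a) by ring.
  rewrite expi_plus, <- IH; reflexivity.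
Qed.

Lemma ccontinuous_expi_comp (g : R -> R) (y : R) :
  continuous g y -> ccontinuous (fun t => expi (g t)) y.
Proof.
intros H; apply ccontinuous_pair; unfold expi; simpl.
- apply continuous_cos_comp, H.
- apply: continuous_comp; [exact H | apply continuous_sin].
Qed.

Lemma continuous_scal_id (a y : R) : continuous (fun t => a * t) y.
Proof. apply: continuous_mult; [apply continuous_const | apply continuous_id]. Qed.

Lemma continuous_opp_scal (a y : R) : continuous (fun t => - (a * t)) y.
Proof. apply: continuous_opp; apply continuous_scal_id. Qed.

Lemma ccontinuous_f_expi (f : C -> C) (y : R) :
  (forall z, ccontinuous f z) -> ccontinuous (fun t => f (expi t)) y.
Proof.
intros Hf; apply ccontinuous_comp; [|apply Hf].
apply ccontinuous_expi_comp, continuous_id.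
Qed.

Lemma one_sub_r_expi_neq_0 (r a : R) : 0 < r < 1 -> (1 - RtoC r * expi a)%C <> 0%C.
Proof.
intros Hr; apply Cmod_gt_0.
pose proof (Cmod_one_sub_ge (RtoC r * expi a)) as H.
rewrite Cmod_mult, Cmod_expi, Cmod_R, Rabs_pos_eq in H; lra.
Qed.

(** Sum and integral are exchanged through exact partial sums: the remainder [phi q^(n+1) / (1 - q)]
    is at most [M r^(n+1) / (1 - r)] uniformly in [y]. The sign of [sigma] selects the half of the
    two-sided series. *)
Lemma cint_geometric_series (phi : R -> C) (sigma r : R) :
  (forall y, ccontinuous phi y) -> 0 < r < 1 ->
  @is_series R_AbsRing C_R_NormedModule
    (fun n => RtoC (r ^ n) * cint (fun y => phi y * expi (- (INR n * (sigma * y))))%C (- PI) PI)%C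
    (cint (fun y => phi y / (1 - RtoC r * expi (- (sigma * y))))%C (- PI) PI).
Proof.
intros Hphi Hr.
pose proof PI_RGT_0 as Hpi.
set (q := fun y => (RtoC r * expi (- (sigma * y)))%C).
assert (Hq : forall y, (1 - q y)%C <> 0%C) by (intros y; apply one_sub_r_expi_neq_0, Hr).
assert (qc : forall y, ccontinuous q y).
{ intros y; apply ccontinuous_mult; [apply ccontinuous_const|].
  apply ccontinuous_expi_comp, continuous_opp_scal. }
assert (qm : forall y, Cmod (q y) = r).
{ intros y; unfold q; rewrite Cmod_mult, Cmod_expi, Cmod_R, Rabs_pos_eq; lra. }
assert (qn : forall n y, (q y ^ n)%C = (RtoC (r ^ n) * expi (- (INR n * (sigma * y))))%C).
{ intros n y; unfold q; rewrite Cpow_mult_l, expi_pow, <- RtoC_pow.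
  do 2 f_equal; ring. }
assert (qnc : forall n y, ccontinuous (fun t => (q t ^ n)%C) y).
{ intros n y; induction n as [|n IH]; simpl; [apply ccontinuous_const|].
  apply ccontinuous_mult; [apply qc | exact IH]. }
assert (Hterm : forall n, is_cint (fun y => phi y * q y ^ n)%C (- PI) PI
  (RtoC (r ^ n) * cint (fun y => phi y * expi (- (INR n * (sigma * y))))%C (- PI) PI)%C).
{ intros n.
  apply is_cint_ext with (fun y => RtoC (r ^ n) * (phi y * expi (- (INR n * (sigma * y)))))%C.
  { intros y _; rewrite qn; ring. }
  apply is_cint_mult, is_cint_of_continuous; intros y _.
  apply ccontinuous_mult; [apply Hphi|].
  apply ccontinuous_expi_comp.
  apply: continuous_opp; apply: continuous_mult; [apply continuous_const | apply continuous_scal_id]. }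
set (a := fun n => (RtoC (r ^ n) * cint (fun y => phi y * expi (- (INR n * (sigma * y))))%C (- PI) PI)%C) in *.
assert (Hsum : forall n, is_cint (fun y => phi y * (1 - q y ^ S n) / (1 - q y))%C (- PI) PI
  (@sum_n C_R_NormedModule a n)).
{ intros n; induction n as [|n IH].
  - rewrite sum_O; apply is_cint_ext with (2 := Hterm 0%nat).
    intros y _; simpl; field; apply Hq.
  - rewrite sum_Sn.
    apply is_cint_ext with (2 := is_cint_plus _ _ _ _ _ _ IH (Hterm (S n))).
    intros y _; rewrite (Cpow_S (q y) (S n)); field; apply Hq. }
set (L := cint (fun y => phi y / (1 - q y))%C (- PI) PI).
assert (HL : is_cint (fun y => phi y / (1 - q y))%C (- PI) PI L).
{ apply is_cint_of_continuous; intros y _; apply ccontinuous_div; [apply Hphi| |apply Hq].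
  apply ccontinuous_minus; [apply ccontinuous_const | apply qc]. }
destruct (ccontinuous_bounded phi (- PI) PI ltac:(lra)) as [M [HM BM]]; [intros; apply Hphi|].
apply (proj2 (filterlim_C_Cmod eventually (sum_n a) L)).
intros eps He.
set (K := 2 * PI * M / (1 - r)).
assert (HK : 0 < K) by (apply Rdiv_lt_0_compat; [nra | lra]).
destruct (pow_lt_1_zero r) with (y := eps / K) as [N HN].
{ rewrite Rabs_pos_eq; lra. }
{ apply Rdiv_lt_0_compat; assumption. }
exists N; intros n Hn.
specialize (HN (S n) ltac:(lia)); rewrite Rabs_pos_eq in HN by (apply pow_le; lra).
rewrite <- Cmod_opp, Copp_minus_distr.
apply Rle_lt_trans with (K * r ^ S n).
- pose proof (is_cint_minus _ _ _ _ _ _ HL (Hsum n)) as D.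
  apply Rle_trans with ((PI - - PI) * (M * r ^ S n / (1 - r))).
  2:{ unfold K; right; field; lra. }
  refine (Cmod_cint_le _ _ _ _ _ _ _ D); [lra|].
  intros y Hy; simpl.
  replace (phi y / (1 - q y) - phi y * (1 - q y * q y ^ n) / (1 - q y))%C
    with (phi y * (q y * q y ^ n) / (1 - q y))%C by (field; apply Hq).
  rewrite Cmod_div, !Cmod_mult, Cmod_pow, qm by apply Hq.
  pose proof (Cmod_one_sub_ge (q y)) as Hge; rewrite qm in Hge.
  specialize (BM y Hy).
  assert (0 < r * r ^ n) by (apply Rmult_lt_0_compat; [lra | apply pow_lt; lra]).
  pose proof (Cmod_ge_0 (phi y)).
  apply Rmult_le_compat; [nra| |nra|].
  + left; apply Rinv_0_lt_compat; lra.
  + apply Rinv_le_contravar; lra.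
- apply (Rmult_lt_compat_l K) in HN; [|exact HK].
  replace (K * (eps / K)) with eps in HN by (field; lra); exact HN.
Qed.

Lemma fsharp_cint (f : C -> C) (xi : R) :
  (forall z, ccontinuous f z) ->
  fsharp f xi = (RtoC (/ (2 * PI)) * cint (fun y => f (expi y) * expi (- (y * xi)))%C (- PI) PI)%C.
Proof.
intros Hf; pose proof PI_RGT_0 as Hpi.
unfold fsharp.
assert (I0 : is_cint (fun y => f (expi y) * expi (- (y * xi)))%C (- PI) PI
  (cint (fun y => f (expi y) * expi (- (y * xi)))%C (- PI) PI)).
{ apply is_cint_of_continuous; intros y _; apply ccontinuous_mult; [apply ccontinuous_f_expi, Hf|].
  apply ccontinuous_expi_comp; apply: continuous_opp; apply: continuous_mult;
    [apply continuous_id | apply continuous_const]. }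
apply is_cint_unique.
set (l := cint (fun y => f (expi y) * expi (- (y * xi)))%C (- PI) PI) in *.
replace (- PI) with (2 * PI * - (1 / 2) + 0) in I0 by field.
replace PI with (2 * PI * (1 / 2) + 0) in I0 at 2 by field.
apply (is_RInt_comp_lin (V := C_R_NormedModule)) in I0.
apply is_cint_mult with (c := RtoC (/ (2 * PI))) in I0.
revert I0; apply is_cint_ext; intros x _.
rewrite scal_C_R, Rplus_0_r, Cmult_assoc, <- RtoC_mult.
rewrite Rinv_l by lra; ring.
Qed.

Lemma is_series_C_mult (a : nat -> C) (c l : C) :
  @is_series R_AbsRing C_R_NormedModule a l ->
  @is_series R_AbsRing C_R_NormedModule (fun n => c * a n)%C (c * l)%C.
Proof.
intros H.
assert (E : forall n, @sum_n C_R_NormedModule (fun n => c * a n)%C n = (c * @sum_n C_R_NormedModule a n)%C).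
{ intros n; induction n as [|n IH]; [rewrite !sum_O; reflexivity|].
  rewrite !sum_Sn, IH.
  change ((c * sum_n a n + c * a (S n))%C = (c * (sum_n a n + a (S n)))%C).
  generalize (@sum_n C_R_NormedModule a n : C); intros; ring. }
apply (proj2 (filterlim_C_Cmod eventually _ _)); intros eps He.
pose proof (Cmod_ge_0 c) as Hc.
pose proof (proj1 (filterlim_C_Cmod eventually _ _) H (eps / (1 + Cmod c))
  ltac:(apply Rdiv_lt_0_compat; lra)) as K.
apply: filter_imp K => n Kn.
rewrite E; generalize dependent (@sum_n C_R_NormedModule a n : C); intros s Kn.
replace (c * s - c * l)%C with (c * (s - l))%C by ring.
rewrite Cmod_mult; pose proof (Cmod_ge_0 (s - l)).
assert (Cmod (s - l) * (1 + Cmod c) < eps).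
{ apply (Rmult_lt_compat_r (1 + Cmod c)) in Kn; [|lra].
  replace (eps / (1 + Cmod c) * (1 + Cmod c)) with eps in Kn by (field; lra); exact Kn. }
nra.
Qed.

Lemma Rpower_lambda_nat (lambda alpha : R) (n : nat) :
  Rpower lambda (alpha * INR n) = Rpower lambda alpha ^ n.
Proof. rewrite <- Rpower_mult, Rpower_pow; [reflexivity | apply exp_pos]. Qed.

Lemma IZR_neg_nat (n : nat) : IZR (- Z.of_nat (S n)) = - INR (S n).
Proof. rewrite opp_IZR, <- INR_IZR_INZ; reflexivity. Qed.

Lemma series_nonneg_cint (f : C -> C) (alpha lambda : R) :
  (forall z, ccontinuous f z) -> 0 < Rpower lambda alpha < 1 ->
  @is_series_nonneg R_AbsRing C_R_NormedModule
    (fun j : Z => fsharp f (alpha * IZR j) * RtoC (Rpower lambda (alpha * IZR j)))%C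
    (RtoC (/ (2 * PI)) *
     cint (fun y => f (expi y) / (1 - RtoC (Rpower lambda alpha) * expi (- (alpha * y))))%C (- PI) PI)%C.
Proof.
intros Hf Hr; unfold is_series_nonneg.
pose proof (is_series_C_mult _ (RtoC (/ (2 * PI))) _ (cint_geometric_series (fun y => f (expi y)) alpha
  (Rpower lambda alpha) (fun y => ccontinuous_f_expi f y Hf) Hr)) as H.
revert H; apply is_series_ext; intros n.
rewrite <- INR_IZR_INZ, fsharp_cint, Rpower_lambda_nat by exact Hf.
rewrite (RInt_ext (V := C_R_CompleteNormedModule) (fun y => f (expi y) * expi (- (y * (alpha * INR n))))%C
  (fun y => f (expi y) * expi (- (INR n * (alpha * y))))%C).
- assert (E : forall p q z : C, (p * (q * z) = p * z * q)%C) by (intros; ring).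
  apply E.
- intros y _; do 3 f_equal; ring.
Qed.

Lemma series_neg_cint (f : C -> C) (alpha lambda : R) :
  (forall z, ccontinuous f z) -> 0 < Rpower lambda alpha < 1 ->
  @is_series_neg R_AbsRing C_R_NormedModule
    (fun j : Z => fsharp f (alpha * IZR j) * RtoC (Rpower lambda (- (alpha * IZR j))))%C
    (RtoC (/ (2 * PI)) *
     cint (fun y => f (expi y) * (RtoC (Rpower lambda alpha) * expi (alpha * y))
                    / (1 - RtoC (Rpower lambda alpha) * expi (alpha * y)))%C (- PI) PI)%C.
Proof.
intros Hf Hr; unfold is_series_neg.
set (r := Rpower lambda alpha) in *.
(* The negative half starts at [j = -1], so the first factor of the geometric series is moved into
   [phi] and the summation index starts at 0 again. *)
set (phi := fun y => (f (expi y) * (RtoC r * expi (alpha * y)))%C).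
assert (Hphi : forall y, ccontinuous phi y).
{ intros y; apply ccontinuous_mult; [apply ccontinuous_f_expi, Hf|].
  apply ccontinuous_mult; [apply ccontinuous_const|].
  apply ccontinuous_expi_comp, continuous_scal_id. }
pose proof (is_series_C_mult _ (RtoC (/ (2 * PI))) _ (cint_geometric_series phi (- alpha) r Hphi Hr)) as H.
rewrite (RInt_ext (V := C_R_CompleteNormedModule) _
  (fun y => f (expi y) * (RtoC r * expi (alpha * y)) / (1 - RtoC r * expi (alpha * y)))%C) in H.
2:{ intros y _; unfold phi; do 5 f_equal; ring. }
revert H; apply is_series_ext; intros n.
rewrite IZR_neg_nat, fsharp_cint by exact Hf.
replace (- (alpha * - INR (S n))) with (alpha * INR (S n)) by ring.
rewrite Rpower_lambda_nat; fold r.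
assert (E : (RtoC r * cint (fun y => f (expi y) * expi (- (y * (alpha * - INR (S n)))))%C (- PI) PI)%C =
  cint (fun y => phi y * expi (- (INR n * (- alpha * y))))%C (- PI) PI).
{ symmetry; apply is_cint_unique.
  apply is_cint_ext with (fun y => RtoC r * (f (expi y) * expi (- (y * (alpha * - INR (S n))))))%C.
  - intros y _; unfold phi.
    rewrite S_INR.
    replace (- (y * (alpha * - (INR n + 1)))) with (alpha * y + - (INR n * (- alpha * y))) by ring.
    rewrite expi_plus; ring.
  - apply is_cint_mult, is_cint_of_continuous; intros y _.
    apply ccontinuous_mult; [apply ccontinuous_f_expi, Hf|].
    apply ccontinuous_expi_comp; apply: continuous_opp; apply: continuous_mult;
      [apply continuous_id | apply continuous_const]. }
rewrite <- E.
assert (E2 : forall p u v z : C, (p * (v * (u * z)) = p * z * (u * v))%C) by (intros; ring).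
simpl pow; rewrite RtoC_mult; apply E2.
Qed.

(** * The identities for lambda < 1 *)

Lemma Cmod2_sub_r_expi (u r b : R) :
  Cmod (RtoC u - RtoC r * expi (- b))%C ^ 2 = u ^ 2 - 2 * r * u * cos b + r ^ 2.
Proof.
rewrite Cmod2_alt; unfold expi, Re, Im; simpl; rewrite cos_neg, sin_neg.
assert (E2 : sin b * sin b = 1 - cos b * cos b) by (pose proof (sin2_cos2 b) as E'; unfold Rsqr in E'; lra).
ring [E2].
Qed.

Lemma Cmod2_expi_sub (v b : R) :
  Cmod (expi (- b) - RtoC v)%C ^ 2 = 1 - 2 * v * cos b + v ^ 2.
Proof.
replace (expi (- b) - RtoC v)%C with (- (RtoC v - RtoC 1 * expi (- b)))%C by ring.
rewrite Cmod_opp, Cmod2_sub_r_expi; ring.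
Qed.

Definition kernel3 (alpha r t : R) : R :=
  Rpower t (alpha - 1) * (1 - (Rpower t alpha) ^ 2) /
  ((Rpower t alpha ^ 2 - 2 * r * Rpower t alpha * cos (alpha * PI) + r ^ 2) *
   (1 - 2 * (r * Rpower t alpha) * cos (alpha * PI) + (r * Rpower t alpha) ^ 2)).

(** With [u = t^alpha] the mixed terms of the two denominators agree, and their difference is
    [(1 - r^2) (1 - u^2)]. [kernel3] is what remains after removing [1 - r^2], and so it still makes
    sense at [r = 1]. *)
Lemma kernel3_eq (alpha r t : R) :
  0 < alpha < 2 -> 0 < r ->
  (1 - r ^ 2) * kernel3 alpha r t = kernel1 alpha r t - kernel2 alpha r t.
Proof.
intros Ha Hr; unfold kernel1, kernel2, kernel3.
pose proof (kernel1_den_pos alpha r t Ha Hr) as H1.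
pose proof (kernel2_den_pos alpha r t Ha Hr) as H2.
field_simplify_eq; [ring|split; apply Rgt_not_eq; [exact H2 | exact H1] || lra].
Qed.

Lemma Rpower_mul_l (lambda t alpha : R) :
  0 < lambda -> 0 < t -> Rpower (lambda * t) alpha = Rpower lambda alpha * Rpower t alpha.
Proof. intros H1 H2; symmetry; apply Rpower_mult_distr; assumption. Qed.

Lemma Rpower_double (t alpha : R) : Rpower t (2 * alpha) = Rpower t alpha ^ 2.
Proof.
replace (2 * alpha) with (alpha + alpha) by ring.
rewrite Rpower_plus; ring.
Qed.

Lemma integrand1_eq (f : C -> C) (alpha lambda t : R) :
  0 < alpha < 2 ->
  (RtoC (Rpower t (alpha - 1)) * f (RtoC (- t))
    / RtoC (Cmod (RtoC (Rpower t alpha)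
                  - RtoC (Rpower lambda alpha) * expi (- (alpha * PI))) ^ 2))%C =
  (RtoC (kernel1 alpha (Rpower lambda alpha) t) * f (RtoC (- t)))%C.
Proof.
intros Ha; rewrite Cmod2_sub_r_expi.
pose proof (kernel1_den_pos alpha (Rpower lambda alpha) t Ha ltac:(apply exp_pos)) as H.
unfold kernel1; rewrite RtoC_div by lra; unfold Cdiv; ring.
Qed.

Lemma integrand2_eq (f : C -> C) (alpha lambda t : R) :
  0 < alpha < 2 -> 0 < lambda -> 0 < t ->
  (RtoC (Rpower t (alpha - 1)) * f (RtoC (- t))
    / RtoC (Cmod (expi (- (alpha * PI)) - RtoC (Rpower (lambda * t) alpha)) ^ 2))%C =
  (RtoC (kernel2 alpha (Rpower lambda alpha) t) * f (RtoC (- t)))%C.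
Proof.
intros Ha Hl Ht; rewrite Cmod2_expi_sub, Rpower_mul_l by assumption.
pose proof (kernel2_den_pos alpha (Rpower lambda alpha) t Ha ltac:(apply exp_pos)) as H.
unfold kernel2; rewrite RtoC_div by lra; unfold Cdiv; ring.
Qed.

Lemma integrand3_eq (f : C -> C) (alpha lambda t : R) :
  0 < alpha < 2 -> 0 < lambda -> 0 < t ->
  (RtoC (Rpower t (alpha - 1)) * RtoC (1 - Rpower t (2 * alpha)) * f (RtoC (- t))
    / RtoC (Cmod ((RtoC (Rpower t alpha)
                   - RtoC (Rpower lambda alpha) * expi (- (alpha * PI)))
                  * (expi (- (alpha * PI)) - RtoC (Rpower (lambda * t) alpha))) ^ 2))%C =
  (RtoC (kernel3 alpha (Rpower lambda alpha) t) * f (RtoC (- t)))%C.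
Proof.
intros Ha Hl Ht; rewrite Cmod_mult, Rpow_mult_distr.
rewrite Cmod2_sub_r_expi, Cmod2_expi_sub, Rpower_mul_l, Rpower_double by assumption.
pose proof (kernel1_den_pos alpha (Rpower lambda alpha) t Ha ltac:(apply exp_pos)) as H1.
pose proof (kernel2_den_pos alpha (Rpower lambda alpha) t Ha ltac:(apply exp_pos)) as H2.
unfold kernel3; rewrite RtoC_div by (apply Rmult_integral_contrapositive_currified; lra).
rewrite (RtoC_mult (Rpower t (alpha - 1))).
unfold Cdiv; ring.
Qed.

(** The constant of [quad_cos_ge]: the denominators of [kernel1] and [kernel2] are at least this
    times [r^2] and this, respectively, uniformly in [t] and up to [r = 1]. *)
Definition den_margin (alpha : R) : R := (1 - cos (alpha * PI)) / 2.

Lemma den_margin_pos (alpha : R) : 0 < alpha < 2 -> 0 < den_margin alpha.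
Proof. intros Ha; pose proof (cos_alpha_PI_lt_1 alpha Ha); unfold den_margin; lra. Qed.

Lemma kernel1_den_ge (alpha r t : R) :
  0 < alpha < 2 -> 0 < r ->
  den_margin alpha * r ^ 2 <=
  Rpower t alpha ^ 2 - 2 * r * Rpower t alpha * cos (alpha * PI) + r ^ 2.
Proof.
intros Ha Hr; pose proof (COS_bound (alpha * PI)).
apply quad_cos_ge; try lra; left; apply exp_pos.
Qed.

Lemma kernel2_den_ge (alpha r t : R) :
  0 < alpha < 2 -> 0 < r ->
  den_margin alpha <=
  1 - 2 * (r * Rpower t alpha) * cos (alpha * PI) + (r * Rpower t alpha) ^ 2.
Proof.
intros Ha Hr; pose proof (COS_bound (alpha * PI)).
assert (0 < Rpower t alpha) by apply exp_pos.
pose proof (quad_cos_ge (cos (alpha * PI)) (r * Rpower t alpha) 1 ltac:(lra) ltac:(nra) ltac:(lra) ltac:(lra)).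
unfold den_margin; nra.
Qed.

Lemma Rabs_div_le (x y a b : R) : Rabs x <= a -> 0 < b <= y -> Rabs (x / y) <= a / b.
Proof.
intros Hx Hy; unfold Rdiv; rewrite Rabs_mult, Rabs_inv, (Rabs_pos_eq y) by lra.
apply Rmult_le_compat; [apply Rabs_pos| |exact Hx|].
- left; apply Rinv_0_lt_compat; lra.
- apply Rinv_le_contravar; lra.
Qed.

Lemma Rpower_le_1 (t alpha : R) : 0 < alpha -> 0 < t <= 1 -> 0 < Rpower t alpha <= 1.
Proof.
intros Ha Ht; split; [apply exp_pos|].
replace 1 with (Rpower 1 alpha) by (unfold Rpower; rewrite ln_1, Rmult_0_r, exp_0; reflexivity).
apply Rle_Rpower_l; lra.
Qed.

(** * Existence of the kernel integrals *)

Lemma ex_kernel_int (f : C -> C) (k : R -> R) (alpha K : R) :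
  (forall z, ccontinuous f z) -> 0 < alpha ->
  (forall t, 0 < t -> continuous k t) ->
  (forall t, 0 < t <= 1 -> Rabs (k t) <= K * Rpower t (alpha - 1)) ->
  exists I, is_int_0_1 (fun t => RtoC (k t) * f (RtoC (- t)))%C I.
Proof.
intros Hf Ha Hk HK.
destruct (ccontinuous_bounded (fun t => f (RtoC (- t))) 0 1 ltac:(lra)) as [B [HB Bf]].
{ intros t Ht; apply ccontinuous_comp; [|apply Hf].
  apply ccontinuous_RtoC; apply: continuous_opp; apply continuous_id. }
assert (HK0 : 0 <= K).
{ specialize (HK 1 ltac:(lra)); unfold Rpower in HK; rewrite ln_1, Rmult_0_r, exp_0 in HK.
  pose proof (Rabs_pos (k 1)); lra. }
destruct (ex_is_int_0_1 (fun t => RtoC (k t) * f (RtoC (- t)))%C (K * B) alpha Ha ltac:(nra)) as [I [HI _]].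
- apply ccontinuous_kernel_f; assumption.
- intros t Ht; rewrite Cmod_mult, Cmod_R.
  specialize (HK t Ht); specialize (Bf t ltac:(lra)).
  replace (K * B * Rpower t (alpha - 1)) with (K * Rpower t (alpha - 1) * B) by ring.
  apply Rmult_le_compat; [apply Rabs_pos | apply Cmod_ge_0 | exact HK | exact Bf].
- exists I; exact HI.
Qed.

Lemma Rpower_div_le (x a b t alpha : R) :
  Rabs x <= a -> 0 < b -> Rabs (Rpower t (alpha - 1) * x) / b <= a / b * Rpower t (alpha - 1).
Proof.
intros Hx Hb; rewrite Rabs_mult, (Rabs_pos_eq (Rpower _ _)) by (left; apply exp_pos).
assert (0 < Rpower t (alpha - 1)) by apply exp_pos.
apply Rle_div_l; [exact Hb|].
replace (a / b * Rpower t (alpha - 1) * b) with (a * Rpower t (alpha - 1)) by (field; lra).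
nra.
Qed.

Lemma ex_kernel1_int (f : C -> C) (alpha r : R) :
  (forall z, ccontinuous f z) -> 0 < alpha < 2 -> 0 < r ->
  exists I, is_int_0_1 (fun t => RtoC (kernel1 alpha r t) * f (RtoC (- t)))%C I.
Proof.
intros Hf Ha Hr; pose proof (den_margin_pos alpha Ha).
assert (Hm : 0 < den_margin alpha * r ^ 2) by (apply Rmult_lt_0_compat; [assumption | nra]).
apply ex_kernel_int with alpha (1 / (den_margin alpha * r ^ 2)); [exact Hf | lra | |].
- intros t Ht; apply continuous_kernel1; assumption || lra.
- intros t Ht; unfold kernel1.
  eapply Rle_trans; [apply Rabs_div_le; [apply Rle_refl | split; [exact Hm | apply kernel1_den_ge; lra]]|].
  rewrite <- (Rmult_1_r (Rpower t (alpha - 1))) at 1.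
  apply Rpower_div_le; [rewrite Rabs_R1; lra | exact Hm].
Qed.

Lemma ex_kernel2_int (f : C -> C) (alpha r : R) :
  (forall z, ccontinuous f z) -> 0 < alpha < 2 -> 0 < r ->
  exists I, is_int_0_1 (fun t => RtoC (kernel2 alpha r t) * f (RtoC (- t)))%C I.
Proof.
intros Hf Ha Hr; pose proof (den_margin_pos alpha Ha) as Hm.
apply ex_kernel_int with alpha (1 / den_margin alpha); [exact Hf | lra | |].
- intros t Ht; apply continuous_kernel2; assumption || lra.
- intros t Ht; unfold kernel2.
  eapply Rle_trans; [apply Rabs_div_le; [apply Rle_refl | split; [exact Hm | apply kernel2_den_ge; lra]]|].
  rewrite <- (Rmult_1_r (Rpower t (alpha - 1))) at 1.
  apply Rpower_div_le; [rewrite Rabs_R1; lra | exact Hm].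
Qed.

Lemma continuous_kernel3 (alpha r t : R) :
  0 < alpha < 2 -> 0 < r -> 0 < t -> continuous (kernel3 alpha r) t.
Proof.
intros Ha Hr Ht.
apply continuous_ext with (fun t => kernel1 alpha r t * ((1 - (Rpower t alpha) ^ 2) * / (1 - 2 * (r * Rpower t alpha) * cos (alpha * PI) + (r * Rpower t alpha) ^ 2))).
{ intros x; unfold kernel1, kernel3, Rdiv; rewrite Rinv_mult.
  match goal with |- ?a = ?b => change (@eq R a b) end; ring. }
apply: continuous_mult; [apply continuous_kernel1; assumption || lra|].
apply: continuous_mult.
- apply: continuous_minus; [apply continuous_const|].
  simpl; repeat apply: continuous_mult; try apply continuous_const; apply continuous_Rpower, Ht.
- apply continuous_Rinv_comp; [|apply Rgt_not_eq, kernel2_den_pos; assumption].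
  apply: continuous_plus.
  + apply: continuous_minus; [apply continuous_const|].
    repeat apply: continuous_mult; try apply continuous_const; apply continuous_Rpower, Ht.
  + simpl; repeat apply: continuous_mult; try apply continuous_const; apply continuous_Rpower, Ht.
Qed.

Lemma ex_kernel3_int (f : C -> C) (alpha r : R) :
  (forall z, ccontinuous f z) -> 0 < alpha < 2 -> 0 < r ->
  exists I, is_int_0_1 (fun t => RtoC (kernel3 alpha r t) * f (RtoC (- t)))%C I.
Proof.
intros Hf Ha Hr; pose proof (den_margin_pos alpha Ha) as H0.
assert (Hm : 0 < den_margin alpha * r ^ 2) by (apply Rmult_lt_0_compat; [assumption | nra]).
assert (Hm2 : 0 < den_margin alpha * r ^ 2 * den_margin alpha) by (apply Rmult_lt_0_compat; assumption).
apply ex_kernel_int with alpha (1 / (den_margin alpha * r ^ 2 * den_margin alpha)); [exact Hf | lra | |].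
- intros t Ht; apply continuous_kernel3; assumption || lra.
- intros t Ht; unfold kernel3.
  eapply Rle_trans; [apply Rabs_div_le; [apply Rle_refl | split; [exact Hm2|]]|].
  + apply Rmult_le_compat; try lra; [apply kernel1_den_ge; lra | apply kernel2_den_ge; lra].
  + apply Rpower_div_le; [|exact Hm2].
    pose proof (Rpower_le_1 t alpha ltac:(lra) Ht); apply Rabs_le; nra.
Qed.

Lemma identity1_of_lt_1 (f : C -> C) (alpha lambda : R) :
  (forall z, ccontinuous f z) ->
  (forall z, Cmod z < 1 -> exists l, is_cderive f z l) ->
  0 < alpha < 2 -> 0 < lambda < 1 -> identity1 f alpha lambda.
Proof.
intros fc fh Ha Hl; pose proof PI_RGT_0 as Hpi.
set (r := Rpower lambda alpha).
assert (Hr : 0 < r < 1).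
{ split; [apply exp_pos|].
  replace 1 with (Rpower 1 alpha) by (unfold Rpower; rewrite ln_1, Rmult_0_r, exp_0; reflexivity).
  apply Rlt_Rpower_l; lra. }
destruct (ex_kernel1_int f alpha r fc Ha ltac:(lra)) as [I HI].
(* [J] is the integral for the constant function 1; it measures the effect of subtracting
   [f lambda]. *)
destruct (ex_kernel1_int (fun _ => RtoC 1) alpha r (fun z => ccontinuous_const (U := C_UniformSpace) _ z) Ha ltac:(lra)) as [J HJ].
assert (HJ' : is_int_0_1 (fun t => RtoC (kernel1 alpha r t)) J).
{ revert HJ; apply is_int_0_1_ext; intros; ring. }
assert (HIJ : is_int_0_1 (fun t => RtoC (kernel1 alpha r t) * (f (RtoC (- t)) - f (RtoC lambda)))%C
  (I - f (RtoC lambda) * J)%C).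
{ assert (Ck : forall t, 0 < t <= 1 -> ccontinuous (fun t => RtoC (kernel1 alpha r t)) t)
    by (intros t Ht; apply ccontinuous_RtoC, continuous_kernel1; lra).
  pose proof (is_int_0_1_minus _ _ _ _ HI (is_int_0_1_mult _ (f (RtoC lambda)) _ Ck HJ')) as H.
  revert H; apply is_int_0_1_ext; intros; ring. }
pose proof (contour_inner f alpha lambda _ fc fh Ha Hl HIJ) as HC.
pose proof (kernel1_integral alpha r J Ha Hr HJ') as HK.
pose proof (cint_geometric_kernel alpha r ltac:(lra) Hr) as HG.
fold r in HC.
set (A := atan (r * sin (alpha * PI) / (1 - r * cos (alpha * PI)))) in *.
set (q := fun y => (1 - RtoC r * expi (- (alpha * y)))%C).
assert (Hq : forall y, q y <> 0%C) by (intros; apply one_sub_r_expi_neq_0, Hr).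
assert (HT : is_cint (fun y => f (expi y) / q y)%C (- PI) PI
  (RtoC (- (2 * r * sin (alpha * PI))) * (I - f (RtoC lambda) * J)
   + f (RtoC lambda) * RtoC (2 * PI + 2 / alpha * A))%C).
{ rewrite <- HC.
  apply is_cint_ext with (fun y => (f (expi y) - f (RtoC lambda)) / q y + f (RtoC lambda) * / q y)%C.
  { intros y _; field; apply Hq. }
  apply is_cint_plus; [|apply is_cint_mult, HG].
  apply is_cint_of_continuous; intros y _.
  apply ccontinuous_div; [| |apply Hq].
  - apply ccontinuous_minus; [apply ccontinuous_f_expi, fc | apply ccontinuous_const].
  - apply ccontinuous_minus; [apply ccontinuous_const|].
    apply ccontinuous_mult; [apply ccontinuous_const|].
    apply ccontinuous_expi_comp, continuous_opp_scal. }
pose proof (series_nonneg_cint f alpha lambda fc Hr) as HS.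
apply is_cint_unique in HT; unfold q in HT.
fold r in HS; rewrite HT in HS.
eexists; exists I; split; [exact HS|]; split.
- revert HI; apply is_int_0_1_ext; intros t _; symmetry; apply integrand1_eq, Ha.
- fold r.
  assert (HK2 : (RtoC (2 * r * sin (alpha * PI)) * J)%C = RtoC (2 / alpha * (PI - alpha * PI - A))).
  { rewrite (RtoC_mult (2 / alpha)), <- HK, Cmult_assoc, <- RtoC_mult; do 2 f_equal; field; lra. }
  transitivity (RtoC (alpha * / (2 * PI)) * (f (RtoC lambda) * (RtoC (2 / alpha * (PI - alpha * PI - A))
     + RtoC (2 * PI + 2 / alpha * A)) - RtoC (2 * r * sin (alpha * PI)) * I))%C.
  { rewrite <- HK2, RtoC_opp, (RtoC_mult alpha); ring. }
  rewrite <- RtoC_plus.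
  (* The arctangent [A] cancels between the two explicit computations for the constant function; the
     remaining [2 PI / alpha] is normalised to 1 by [alpha / (2 PI)], which produces the term
     [f lambda]. *)
  replace (2 / alpha * (PI - alpha * PI - A) + (2 * PI + 2 / alpha * A)) with (2 * PI / alpha) by (field; lra).
  transitivity (f (RtoC lambda) * RtoC (alpha * / (2 * PI) * (2 * PI / alpha))
    - RtoC (alpha * / (2 * PI) * (2 * r * sin (alpha * PI))) * I)%C.
  { rewrite !(RtoC_mult (alpha * / (2 * PI))); ring. }
  replace (alpha * / (2 * PI) * (2 * PI / alpha)) with 1 by (field; lra).
  replace (alpha * / (2 * PI) * (2 * r * sin (alpha * PI))) with (alpha * r * sin (alpha * PI) / PI) by (field; lra).
  ring.
Qed.

Lemma identity2_of_lt_1 (f : C -> C) (alpha lambda : R) :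
  (forall z, ccontinuous f z) ->
  (forall z, Cmod z < 1 -> exists l, is_cderive f z l) ->
  0 < alpha < 2 -> 0 < lambda < 1 -> identity2 f alpha lambda.
Proof.
intros fc fh Ha Hl; pose proof PI_RGT_0 as Hpi.
set (r := Rpower lambda alpha).
assert (Hr : 0 < r < 1).
{ split; [apply exp_pos|].
  replace 1 with (Rpower 1 alpha) by (unfold Rpower; rewrite ln_1, Rmult_0_r, exp_0; reflexivity).
  apply Rlt_Rpower_l; lra. }
destruct (ex_kernel2_int f alpha r fc Ha ltac:(lra)) as [I HI].
pose proof (series_neg_cint f alpha lambda fc Hr) as HS.
fold r in HS; rewrite (contour_outer f alpha r I fc fh Ha Hr HI) in HS.
eexists; exists I; split; [exact HS|]; split.
- revert HI; apply is_int_0_1_ext; intros t Ht; symmetry; apply integrand2_eq; lra.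
- fold r; rewrite !Cmult_assoc, <- !RtoC_mult; do 2 f_equal; field; lra.
Qed.

Lemma identity3_of_identity12 (f : C -> C) (alpha lambda : R) :
  (forall z, ccontinuous f z) -> 0 < alpha < 2 -> 0 < lambda ->
  identity1 f alpha lambda -> identity2 f alpha lambda -> identity3 f alpha lambda.
Proof.
intros fc Ha Hl [S1 [I1 [HS1 [HI1 E1]]]] [S2 [I2 [HS2 [HI2 E2]]]].
set (r := Rpower lambda alpha) in *.
assert (Hr : 0 < r) by apply exp_pos.
(* [I3] comes from its own bound and not as [(I1 - I2) / (1 - r^2)], so the argument covers
   [lambda = 1] as well. *)
destruct (ex_kernel3_int f alpha r fc Ha Hr) as [I3 HI3].
assert (E3 : (RtoC (1 - r ^ 2) * I3)%C = (I1 - I2)%C).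
{ apply (is_int_0_1_unique (fun t => RtoC (1 - r ^ 2) * (RtoC (kernel3 alpha r t) * f (RtoC (- t))))%C).
  - apply is_int_0_1_mult; [|exact HI3].
    apply ccontinuous_kernel_f; [exact fc|]; intros; apply continuous_kernel3; assumption.
  - pose proof (is_int_0_1_minus _ _ _ _ HI1 HI2) as H12.
    revert H12; apply is_int_0_1_ext; intros t Ht.
    unfold r at 1; rewrite integrand1_eq, integrand2_eq by lra.
    rewrite Cmult_assoc, <- RtoC_mult; fold r; rewrite kernel3_eq, RtoC_minus by lra; ring. }
exists (S1 + S2)%C, I3; split; [|split].
- exists S1, S2; split; [|split; [|reflexivity]].
  + revert HS1; unfold is_series_nonneg; apply is_series_ext; intros n.
    rewrite Z.abs_eq by lia; reflexivity.
  + revert HS2; unfold is_series_neg; apply is_series_ext; intros n.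
    rewrite Z.abs_neq by lia; rewrite (opp_IZR (- Z.of_nat (S n))).
    do 3 f_equal; ring.
- revert HI3; apply is_int_0_1_ext; intros t Ht; symmetry; apply integrand3_eq; lra.
- rewrite Rpower_double; fold r.
  rewrite Cmult_plus_distr_l, E1, E2.
  replace (alpha * r * (1 - r ^ 2) * sin (alpha * PI) / PI)
    with (alpha * r * sin (alpha * PI) / PI * (1 - r ^ 2)) by (unfold Rdiv; ring).
  rewrite (RtoC_mult (alpha * r * sin (alpha * PI) / PI)), <- Cmult_assoc, E3; ring.
Qed.

(** * The limit lambda = 1 *)

(** With [m] the margin, [r >= 1/2] makes the denominators at least [m / 4] and [m]. They differ by
    [(1 - r) (1 + r - 2 u c)], which is at most [4 (1 - r)] in modulus; hence the 16. This explicit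
    rate in [1 - r] does the work of dominated convergence. *)
Lemma kernel1_sub_le (alpha r t : R) :
  0 < alpha < 2 -> 1 / 2 <= r <= 1 -> 0 < t <= 1 ->
  Rabs (kernel1 alpha r t - kernel1 alpha 1 t) <=
  16 * (1 - r) / den_margin alpha ^ 2 * Rpower t (alpha - 1).
Proof.
intros Ha Hr Ht.
pose proof (den_margin_pos alpha Ha) as Hm.
pose proof (kernel1_den_ge alpha r t Ha ltac:(lra)) as H1.
pose proof (kernel1_den_ge alpha 1 t Ha ltac:(lra)) as H2.
pose proof (Rpower_le_1 t alpha ltac:(lra) Ht) as Hu.
pose proof (COS_bound (alpha * PI)) as Hc.
unfold kernel1.
set (u := Rpower t alpha) in *; set (c := cos (alpha * PI)) in *; set (m := den_margin alpha) in *.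
assert (H1' : m / 4 <= u ^ 2 - 2 * r * u * c + r ^ 2)
  by (eapply Rle_trans; [|exact H1]; assert (1 / 4 <= r ^ 2) by nra; nra).
assert (H2' : m <= u ^ 2 - 2 * 1 * u * c + 1 ^ 2) by (rewrite pow1, Rmult_1_r in H2; lra).
assert (HN : Rabs ((u ^ 2 - 2 * 1 * u * c + 1 ^ 2) - (u ^ 2 - 2 * r * u * c + r ^ 2)) <= 4 * (1 - r)).
{ match goal with |- Rabs ?e <= _ => replace e with ((1 - r) * (1 + r - 2 * (u * c))) by ring end.
  assert (Huc : -1 <= u * c <= 1) by nra.
  rewrite Rabs_mult, (Rabs_pos_eq (1 - r)) by lra.
  rewrite Rmult_comm; apply Rmult_le_compat_r; [lra|].
  apply Rabs_le; lra. }
set (A1 := u ^ 2 - 2 * 1 * u * c + 1 ^ 2) in *; set (Ar := u ^ 2 - 2 * r * u * c + r ^ 2) in *.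
set (p := Rpower t (alpha - 1)).
replace (p / Ar - p / A1) with (p * (A1 - Ar) / (Ar * A1)) by (field; lra).
eapply Rle_trans.
- apply Rabs_div_le; [apply Rle_refl|].
  split; [|apply Rmult_le_compat; [| |exact H1'|exact H2']; lra]; nra.
- eapply Rle_trans; [apply Rpower_div_le; [exact HN | nra]|].
  right; fold p; field; lra.
Qed.

(** Both denominators are at least [m] here; the weaker [m / 4] is used to reach the constant of
    [kernel1_sub_le], so that [kernel_int_limit] serves both kernels. *)
Lemma kernel2_sub_le (alpha r t : R) :
  0 < alpha < 2 -> 1 / 2 <= r <= 1 -> 0 < t <= 1 ->
  Rabs (kernel2 alpha r t - kernel2 alpha 1 t) <=
  16 * (1 - r) / den_margin alpha ^ 2 * Rpower t (alpha - 1).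
Proof.
intros Ha Hr Ht.
pose proof (den_margin_pos alpha Ha) as Hm.
pose proof (kernel2_den_ge alpha r t Ha ltac:(lra)) as H1.
pose proof (kernel2_den_ge alpha 1 t Ha ltac:(lra)) as H2.
pose proof (Rpower_le_1 t alpha ltac:(lra) Ht) as Hu.
pose proof (COS_bound (alpha * PI)) as Hc.
unfold kernel2.
set (u := Rpower t alpha) in *; set (c := cos (alpha * PI)) in *; set (m := den_margin alpha) in *.
assert (HN : Rabs ((1 - 2 * (1 * u) * c + (1 * u) ^ 2) - (1 - 2 * (r * u) * c + (r * u) ^ 2)) <= 4 * (1 - r)).
{ match goal with |- Rabs ?e <= _ => replace e with ((1 - r) * (u * (u * (1 + r)) - 2 * (u * c))) by ring end.
  assert (Huc : -1 <= u * c <= 1) by nra.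
  assert (Huu : 0 <= u * (u * (1 + r)) <= 2) by nra.
  rewrite Rabs_mult, (Rabs_pos_eq (1 - r)) by lra.
  rewrite Rmult_comm; apply Rmult_le_compat_r; [lra|].
  apply Rabs_le; lra. }
set (A1 := 1 - 2 * (1 * u) * c + (1 * u) ^ 2) in *; set (Ar := 1 - 2 * (r * u) * c + (r * u) ^ 2) in *.
set (p := Rpower t (alpha - 1)).
assert (H1' : m / 4 <= Ar) by lra.
replace (p / Ar - p / A1) with (p * (A1 - Ar) / (Ar * A1)) by (field; lra).
eapply Rle_trans.
- apply Rabs_div_le; [apply Rle_refl|].
  split; [|apply Rmult_le_compat; [| |exact H1'|exact H2]; lra]; nra.
- eapply Rle_trans; [apply Rpower_div_le; [exact HN | nra]|].
  right; fold p; field; lra.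
Qed.

Lemma Cmod_kernel_int_sub_le (f : C -> C) (k k' : R -> R) (alpha K B : R) (I I' : C) :
  (forall z, ccontinuous f z) -> 0 < alpha -> 0 <= K -> 0 <= B ->
  (forall t, 0 < t -> continuous k t) -> (forall t, 0 < t -> continuous k' t) ->
  (forall t, 0 < t <= 1 -> Rabs (k t - k' t) <= K * Rpower t (alpha - 1)) ->
  (forall t, 0 < t <= 1 -> Cmod (f (RtoC (- t))) <= B) ->
  is_int_0_1 (fun t => RtoC (k t) * f (RtoC (- t)))%C I ->
  is_int_0_1 (fun t => RtoC (k' t) * f (RtoC (- t)))%C I' ->
  Cmod (I - I')%C <= K * B / alpha.
Proof.
intros Hf Ha HK HB Hk Hk' Hkk HBf HI HI'.
destruct (ex_is_int_0_1 (fun t => RtoC (k t) * f (RtoC (- t)) - RtoC (k' t) * f (RtoC (- t)))%C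
  (K * B) alpha Ha ltac:(nra)) as [J [HJ HJB]].
- intros t Ht; apply ccontinuous_minus; apply (ccontinuous_kernel_f f); assumption.
- intros t Ht.
  replace (RtoC (k t) * f (RtoC (- t)) - RtoC (k' t) * f (RtoC (- t)))%C
    with (RtoC (k t - k' t) * f (RtoC (- t)))%C by (rewrite RtoC_minus; ring).
  rewrite Cmod_mult, Cmod_R.
  replace (K * B * Rpower t (alpha - 1)) with (K * Rpower t (alpha - 1) * B) by ring.
  apply Rmult_le_compat; [apply Rabs_pos | apply Cmod_ge_0 | apply Hkk, Ht | apply HBf, Ht].
- rewrite (is_int_0_1_unique _ _ _ (is_int_0_1_minus _ _ _ _ HI HI') HJ); exact HJB.
Qed.

Lemma Cmod_le_of_filterlim (u : nat -> C) (l : C) (B : R) :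
  filterlim u eventually (@locally C_UniformSpace l) ->
  (forall n, Cmod (u n) <= B) -> Cmod l <= B.
Proof.
intros H HB; apply le_epsilon; intros eps He.
destruct (proj1 (filterlim_C_Cmod eventually u l) H eps He) as [N HN].
specialize (HN N (le_n N)).
replace l with (u N + - (u N - l))%C by ring.
eapply Rle_trans; [apply Cmod_triangle|]; rewrite Cmod_opp.
specialize (HB N); lra.
Qed.

(** Under absolute convergence the tail beyond some [N] is small uniformly in [r], and Bernoulli's
    inequality [1 - r^n <= n (1 - r)] controls the first terms by one bound on [1 - r]. The shift
    [k] is 0 for the nonnegative half and 1 for the negative one. *)
Lemma abel_limit (a : nat -> C) (s : R) (k : nat) (S1 : C) :
  @is_series R_AbsRing R_NormedModule (fun n => Cmod (a n)) s ->
  @is_series R_AbsRing C_R_NormedModule a S1 ->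
  forall eps, 0 < eps -> exists d, 0 < d /\ forall r S, 0 < r < 1 -> 1 - r < d ->
    @is_series R_AbsRing C_R_NormedModule (fun n => a n * RtoC (r ^ (n + k)))%C S ->
    Cmod (S1 - S)%C <= eps.
Proof.
intros Hs HS1 eps He.
set (A := @sum_n R_NormedModule (fun n => Cmod (a n))).
assert (HAS : forall n, A (S n) = A n + Cmod (a (S n))) by (intros n; unfold A; rewrite sum_Sn; reflexivity).
assert (Hlim : is_lim_seq A s) by exact Hs.
assert (HAs : forall n, A n <= s).
{ apply is_lim_seq_incr_compare; [exact Hlim|].
  intros n; rewrite HAS; pose proof (Cmod_ge_0 (a (S n))); lra. }
assert (HA0 : forall n, 0 <= A n).
{ intros n; induction n as [|n IH].
  - unfold A; rewrite sum_O; apply Cmod_ge_0.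
  - rewrite HAS; pose proof (Cmod_ge_0 (a (S n))); lra. }
assert (Hmono : forall n m, (n <= m)%nat -> A n <= A m).
{ intros n m H; induction H as [|m H IH]; [lra|].
  rewrite HAS; pose proof (Cmod_ge_0 (a (S m))); lra. }
assert (Hs0 : 0 <= s) by (specialize (HA0 0%nat); specialize (HAs 0%nat); lra).
assert (He2 : 0 < eps / 2) by lra.
destruct (proj2 (is_lim_seq_spec A s) Hlim (mkposreal _ He2)) as [N HN].
specialize (HN N (le_n N)); simpl in HN.
apply Rabs_lt_between in HN.
(* [eta] times the sum of all moduli stays below [eps / 2]; the added 1 covers [s = 0]. *)
set (eta := eps / (2 * (s + 1))).
assert (Heta : 0 < eta) by (apply Rdiv_lt_0_compat; lra).
exists (eta / INR (S (N + k))); split.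
{ apply Rdiv_lt_0_compat; [exact Heta | apply lt_0_INR; lia]. }
intros r S Hr Hd HS.
assert (Bern : forall n, 1 - r ^ n <= INR n * (1 - r)).
{ intros n; induction n as [|n IH]; [simpl; lra|].
  rewrite S_INR; simpl.
  assert (0 <= 1 - r ^ n) by (pose proof (pow_incr r 1 n ltac:(lra)) as P; rewrite pow1 in P; lra).
  nra. }
assert (Hpow : forall n, 0 < r ^ n <= 1).
{ intros n; split; [apply pow_lt; lra|].
  pose proof (pow_incr r 1 n ltac:(lra)) as P; rewrite pow1 in P; lra. }
assert (Hsmall : forall n, (n <= N)%nat -> 1 - r ^ (n + k) <= eta).
{ intros n Hn; eapply Rle_trans; [apply Bern|].
  apply Rle_trans with (INR (Datatypes.S (N + k)) * (1 - r)).
  - apply Rmult_le_compat_r; [lra | apply le_INR; lia].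
  - apply (Rmult_lt_compat_l (INR (Datatypes.S (N + k)))) in Hd; [|apply lt_0_INR; lia].
    replace (INR (Datatypes.S (N + k)) * (eta / INR (Datatypes.S (N + k)))) with eta in Hd
      by (field; apply not_0_INR; lia).
    lra. }
set (b := fun n => (a n - a n * RtoC (r ^ (n + k)))%C).
assert (Hb : forall n, Cmod (b n) = Cmod (a n) * (1 - r ^ (n + k))).
{ intros n; unfold b.
  replace (a n - a n * RtoC (r ^ (n + k)))%C with (a n * RtoC (1 - r ^ (n + k)))%C
    by (rewrite RtoC_minus; ring).
  rewrite Cmod_mult, Cmod_R, Rabs_pos_eq; [reflexivity|].
  specialize (Hpow (n + k)%nat); lra. }
(* Terms up to [N] are paid for by [eta], later ones in full by [A n - A N]; [Rmax] merges both
   ranges into a single induction. *)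
assert (Hsum : forall n, Cmod (@sum_n C_R_NormedModule b n) <= eta * A n + Rmax 0 (A n - A N)).
{ intros n; induction n as [|n IH].
  - rewrite sum_O, Hb; unfold A at 1; rewrite sum_O.
    pose proof (Rmax_l 0 (A 0%nat - A N)); pose proof (Cmod_ge_0 (a 0%nat)).
    specialize (Hsmall 0%nat ltac:(lia)); nra.
  - rewrite sum_Sn; eapply Rle_trans; [apply Cmod_triangle|].
    rewrite Hb, HAS.
    pose proof (Cmod_ge_0 (a (Datatypes.S n))) as Ha.
    specialize (Hpow (Datatypes.S n + k)%nat).
    destruct (le_lt_dec (Datatypes.S n) N) as [Hn|Hn].
    + specialize (Hsmall (Datatypes.S n) Hn).
      assert (Rmax 0 (A n - A N) <= Rmax 0 (A n + Cmod (a (Datatypes.S n)) - A N))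
        by (apply Rle_max_compat_l; lra).
      nra.
    + pose proof (Hmono N n ltac:(lia)) as Hm.
      rewrite Rmax_right in IH |- * by lra.
      assert (Cmod (a (Datatypes.S n)) * (1 - r ^ (Datatypes.S n + k)) <= Cmod (a (Datatypes.S n))) by nra.
      nra. }
pose proof (is_series_minus (V := C_R_NormedModule) _ _ _ _ HS1 HS) as Hdiff.
apply (Cmod_le_of_filterlim _ (S1 - S)%C eps Hdiff).
intros n; eapply Rle_trans; [exact (Hsum n)|].
assert (E1 : eta * A n <= eps / 2).
{ apply Rle_trans with (eta * (s + 1)).
  - apply Rmult_le_compat_l; [lra|]; specialize (HAs n); lra.
  - right; unfold eta; field; lra. }
assert (E2 : Rmax 0 (A n - A N) <= eps / 2).
{ apply Rmax_lub; [lra|]; specialize (HAs n); lra. }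
lra.
Qed.

(** The common shape of (1) and (2) with [r = lambda^alpha]: the factor of the integral is
    [kappa * r], and [kappa] is its value at [lambda = 1]. *)
Lemma limit_identity (alpha kappa : R) (S1 I1 v1 : C) :
  (forall d, 0 < d -> exists r S I v, 0 < r < 1 /\ 1 - r <= d /\
     Cmod (S1 - S)%C <= d /\ Cmod (I - I1)%C <= d /\ Cmod (v - v1)%C <= d /\
     (RtoC alpha * S)%C = (v - RtoC (kappa * r) * I)%C) ->
  (RtoC alpha * S1)%C = (v1 - RtoC kappa * I1)%C.
Proof.
intros H; apply Ceq_minus, Cmod_eq_0, Rle_antisym; [|apply Cmod_ge_0].
(* [K] collects the coefficients of [d] in the error: [alpha] from the series, 1 from [v], and the
   rest from [kappa I1 - kappa r I = kappa ((1 - r) I1 - r (I - I1))]. *)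
set (K := Rabs alpha + 1 + Rabs kappa * (Cmod I1 + 1)).
assert (HK : 0 < K).
{ unfold K; pose proof (Rabs_pos alpha); pose proof (Rabs_pos kappa); pose proof (Cmod_ge_0 I1); nra. }
apply le_epsilon; intros eps He; rewrite Rplus_0_l.
destruct (H (eps / K)) as [r [S [I [v [Hr [Hd [HS [HI [Hv E]]]]]]]]]; [apply Rdiv_lt_0_compat; lra|].
set (d := eps / K) in *.
replace (RtoC alpha * S1 - (v1 - RtoC kappa * I1))%C with
  (RtoC alpha * (S1 - S) + ((v - v1) + RtoC kappa * (RtoC (1 - r) * I1 + - (RtoC r * (I - I1)))))%C.
2:{ transitivity (RtoC alpha * S1 - RtoC alpha * S + ((v - v1) + RtoC kappa * (RtoC (1 - r) * I1 - RtoC r * (I - I1))))%C; [ring|].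
    rewrite E, RtoC_minus, RtoC_mult; ring. }
apply Rle_trans with (Rabs alpha * d + (d + Rabs kappa * (d * Cmod I1 + d))).
- eapply Rle_trans; [apply Cmod_triangle|]; apply Rplus_le_compat.
  { rewrite Cmod_mult, Cmod_R; apply Rmult_le_compat_l; [apply Rabs_pos | exact HS]. }
  eapply Rle_trans; [apply Cmod_triangle|]; apply Rplus_le_compat; [exact Hv|].
  rewrite Cmod_mult, Cmod_R; apply Rmult_le_compat_l; [apply Rabs_pos|].
  eapply Rle_trans; [apply Cmod_triangle|].
  rewrite Cmod_opp, !Cmod_mult, !Cmod_R, !Rabs_pos_eq by lra.
  pose proof (Cmod_ge_0 I1); pose proof (Cmod_ge_0 (I - I1)).
  apply Rplus_le_compat; nra.
- right; replace eps with (d * K) by (unfold d; field; lra); unfold K; ring.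
Qed.

Lemma Rpower_1_l (x : R) : Rpower 1 x = 1.
Proof. unfold Rpower; rewrite ln_1, Rmult_0_r, exp_0; reflexivity. Qed.

Lemma lambda_near_1 (alpha d : R) :
  0 < alpha -> 0 < d ->
  exists lambda, 0 < lambda < 1 /\ 1 - lambda < d /\ 0 < Rpower lambda alpha < 1 /\
    1 - Rpower lambda alpha < d.
Proof.
intros Ha Hd.
pose proof (continuous_Rpower alpha 1 Rlt_0_1 _ (locally_ball _ (mkposreal _ Hd))) as [e He].
set (h := Rmin (Rmin (e / 2) (d / 2)) (1 / 2)).
assert (Hh : 0 < h) by (pose proof (cond_pos e); repeat apply Rmin_glb_lt; lra).
assert (H1 : h <= e / 2) by (eapply Rle_trans; [apply Rmin_l | apply Rmin_l]).
assert (H2 : h <= d / 2) by (eapply Rle_trans; [apply Rmin_l | apply Rmin_r]).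
assert (H3 : h <= 1 / 2) by apply Rmin_r.
clearbody h.
assert (B : ball 1 e (1 - h)).
{ change (Rabs (1 - h - 1) < e).
  replace (1 - h - 1) with (- h) by ring; rewrite Rabs_Ropp, Rabs_pos_eq; lra. }
specialize (He _ B).
change (Rabs (Rpower (1 - h) alpha - Rpower 1 alpha) < d) in He.
rewrite Rpower_1_l in He; apply Rabs_lt_between in He.
exists (1 - h); repeat split; try lra; [apply exp_pos|].
assert (K : Rpower (1 - h) alpha < Rpower 1 alpha) by (apply Rlt_Rpower_l; lra).
rewrite Rpower_1_l in K; exact K.
Qed.

Lemma f_slit_bounded (f : C -> C) :
  (forall z, ccontinuous f z) ->
  exists B, 0 < B /\ forall t, 0 < t <= 1 -> Cmod (f (RtoC (- t))) <= B.
Proof.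
intros Hf.
destruct (ccontinuous_bounded (fun t => f (RtoC (- t))) 0 1 ltac:(lra)) as [B [HB Bf]].
{ intros t Ht; apply ccontinuous_comp; [|apply Hf].
  apply ccontinuous_RtoC; apply: continuous_opp; apply continuous_id. }
exists B; split; [exact HB|]; intros t Ht; apply Bf; lra.
Qed.

Lemma ex_series_C_abs (a : nat -> C) (s : R) :
  @is_series R_AbsRing R_NormedModule (fun n => Cmod (a n)) s ->
  exists l, @is_series R_AbsRing C_R_NormedModule a l.
Proof.
intros H.
apply (ex_series_le (V := C_R_CompleteNormedModule) a (fun n => Cmod (a n))).
- intros n; right; apply norm_C_R.
- exists s; exact H.
Qed.

Lemma kernel_int_limit (f : C -> C) (k : R -> R -> R) (alpha : R) :
  (forall z, ccontinuous f z) -> 0 < alpha < 2 ->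
  (forall r t, 0 < r -> 0 < t -> continuous (k r) t) ->
  (forall r t, 1 / 2 <= r <= 1 -> 0 < t <= 1 ->
     Rabs (k r t - k 1 t) <= 16 * (1 - r) / den_margin alpha ^ 2 * Rpower t (alpha - 1)) ->
  forall eps, 0 < eps -> exists d, 0 < d /\ forall r I I1, 0 < r < 1 -> 1 - r < d ->
    is_int_0_1 (fun t => RtoC (k r t) * f (RtoC (- t)))%C I ->
    is_int_0_1 (fun t => RtoC (k 1 t) * f (RtoC (- t)))%C I1 ->
    Cmod (I - I1)%C <= eps.
Proof.
intros Hf Ha Hk Hkk eps He.
destruct (f_slit_bounded f Hf) as [B [HB Bf]].
pose proof (den_margin_pos alpha Ha) as Hm.
set (m := den_margin alpha) in *.
assert (Hm2 : 0 < m ^ 2) by (apply pow_lt, Hm).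
assert (Hd : 0 < eps * alpha * m ^ 2 / (16 * B)).
{ apply Rdiv_lt_0_compat; [apply Rmult_lt_0_compat; [nra | exact Hm2] | lra]. }
(* The first bound gives [r >= 1/2], the range of the kernel estimate; the second solves
   [16 (1 - r) B / (m^2 alpha) <= eps]. *)
exists (Rmin (1 / 2) (eps * alpha * m ^ 2 / (16 * B))); split; [apply Rmin_glb_lt; lra|].
intros r I I1 Hr Hrd HI HI1.
pose proof (Rlt_le_trans _ _ _ Hrd (Rmin_l _ _)) as H1.
pose proof (Rlt_le_trans _ _ _ Hrd (Rmin_r _ _)) as H2.
apply Rle_trans with (16 * (1 - r) / m ^ 2 * B / alpha).
- apply (Cmod_kernel_int_sub_le f (k r) (k 1)); try assumption; try lra.
  + apply Rmult_le_pos; [lra | left; apply Rinv_0_lt_compat, Hm2].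
  + intros; apply Hk; lra.
  + intros; apply Hk; lra.
  + intros; apply Hkk; lra.
- apply Rle_div_l; [lra|].
  replace (16 * (1 - r) / m ^ 2 * B) with ((1 - r) * (16 * B) / m ^ 2) by (field; lra).
  apply Rle_div_l; [exact Hm2|].
  apply (Rmult_lt_compat_r (16 * B)) in H2; [|lra].
  replace (eps * alpha * m ^ 2 / (16 * B) * (16 * B)) with (eps * alpha * m ^ 2) in H2 by (field; lra).
  lra.
Qed.

Lemma identity1_at_1 (f : C -> C) (alpha s : R) :
  (forall z, ccontinuous f z) -> 0 < alpha < 2 ->
  (forall lambda, 0 < lambda < 1 -> identity1 f alpha lambda) ->
  @is_series_nonneg R_AbsRing R_NormedModule (fun j : Z => Cmod (fsharp f (alpha * IZR j))) s ->
  identity1 f alpha 1.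
Proof.
intros fc Ha H Hs; unfold is_series_nonneg in Hs.
set (a := fun n : nat => fsharp f (alpha * IZR (Z.of_nat n))) in *.
destruct (ex_series_C_abs a s Hs) as [S1 HS1].
destruct (ex_kernel1_int f alpha 1 fc Ha Rlt_0_1) as [I1 HI1].
exists S1, I1; split; [|split].
- revert HS1; apply is_series_ext; intros n; rewrite Rpower_1_l; symmetry; apply Cmult_1_r.
- revert HI1; apply is_int_0_1_ext; intros t Ht.
  rewrite integrand1_eq, Rpower_1_l by exact Ha; reflexivity.
- rewrite Rpower_1_l, Rmult_1_r.
  apply limit_identity; intros d Hd.
  destruct (abel_limit a s 0 S1 Hs HS1 d Hd) as [d1 [Hd1 K1]].
  destruct (kernel_int_limit f (kernel1 alpha) alpha fc Ha
    (fun r t Hr Ht => continuous_kernel1 alpha r t Ha Hr Ht)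
    (fun r t Hr Ht => kernel1_sub_le alpha r t Ha Hr Ht) d Hd) as [d2 [Hd2 K2]].
  pose proof (proj1 (filterlim_C_Cmod _ _ _) (fc (RtoC 1)) d Hd) as K3.
  apply locally_C_Cmod in K3; destruct K3 as [d3 [Hd3 K3]].
  destruct (lambda_near_1 alpha (Rmin (Rmin d1 d2) (Rmin d3 d))) as [lambda [Hl [Hl1 [Hr Hr1]]]];
    [lra | repeat apply Rmin_glb_lt; assumption|].
  assert (M1 : Rmin (Rmin d1 d2) (Rmin d3 d) <= d1) by (eapply Rle_trans; [apply Rmin_l | apply Rmin_l]).
  assert (M2 : Rmin (Rmin d1 d2) (Rmin d3 d) <= d2) by (eapply Rle_trans; [apply Rmin_l | apply Rmin_r]).
  assert (M3 : Rmin (Rmin d1 d2) (Rmin d3 d) <= d3) by (eapply Rle_trans; [apply Rmin_r | apply Rmin_l]).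
  assert (M4 : Rmin (Rmin d1 d2) (Rmin d3 d) <= d) by (eapply Rle_trans; [apply Rmin_r | apply Rmin_r]).
  destruct (H lambda Hl) as [S [I [HS [HI E]]]].
  exists (Rpower lambda alpha), S, I, (f (RtoC lambda)).
  split; [exact Hr|]; split; [lra|]; split; [|split; [|split]].
  + apply (K1 (Rpower lambda alpha)); [exact Hr | lra|].
    revert HS; unfold is_series_nonneg; apply is_series_ext; intros n.
    unfold a; rewrite <- INR_IZR_INZ, Rpower_lambda_nat, Nat.add_0_r; reflexivity.
  + apply (K2 (Rpower lambda alpha)); [exact Hr | lra| |exact HI1].
    revert HI; apply is_int_0_1_ext; intros t Ht; apply integrand1_eq, Ha.
  + left; apply K3; rewrite <- RtoC_minus, Cmod_R, Rabs_minus_sym, Rabs_pos_eq; lra.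
  + rewrite E; do 3 f_equal; unfold Rdiv; ring.
Qed.

Lemma identity2_at_1 (f : C -> C) (alpha s : R) :
  (forall z, ccontinuous f z) -> 0 < alpha < 2 ->
  (forall lambda, 0 < lambda < 1 -> identity2 f alpha lambda) ->
  @is_series_neg R_AbsRing R_NormedModule (fun j : Z => Cmod (fsharp f (alpha * IZR j))) s ->
  identity2 f alpha 1.
Proof.
intros fc Ha H Hs; unfold is_series_neg in Hs.
set (a := fun n : nat => fsharp f (alpha * IZR (- Z.of_nat (S n)))) in *.
destruct (ex_series_C_abs a s Hs) as [S1 HS1].
destruct (ex_kernel2_int f alpha 1 fc Ha Rlt_0_1) as [I1 HI1].
exists S1, I1; split; [|split].
- revert HS1; apply is_series_ext; intros n; rewrite Rpower_1_l; symmetry; apply Cmult_1_r.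
- revert HI1; apply is_int_0_1_ext; intros t Ht.
  rewrite integrand2_eq, Rpower_1_l by lra; reflexivity.
- rewrite Rpower_1_l, Rmult_1_r.
  (* (2) is brought to the shape of [limit_identity] with [v = 0] and a negative [kappa]. *)
  transitivity (0 - RtoC (- (alpha * sin (alpha * PI) / PI)) * I1)%C; [|rewrite RtoC_opp; ring].
  apply limit_identity; intros d Hd.
  (* The shift is 1 because the term of index [n] belongs to [j = -(n + 1)] and carries the power
     [r^(n + 1)]. *)
  destruct (abel_limit a s 1 S1 Hs HS1 d Hd) as [d1 [Hd1 K1]].
  destruct (kernel_int_limit f (kernel2 alpha) alpha fc Ha
    (fun r t Hr Ht => continuous_kernel2 alpha r t Ha Hr Ht)
    (fun r t Hr Ht => kernel2_sub_le alpha r t Ha Hr Ht) d Hd) as [d2 [Hd2 K2]].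
  destruct (lambda_near_1 alpha (Rmin (Rmin d1 d2) d)) as [lambda [Hl [Hl1 [Hr Hr1]]]];
    [lra | repeat apply Rmin_glb_lt; assumption|].
  assert (M1 : Rmin (Rmin d1 d2) d <= d1) by (eapply Rle_trans; [apply Rmin_l | apply Rmin_l]).
  assert (M2 : Rmin (Rmin d1 d2) d <= d2) by (eapply Rle_trans; [apply Rmin_l | apply Rmin_r]).
  assert (M4 : Rmin (Rmin d1 d2) d <= d) by apply Rmin_r.
  destruct (H lambda Hl) as [S [I [HS [HI E]]]].
  exists (Rpower lambda alpha), S, I, (RtoC 0).
  split; [exact Hr|]; split; [lra|]; split; [|split; [|split]].
  + apply (K1 (Rpower lambda alpha)); [exact Hr | lra|].
    revert HS; unfold is_series_neg; apply is_series_ext; intros n.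
    unfold a; rewrite IZR_neg_nat.
    replace (- (alpha * - INR (Datatypes.S n))) with (alpha * INR (Datatypes.S n)) by ring.
    rewrite Rpower_lambda_nat, Nat.add_1_r; reflexivity.
  + apply (K2 (Rpower lambda alpha)); [exact Hr | lra| |exact HI1].
    revert HI; apply is_int_0_1_ext; intros t Ht; apply integrand2_eq; lra.
  + replace (0 - 0)%C with (RtoC 0) by ring; rewrite Cmod_0; lra.
  + rewrite E.
    replace (- (alpha * sin (alpha * PI) / PI) * Rpower lambda alpha)
      with (- (alpha * Rpower lambda alpha * sin (alpha * PI) / PI)) by (unfold Rdiv; ring).
    rewrite RtoC_opp; ring.
Qed.

(** * Extension from the closed disk to the plane *)

(* [f] composed with this map is continuous on all of [C], so that no one-sided
   continuity at the unit circle is needed. *)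
Definition disk_retract (z : C) : C := (z / RtoC (Rmax 1 (Cmod z)))%C.

Lemma disk_retract_id (z : C) : Cmod z <= 1 -> disk_retract z = z.
Proof.
intros H; unfold disk_retract; rewrite Rmax_left by exact H; field.
Qed.

Lemma Rmax_Cmod_pos (z : C) : 0 < Rmax 1 (Cmod z).
Proof. pose proof (Rmax_l 1 (Cmod z)); lra. Qed.

Lemma RtoC_neq_0 (x : R) : x <> 0 -> RtoC x <> 0%C.
Proof. intros H E; injection E; exact H. Qed.

Lemma Cmod_disk_retract_le (z : C) : Cmod (disk_retract z) <= 1.
Proof.
pose proof (Rmax_Cmod_pos z) as H.
unfold disk_retract; rewrite Cmod_div, Cmod_R, Rabs_pos_eq by (lra || apply RtoC_neq_0; lra).
apply Rle_div_l; [exact H|]; rewrite Rmult_1_l; apply Rmax_r.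
Qed.

Lemma ccontinuous_disk_retract (z : C) : ccontinuous disk_retract z.
Proof.
pose proof (Rmax_Cmod_pos z) as H.
apply (ccontinuous_div (U := C_UniformSpace)); [apply ccontinuous_id| |apply RtoC_neq_0; lra].
apply (ccontinuous_RtoC (U := C_UniformSpace)).
apply (continuous_ext (T := C_UniformSpace) (U := R_UniformSpace)
  (fun w => / 2 * (1 + Cmod w + Rabs (1 - Cmod w)))).
{ intros w; change (/ 2 * (1 + Cmod w + Rabs (1 - Cmod w)) = Rmax 1 (Cmod w)).
  unfold Rmax; destruct (Rle_dec 1 (Cmod w)).
  - rewrite Rabs_left1 by lra; field.
  - rewrite Rabs_pos_eq by lra; field. }
pose proof (continuous_Cmod_comp (U := C_UniformSpace) (fun w => w) z (ccontinuous_id z)) as Hc.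
apply: continuous_mult; [apply continuous_const|].
apply: continuous_plus.
- apply: continuous_plus; [apply continuous_const | exact Hc].
- apply (continuous_comp (U := C_UniformSpace) (V := R_UniformSpace) (fun w => 1 - Cmod w) Rabs);
    [|apply continuous_Rabs].
  apply: continuous_minus; [apply continuous_const | exact Hc].
Qed.

(** The retraction takes all its values in the closed disk, so it tends to its limit even along the
    [within] filter for which [f] is assumed continuous. *)
Lemma ccontinuous_retracted (f : C -> C) (z : C) :
  continuous_on_closed_disk f -> ccontinuous (fun w => f (disk_retract w)) z.
Proof.
intros Hf.
apply (filterlim_comp _ _ _ disk_retract f (@locally C_UniformSpace z)
  (within (fun w : C => Cmod w <= 1) (@locally C_UniformSpace (disk_retract z)))).
- intros P HP.
  pose proof (ccontinuous_disk_retract z _ HP) as H.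
  unfold filtermap in *.
  apply: filter_imp H => w Hw; apply Hw, Cmod_disk_retract_le.
- apply Hf, Cmod_disk_retract_le.
Qed.

(** Around a point of the open disk the retraction is the identity, so the derivative of [f] is
    kept. *)
Lemma ex_cderive_retracted (f : C -> C) (z : C) :
  holomorphic_in_disk f -> Cmod z < 1 ->
  exists l, is_cderive (fun w => f (disk_retract w)) z l.
Proof.
intros Hf Hz.
destruct (ex_derive_is_cderive f z (Hf z Hz)) as [l Hl]; exists l.
revert Hl; apply is_cderive_ext_loc.
exists (1 - Cmod z); split; [lra|]; intros w Hw.
rewrite disk_retract_id; [reflexivity|].
replace w with ((w - z) + z)%C by ring.
eapply Rle_trans; [apply Cmod_triangle | lra].
Qed.

Lemma fsharp_ext (f g : C -> C) (xi : R) :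
  (forall z, Cmod z <= 1 -> f z = g z) -> fsharp f xi = fsharp g xi.
Proof.
intros H; apply (RInt_ext (V := C_R_CompleteNormedModule)); intros x _.
rewrite H; [reflexivity | rewrite Cmod_expi; lra].
Qed.

Lemma identity1_ext (f g : C -> C) (alpha lambda : R) :
  (forall z, Cmod z <= 1 -> f z = g z) -> 0 < lambda <= 1 ->
  identity1 f alpha lambda -> identity1 g alpha lambda.
Proof.
intros E Hl [S [I [HS [HI HE]]]]; exists S, I; split; [|split].
- revert HS; apply is_series_ext; intros n; rewrite (fsharp_ext f g _ E); reflexivity.
- revert HI; apply is_int_0_1_ext; intros t Ht.
  rewrite E; [reflexivity | rewrite Cmod_R, Rabs_Ropp, Rabs_pos_eq; lra].
- rewrite HE, E; [reflexivity | rewrite Cmod_R, Rabs_pos_eq; lra].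
Qed.

Lemma identity2_ext (f g : C -> C) (alpha lambda : R) :
  (forall z, Cmod z <= 1 -> f z = g z) ->
  identity2 f alpha lambda -> identity2 g alpha lambda.
Proof.
intros E [S [I [HS [HI HE]]]]; exists S, I; split; [|split].
- revert HS; apply is_series_ext; intros n; rewrite (fsharp_ext f g _ E); reflexivity.
- revert HI; apply is_int_0_1_ext; intros t Ht.
  rewrite E; [reflexivity | rewrite Cmod_R, Rabs_Ropp, Rabs_pos_eq; lra].
- exact HE.
Qed.

Lemma is_series_Z_ext {K : AbsRing} {V : NormedModule K} (a b : Z -> V) (l : V) :
  (forall j, a j = b j) -> is_series_Z a l -> is_series_Z b l.
Proof.
intros E [l1 [l2 [H1 [H2 ->]]]]; exists l1, l2; split; [|split; [|reflexivity]].
- revert H1; apply is_series_ext; intros n; apply E.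
- revert H2; apply is_series_ext; intros n; apply E.
Qed.

Lemma identity3_ext (f g : C -> C) (alpha lambda : R) :
  (forall z, Cmod z <= 1 -> f z = g z) -> 0 < lambda <= 1 ->
  identity3 f alpha lambda -> identity3 g alpha lambda.
Proof.
intros E Hl [S [I [HS [HI HE]]]]; exists S, I; split; [|split].
- revert HS; apply is_series_Z_ext; intros j; rewrite (fsharp_ext f g _ E); reflexivity.
- revert HI; apply is_int_0_1_ext; intros t Ht.
  rewrite E; [reflexivity | rewrite Cmod_R, Rabs_Ropp, Rabs_pos_eq; lra].
- rewrite HE, E; [reflexivity | rewrite Cmod_R, Rabs_pos_eq; lra].
Qed.

Theorem theorem2p1 (f : C -> C)
  (f_cont : continuous_on_closed_disk f)
  (f_hol : holomorphic_in_disk f)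
  (alpha : R) (alpha_bounds : 0 < alpha < 2) :
  (forall lambda : R, 0 < lambda < 1 ->
     identity1 f alpha lambda /\ identity2 f alpha lambda /\ identity3 f alpha lambda)
  /\
  ((exists s : R,
      @is_series_Z R_AbsRing R_NormedModule
        (fun j : Z => Cmod (fsharp f (alpha * IZR j))) s) ->
     identity1 f alpha 1 /\ identity2 f alpha 1 /\ identity3 f alpha 1
     /\ exists S : C,
          @is_series_Z R_AbsRing C_R_NormedModule
            (fun j : Z => fsharp f (alpha * IZR j)) S
          /\ (RtoC alpha * S = f (RtoC 1))%C).
Proof.
(* The identities evaluate the function only on the closed disk, where [g] and [f] agree; they are
   proved for [g] and transferred. *)
set (g := fun w => f (disk_retract w)).
assert (gc : forall z, ccontinuous g z) by (intros z; apply ccontinuous_retracted, f_cont).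
assert (gh : forall z, Cmod z < 1 -> exists l, is_cderive g z l)
  by (intros z Hz; apply ex_cderive_retracted; assumption).
assert (gf : forall z, Cmod z <= 1 -> g z = f z)
  by (intros z Hz; unfold g; rewrite disk_retract_id; [reflexivity | exact Hz]).
pose proof (fun lambda Hl => identity1_of_lt_1 g alpha lambda gc gh alpha_bounds Hl) as H1.
pose proof (fun lambda Hl => identity2_of_lt_1 g alpha lambda gc gh alpha_bounds Hl) as H2.
split.
- intros lambda Hl; split; [|split].
  + apply (identity1_ext g); [exact gf | lra | apply H1, Hl].
  + apply (identity2_ext g); [exact gf | apply H2, Hl].
  + apply (identity3_ext g); [exact gf | lra|].
    apply identity3_of_identity12; [exact gc | exact alpha_bounds | lra | apply H1, Hl | apply H2, Hl].
- intros [s Hs].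
  assert (Hs' : is_series_Z (fun j : Z => Cmod (fsharp g (alpha * IZR j))) s).
  { revert Hs; apply is_series_Z_ext; intros j; rewrite (fsharp_ext g f _ gf); reflexivity. }
  destruct Hs' as [s1 [s2 [Hs1 [Hs2 _]]]].
  pose proof (identity1_at_1 g alpha s1 gc alpha_bounds H1 Hs1) as K1.
  pose proof (identity2_at_1 g alpha s2 gc alpha_bounds H2 Hs2) as K2.
  pose proof (identity3_of_identity12 g alpha 1 gc alpha_bounds Rlt_0_1 K1 K2) as K3.
  apply (identity3_ext g f) in K3; [|exact gf | lra].
  split; [apply (identity1_ext g); [exact gf | lra | exact K1]|].
  split; [apply (identity2_ext g); [exact gf | exact K2]|].
  split; [exact K3|].
  destruct K3 as [S [I [HS [_ E]]]]; exists S; split.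
  + revert HS; apply is_series_Z_ext; intros j; rewrite Rpower_1_l; apply Cmult_1_r.
  (* At [lambda = 1] the factor [1 - lambda^(2 alpha)] is 0 and removes the integral from (3). *)
  + rewrite E, !Rpower_1_l, Rminus_diag, Rmult_0_r; unfold Rdiv; rewrite !Rmult_0_l; ring.
Qed.
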